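(* Let $\Omega\subset\mathbb{R}^2$ be a bounded Lipschitz domain with connected complement, $V\in L^\infty(\Omega)$ possibly complex-valued, $k>0$, and let $v,w\in H^1(\Omega)$ be a pair of eigenfunctions of $$(\Delta+k^2(1+V))w=0\ \text{ in }\Omega,\qquad(\Delta+k^2)v=0\ \text{ in }\Omega,\qquad w=v,\ \ \partial_\nu w=\partial_\nu v\ \text{ on }\partial\Omega.$$ Assume that $\Omega$ contains a corner $\Omega\cap W$ with vertex $\mathbf{x}_c$, where $W$ is an open sector with boundary angles $\theta_m,\theta_M$ satisfying $-\pi<\theta_m<\theta_M<\pi$ and $\theta_M-\theta_m\ne\pi$, and let $S_h=W\cap B(\mathbf{x}_c,h)$, with $h>0$ sufficiently small, be a neighbourhood of $\mathbf{x}_c$ in $\Omega$. Assume that $qw\in C^\alpha(\overline{S}_h)$ for some $0<\alpha<1$, where $q:=1+V$, and that $v$ can be approximated in $H^1(S_h)$ by Herglotz functions $v_j$, $j=1,2,\dots$, with kernels $g_j$ satisfying $$\|v-v_j\|_{H^1(S_h)}\le j^{-\Upsilon},\qquad\|g_j\|_{L^2(\mathbb{S}^1)}\le Cj^{\varrho}$$ for some constants $C>0$, $\Upsilon>0$ and $\varrho<\alpha\Upsilon/2$. Then $$\lim_{\rho\to+0}\frac{1}{m(B(\mathbf{x}_c,\rho)\cap\Omega)}\int_{B(\mathbf{x}_c,\rho)\cap\Omega}V(\mathbf{x})w(\mathbf{x})\,d\mathbf{x}=0.$$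
   Context: The sector with vertex at the origin is $W=\{\mathbf{x}\in\mathbb{R}^2:\ \mathbf{x}\ne\mathbf{0},\ \theta_m<\arg(x_1+\mathbf{i}x_2)<\theta_M\}$; for a general vertex it is translated so that the vertex is $\mathbf{x}_c$. That $\Omega$ contains the corner means that $\Omega$ coincides with $W$ near $\mathbf{x}_c$, i.e. $\Omega\cap B(\mathbf{x}_c,h)=S_h$ for small $h$. $\nu$ is the exterior unit normal to $\partial\Omega$, and $m$ is Lebesgue measure. A Herglotz function with kernel $g_j\in L^2(\mathbb{S}^1)$ is $v_j(\mathbf{x})=\int_{\mathbb{S}^1}e^{ik\xi\cdot\mathbf{x}}g_j(\xi)\,d\sigma(\xi)$, $\mathbf{x}\in\mathbb{R}^2$. *)

(* Defs.v *)
From HB Require Import structures.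
From mathcomp Require Import all_boot all_order all_algebra.
From mathcomp Require Import all_classical all_reals all_analysis.
From mathcomp Require Import complex.

Set Implicit Arguments.
Unset Strict Implicit.
Unset Printing Implicit Defensive.

Import Order.TTheory GRing.Theory Num.Theory.
Import numFieldNormedType.Exports.
Import ComplexField.Normc.

Local Open Scope classical_set_scope.
Local Open Scope ring_scope.
Local Open Scope complex_scope.

(* [R * R] carries the max norm as a normedModType: its topology, hence
   [open], [closure], [continuous], ..., is the usual one of the plane, but the
   Euclidean distance has to be introduced separately. *)
Definition edist (R : realType) (x y : R * R) : R :=
  Num.sqrt ((x.1 - y.1) ^+ 2 + (x.2 - y.2) ^+ 2).

Definition eball (R : realType) (c : R * R) (r : R) : set (R * R) :=
  [set x | edist x c < r].

Definition mu2 (R : realType) :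
    {measure set (measurableTypeR R * measurableTypeR R) -> \bar R} :=
  (@lebesgue_measure R \x @lebesgue_measure R)%E.

Definition Cmeasurable (R : realType) (d : measure_display)
    (T : measurableType d) (D : set T) (f : T -> R[i]) : Prop :=
  measurable_fun D (fun x => complex.Re (f x) : measurableTypeR R) /\
  measurable_fun D (fun x => complex.Im (f x) : measurableTypeR R).

Definition Cintegral (R : realType) (d : measure_display)
    (T : measurableType d) (mu : {measure set T -> \bar R}) (D : set T)
    (f : T -> R[i]) : R[i] :=
  Rintegral mu D (fun x => complex.Re (f x))
  +i* Rintegral mu D (fun x => complex.Im (f x)).

Definition sqL2norm (R : realType) (d : measure_display)
    (T : measurableType d) (mu : {measure set T -> \bar R}) (D : set T)
    (f : T -> R[i]) : \bar R :=
  (\int[mu]_(x in D) ((normc (f x)) ^+ 2)%:E)%E.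

Definition L2 (R : realType) (d : measure_display)
    (T : measurableType d) (mu : {measure set T -> \bar R}) (D : set T)
    (f : T -> R[i]) : Prop :=
  Cmeasurable D f /\ (sqL2norm mu D f < +oo)%E.

Definition Linfty (R : realType) (d : measure_display)
    (T : measurableType d) (mu : {measure set T -> \bar R}) (D : set T)
    (f : T -> R[i]) : Prop :=
  Cmeasurable D f /\
  exists M : R, {ae mu, forall x, D x -> normc (f x) <= M}.

Definition e1 (R : realType) : R * R := (1, 0).
Definition e2 (R : realType) : R * R := (0, 1).

Fixpoint Cn (R : realType) (n : nat) (f : R * R -> R) : Prop :=
  match n with
  | 0%N => continuous f
  | n'.+1 => [/\ continuous f,
                 forall x, derivable f x (e1 R) /\ derivable f x (e2 R),
                 Cn n' (fun x => 'D_(e1 R) f x) &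
                 Cn n' (fun x => 'D_(e2 R) f x)]
  end.

Definition test_function (R : realType) (Omega : set (R * R))
    (phi : R * R -> R) : Prop :=
  (forall n, Cn n phi) /\
  exists K : set (R * R),
    [/\ compact K, K `<=` Omega & forall x, ~ K x -> phi x = 0].

Definition laplacian (R : realType) (phi : R * R -> R) (x : R * R) : R :=
  'D_(e1 R) (fun y => 'D_(e1 R) phi y) x + 'D_(e2 R) (fun y => 'D_(e2 R) phi y) x.

Definition Cpartial (R : realType) (e : R * R) (f : R * R -> R[i])
    (x : R * R) : R[i] :=
  'D_e (fun y => complex.Re (f y)) x +i* 'D_e (fun y => complex.Im (f y)) x.

(* A complex vector field (e.g. a gradient) is a map into [R[i] * R[i]]. *)
Definition Cgrad (R : realType) (f : R * R -> R[i]) (x : R * R) :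
    R[i] * R[i] :=
  (Cpartial (e1 R) f x, Cpartial (e2 R) f x).

(* Bilinear, i.e. without complex conjugation. *)
Definition cdot (R : realType) (a b : R[i] * R[i]) : R[i] :=
  a.1 * b.1 + a.2 * b.2.

Definition weak_partial (R : realType) (Omega : set (R * R)) (e : R * R)
    (u g : R * R -> R[i]) : Prop :=
  forall phi : R * R -> R, test_function Omega phi ->
    Cintegral (mu2 R) Omega (fun x => u x * ('D_e phi x)%:C) =
    - Cintegral (mu2 R) Omega (fun x => g x * (phi x)%:C).

(* [H1 Omega u Du]: u belongs to H^1(Omega) and Du is (a version of) its weak
   gradient, which is unique up to a null set. *)
Definition H1 (R : realType) (Omega : set (R * R)) (u : R * R -> R[i])
    (Du : R * R -> R[i] * R[i]) : Prop :=
  [/\ L2 (mu2 R) Omega u,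
      L2 (mu2 R) Omega (fun x => (Du x).1),
      L2 (mu2 R) Omega (fun x => (Du x).2),
      weak_partial Omega (e1 R) u (fun x => (Du x).1) &
      weak_partial Omega (e2 R) u (fun x => (Du x).2)].

Definition H1norm (R : realType) (Omega : set (R * R)) (u : R * R -> R[i])
    (Du : R * R -> R[i] * R[i]) : \bar R :=
  ((sqL2norm (mu2 R) Omega u
    + sqL2norm (mu2 R) Omega (fun x => (Du x).1)
    + sqL2norm (mu2 R) Omega (fun x => (Du x).2)) `^ 2^-1)%E.

(* H^1_0(Omega): the closure of the complex-valued test functions in H^1. *)
Definition H10 (R : realType) (Omega : set (R * R)) (u : R * R -> R[i])
    (Du : R * R -> R[i] * R[i]) : Prop :=
  H1 Omega u Du /\
  exists phi : nat -> R * R -> R[i],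
    (forall n, test_function Omega (fun x => complex.Re (phi n x)) /\
               test_function Omega (fun x => complex.Im (phi n x))) /\
    H1norm Omega (fun x => u x - phi n x) (fun x => Du x - Cgrad (phi n) x)
      @[n --> \oo] --> 0%E.

(* The distributional Laplacian of u on Omega is the function f. *)
Definition weak_laplacian (R : realType) (Omega : set (R * R))
    (u f : R * R -> R[i]) : Prop :=
  forall phi : R * R -> R, test_function Omega phi ->
    Cintegral (mu2 R) Omega (fun x => u x * (laplacian phi x)%:C) =
    Cintegral (mu2 R) Omega (fun x => f x * (phi x)%:C).

(* The exterior normal derivative of u on the boundary, as an element of
   H^{-1/2}: for u in H^1 with gradient Du and Laplacian f in L^2, it pairs with
   the boundary values of psi in H^1 by Green's first identity. *)
Definition normal_derivative (R : realType) (Omega : set (R * R))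
    (Du : R * R -> R[i] * R[i]) (f : R * R -> R[i])
    (psi : R * R -> R[i]) (Dpsi : R * R -> R[i] * R[i]) : R[i] :=
  Cintegral (mu2 R) Omega (fun x => cdot (Du x) (Dpsi x) + f x * psi x).

(* (v, w) is a nontrivial pair of transmission eigenfunctions in H^1 x H^1 with
   weak gradients Dv, Dw. Equality of the Dirichlet data is w - v in H^1_0;
   equality of the Neumann data is in H^{-1/2}. *)
Definition transmission_eigenfunctions (R : realType) (Omega : set (R * R))
    (k : R) (V v w : R * R -> R[i]) (Dv Dw : R * R -> R[i] * R[i]) : Prop :=
  let lap_w := fun x => - ((k ^+ 2)%:C * (1 + V x) * w x) in
  let lap_v := fun x => - ((k ^+ 2)%:C * v x) in
  (H1 Omega v Dv /\ H1 Omega w Dw) /\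
  ~ {ae mu2 R, forall x, Omega x -> v x = 0 /\ w x = 0} /\
  weak_laplacian Omega w lap_w /\
  weak_laplacian Omega v lap_v /\
  H10 Omega (fun x => w x - v x) (fun x => Dw x - Dv x) /\
  (forall psi Dpsi, H1 Omega psi Dpsi ->
     normal_derivative Omega Dw lap_w psi Dpsi =
     normal_derivative Omega Dv lap_v psi Dpsi).

(* Near each boundary point, in Cartesian coordinates (s, t) obtained by a
   translation and the rotation taking (1, 0) to (a, b), Omega is the part of
   the plane above the graph of a Lipschitz function. *)
Definition lipschitz_boundary (R : realType) (Omega : set (R * R)) : Prop :=
  forall p : R * R, (closure Omega `\` interior Omega) p ->
  exists (r a b : R) (gamma : R -> R),
    [/\ 0 < r, a ^+ 2 + b ^+ 2 = 1, lipschitz gamma &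
        forall x, eball p r x ->
          let s := a * (x.1 - p.1) + b * (x.2 - p.2) in
          let t := a * (x.2 - p.2) - b * (x.1 - p.1) in
          Omega x <-> gamma s < t].

Definition bounded_lipschitz_domain (R : realType) (Omega : set (R * R)) :
    Prop :=
  [/\ open Omega, connected Omega, Omega !=set0, bounded_set Omega &
      lipschitz_boundary Omega].

(* Principal argument of x.1 + i x.2, in ]-pi, pi] for x <> 0. *)
Definition Carg (R : realType) (x : R * R) : R :=
  let t := acos (x.1 / Num.sqrt (x.1 ^+ 2 + x.2 ^+ 2)) in
  if 0 <= x.2 then t else - t.

Definition sector (R : realType) (c : R * R) (tm tM : R) : set (R * R) :=
  [set x | x <> c /\ tm < Carg (x - c) < tM].

(* u has a representative in C^alpha(D), where u is given almost everywhere on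
   S; used with D the closure of S. *)
Definition ae_holder (R : realType) (S D : set (R * R)) (alpha : R)
    (u : R * R -> R[i]) : Prop :=
  exists F : R * R -> R[i],
    {ae mu2 R, forall x, S x -> u x = F x} /\
    exists M : R, forall x y, D x -> D y ->
      normc (F x - F y) <= M * (edist x y) `^ alpha.

Definition expi (R : realType) (t : R) : R[i] := cos t +i* sin t.

(* The unit circle with its arc length measure is parametrised by
   t |-> (cos t, sin t), 0 <= t <= 2 pi. *)
Definition circle_pt (R : realType) (t : R) : R * R := (cos t, sin t).

Definition circle_fun (R : realType) (g : R * R -> R[i]) :
    measurableTypeR R -> R[i] :=
  fun t => g (circle_pt t).

Definition L2circle (R : realType) (g : R * R -> R[i]) : Prop :=
  L2 (@lebesgue_measure R) `[0, 2 * pi] (circle_fun g).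

Definition L2circle_norm (R : realType) (g : R * R -> R[i]) : \bar R :=
  (sqL2norm (@lebesgue_measure R) `[0%R, (2 * pi)%R] (circle_fun g) `^ 2^-1)%E.

Definition herglotz (R : realType) (k : R) (g : R * R -> R[i]) (x : R * R) :
    R[i] :=
  Cintegral (@lebesgue_measure R) `[0, 2 * pi]
    (fun t : measurableTypeR R =>
       let xi := circle_pt (t : R) in
       expi (k * (xi.1 * x.1 + xi.2 * x.2)) * g xi).

(* Main.v *)
(* Identify x with the complex number z centred at the vertex xc and test with
   u_s = (1 + s z)^-6. Its pole xc - (1/s, 0) lies in the ball but outside the
   sector as soon as s >= 2/h, so u_s is holomorphic on all of Omega and no
   cut-off is needed: since the Cauchy data of w - v vanish,
     \int_Omega ((1 + V) w - v) u_s = 0.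
   On the sector, u_s concentrates at scale 1/s and has integral K / s^2, where
   K <> 0 precisely because the aperture is not pi. Replacing (1 + V) w by its
   Hoelder representative F and v by the Herglotz function v_j, the choice
   s = j^(Upsilon/2) gives F(xc) - v_j(xc) -> 0.
   The same integrals with s ~ 1/rho bound the measure of the corner of radius
   rho from below by c rho^2. Finally, with j ~ rho^(-2/Upsilon), split
     V w = (F - F(xc)) + (F(xc) - v_j(xc)) + (v_j(xc) - v_j) + (v_j - v) + (v - w).
   The average of the last term is controlled by Poincare's inequality on
   horizontal segments: w - v is in H^1_0 and each segment starts outside Omega. *)
Require Import Defs.
From mathcomp Require Import all_boot all_order all_algebra.
From mathcomp Require Import all_classical all_reals all_analysis.
From mathcomp Require Import measurable_realfun complex.
From mathcomp Require Import ring lra.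

Set Implicit Arguments.
Unset Strict Implicit.
Unset Printing Implicit Defensive.

Import Order.TTheory GRing.Theory Num.Theory.
Import numFieldNormedType.Exports.
Import ComplexField.Normc.
Local Open Scope classical_set_scope.
Local Open Scope ring_scope.
Local Open Scope complex_scope.

(** The pole of [u_s] lies on the horizontal half-line to the left of the vertex, which [-pi < tm]
    and [tM < pi] keep at a positive angle from the sector. Hence
    [|1 + s z|^2 >= k0 (1 + s^2 |z|^2)] on the sector with one constant [k0] for all [s]. The cone
    behind this bound also supplies the points outside Omega where the Poincare segments start. The
    exponent 6 gives three factors [(1 + s^2 |z|^2)^-1]: two form a majorant of mass of order
    [s^-2], the third pays for a weight [|z|^al] and gains [s^-al]. After multiplication by [s^2]
    the Hoelder term is of order [s^-alpha], the Lipschitz term of [v_j] of order [j^varrho / s],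
    the approximation error of order [j^(-Upsilon) s]. So [s] must lie well between [j^varrho] and
    [j^Upsilon]; [j^(Upsilon/2)] does, as [varrho < Upsilon / 2]. The same balance returns with
    [1/rho] for [s] in the final averages. In polar coordinates [K] is 1/20 times the integral of
    [e^(-2 i theta)] over the aperture; here it is obtained from horizontal slices. *)

Local Notation cRe := complex.Re.
Local Notation cIm := complex.Im.

(** * Complex-valued integrable and square integrable functions *)

Section normc.
Context {R : realType}.
Implicit Types z w : R[i].

Lemma normcE2 z : normc z = Num.sqrt ((cRe z) ^+ 2 + (cIm z) ^+ 2).
Proof. by case: z. Qed.

Lemma normc_ge0 z : 0 <= normc z.
Proof. by rewrite normcE2 sqrtr_ge0. Qed.

Lemma normc_gt0 z : z != 0 -> 0 < normc z.
Proof.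
move=> z0; rewrite lt_neqAle normc_ge0 andbT eq_sym.
by apply: contraNN z0 => /eqP /eq0_normc ->.
Qed.

Lemma sqr_normcE z : normc z ^+ 2 = (cRe z) ^+ 2 + (cIm z) ^+ 2.
Proof. by rewrite normcE2 sqr_sqrtr// addr_ge0// sqr_ge0. Qed.

Lemma normr_Re_le z : `|cRe z| <= normc z.
Proof.
by rewrite -(ler_pXn2r (n:=2))// ?nnegrE ?normc_ge0// sqr_normcE real_normK ?num_real// lerDl sqr_ge0.
Qed.

Lemma normr_Im_le z : `|cIm z| <= normc z.
Proof.
by rewrite -(ler_pXn2r (n:=2))// ?nnegrE ?normc_ge0// sqr_normcE real_normK ?num_real// lerDr sqr_ge0.
Qed.

Lemma normc_le_ReIm z : normc z <= `|cRe z| + `|cIm z|.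
Proof.
rewrite -(ler_pXn2r (n:=2))// ?nnegrE ?normc_ge0 ?addr_ge0//.
rewrite sqr_normcE sqrrD !real_normK ?num_real// lerD2r lerDl mulrn_wge0// mulr_ge0//.
Qed.

Lemma normcR (a : R) : normc a%:C = `|a|.
Proof. by rewrite normcE2 /= expr0n addr0 sqrtr_sqr. Qed.

Lemma normc_expr z n : normc (z ^+ n) = normc z ^+ n.
Proof. by elim: n => [|n ih]; rewrite ?expr0 ?normc1// !exprS normcM ih. Qed.

Lemma normcB z w : normc (z - w) = normc (w - z).
Proof. by rewrite -normcN opprB. Qed.

Lemma le_normcB z w : normc (z - w) <= normc z + normc w.
Proof. by rewrite (le_trans (le_normcD _ _))// normcN. Qed.

Lemma cReD z w : cRe (z + w) = cRe z + cRe w.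
Proof. by case: z; case: w. Qed.
Lemma cImD z w : cIm (z + w) = cIm z + cIm w.
Proof. by case: z; case: w. Qed.
Lemma cReN z : cRe (- z) = - cRe z.
Proof. by case: z. Qed.
Lemma cImN z : cIm (- z) = - cIm z.
Proof. by case: z. Qed.
Lemma cReM z w : cRe (z * w) =
  cRe z * cRe w - cIm z * cIm w.
Proof. by case: z; case: w. Qed.
Lemma cImM z w : cIm (z * w) =
  cRe z * cIm w + cIm z * cRe w.
Proof. by case: z; case: w. Qed.
Lemma complex_eta z : z = cRe z +i* cIm z.
Proof. by case: z. Qed.

End normc.

Section Cmeasurable.
Context {R : realType} d {T : measurableType d}.
Variable D : set T.
Implicit Types f g : T -> R[i].

Lemma Cmeasurable_cst (c : R[i]) : Cmeasurable D (fun=> c).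
Proof. by split; exact: measurable_cst. Qed.

Lemma CmeasurableD f g : Cmeasurable D f -> Cmeasurable D g ->
  Cmeasurable D (fun x => f x + g x).
Proof.
move=> [fr fi] [gr gi]; split.
  by under eq_fun do rewrite cReD; exact: measurable_funD.
by under eq_fun do rewrite cImD; exact: measurable_funD.
Qed.

Lemma CmeasurableN f : Cmeasurable D f -> Cmeasurable D (fun x => - f x).
Proof.
move=> [fr fi]; split.
  by under eq_fun do rewrite cReN; exact: measurableT_comp.
by under eq_fun do rewrite cImN; exact: measurableT_comp.
Qed.

Lemma CmeasurableB f g : Cmeasurable D f -> Cmeasurable D g ->
  Cmeasurable D (fun x => f x - g x).
Proof. by move=> mf mg; apply: CmeasurableD => //; exact: CmeasurableN. Qed.

Lemma CmeasurableM f g : Cmeasurable D f -> Cmeasurable D g ->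
  Cmeasurable D (fun x => f x * g x).
Proof.
move=> [fr fi] [gr gi]; split.
  by under eq_fun do rewrite cReM; apply: measurable_funB; exact: measurable_funM.
by under eq_fun do rewrite cImM; apply: measurable_funD; exact: measurable_funM.
Qed.

Lemma measurable_normc f : Cmeasurable D f ->
  measurable_fun D (fun x => normc (f x) : measurableTypeR R).
Proof.
move=> [fr fi].
under eq_fun do rewrite normcE2.
apply: measurableT_comp; first by apply: continuous_measurable_fun; exact: sqrt_continuous.
by apply: measurable_funD; exact: measurable_funX.
Qed.

End Cmeasurable.

Lemma CmeasurableS {R : realType} d {T : measurableType d} (A B : set T)
    (f : T -> R[i]) : measurable B -> A `<=` B ->
  Cmeasurable B f -> Cmeasurable A f.
Proof. by move=> mB AB [fr fi]; split; exact: measurable_funS _ AB _. Qed.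

Definition Cintegrable {R : realType} d {T : measurableType d}
    (mu : {measure set T -> \bar R}) (D : set T) (f : T -> R[i]) : Prop :=
  mu.-integrable D (EFin \o (fun x => cRe (f x))) /\
  mu.-integrable D (EFin \o (fun x => cIm (f x))).

Section Cintegral.
Context {R : realType} d {T : measurableType d}.
Variable mu : {measure set T -> \bar R}.
Implicit Types (f g : T -> R[i]) (D : set T).

Lemma Cintegrable_Cmeasurable D f : Cintegrable mu D f -> Cmeasurable D f.
Proof.
by move=> [/measurable_int/measurable_EFinP ? /measurable_int/measurable_EFinP ?].
Qed.

Lemma le_Cintegrable D f (g : T -> R) : measurable D -> Cmeasurable D f ->
  mu.-integrable D (EFin \o g) -> (forall x, D x -> normc (f x) <= g x) ->
  Cintegrable mu D f.
Proof.
move=> mD [fr fi] ig fg; split.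
  apply: le_integrable ig => //; first exact/measurable_EFinP.
  move=> x Dx /=; rewrite lee_fin (le_trans (normr_Re_le _))//.
  by rewrite (le_trans (fg _ Dx))// ler_norm.
apply: le_integrable ig => //; first exact/measurable_EFinP.
move=> x Dx /=; rewrite lee_fin (le_trans (normr_Im_le _))//.
by rewrite (le_trans (fg _ Dx))// ler_norm.
Qed.

Lemma integrable_normc D f : measurable D -> Cintegrable mu D f ->
  mu.-integrable D (EFin \o (fun x => normc (f x))).
Proof.
move=> mD cf; have [fr fi] := cf.
have := integrableD mD (integrable_norm fr) (integrable_norm fi).
apply: le_integrable => //.
  by apply/measurable_EFinP/measurable_normc; exact: Cintegrable_Cmeasurable.
move=> x Dx /=; rewrite lee_fin ger0_norm ?normc_ge0// ger0_norm ?addr_ge0//.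
exact: normc_le_ReIm.
Qed.

Lemma CintegrableS (A D : set T) f : measurable A -> measurable D -> A `<=` D ->
  Cintegrable mu D f -> Cintegrable mu A f.
Proof. by move=> mA mD AD [fr fi]; split; exact: integrableS _ _ AD _. Qed.

Lemma CintegrableD D f g : measurable D ->
  Cintegrable mu D f -> Cintegrable mu D g ->
  Cintegrable mu D (fun x => f x + g x).
Proof.
move=> mD [fr fi] [gr gi]; split.
  apply: (eq_integrable mD _ _ _ (integrableD mD fr gr)).
  by move=> x _ /=; rewrite cReD.
apply: (eq_integrable mD _ _ _ (integrableD mD fi gi)).
by move=> x _ /=; rewrite cImD.
Qed.

Lemma CintegrableZ D f (c : R[i]) : measurable D ->
  Cintegrable mu D f -> Cintegrable mu D (fun x => c * f x).
Proof.
move=> mD cf; have mf := Cintegrable_Cmeasurable cf.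
apply: (le_Cintegrable mD (CmeasurableM (Cmeasurable_cst D c) mf)
  (integrableZl mD (normc c) (integrable_normc mD cf))).
by move=> x Dx /=; rewrite normcM.
Qed.

Lemma CintegrableN D f : measurable D ->
  Cintegrable mu D f -> Cintegrable mu D (fun x => - f x).
Proof.
move=> mD cf; under eq_fun do rewrite -mulN1r; exact: CintegrableZ.
Qed.

Lemma CintegrableB D f g : measurable D ->
  Cintegrable mu D f -> Cintegrable mu D g ->
  Cintegrable mu D (fun x => f x - g x).
Proof.
by move=> mD cf cg; apply: CintegrableD => //; exact: CintegrableN.
Qed.

Lemma eq_Cintegral D f g : {in D, f =1 g} ->
  Cintegral mu D f = Cintegral mu D g.
Proof.
by move=> fg; congr (_ +i* _); apply: eq_Rintegral => x xD; rewrite fg.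
Qed.

Lemma CintegralD D f g : measurable D ->
  Cintegrable mu D f -> Cintegrable mu D g ->
  Cintegral mu D (fun x => f x + g x) = Cintegral mu D f + Cintegral mu D g.
Proof.
move=> mD [fr fi] [gr gi]; rewrite /Cintegral {2 3}/GRing.add /= -!RintegralD//.
by congr (_ +i* _); apply: eq_Rintegral => x _; rewrite ?cReD ?cImD.
Qed.

Lemma CintegralZ D f (c : R[i]) : measurable D -> Cintegrable mu D f ->
  Cintegral mu D (fun x => c * f x) = c * Cintegral mu D f.
Proof.
move=> mD cf; have [fr fi] := cf.
have Z (a : R) (h : T -> R) : mu.-integrable D (EFin \o h) ->
    mu.-integrable D (EFin \o (fun x => a * h x)).
  by move=> ih; exact: (integrableZl mD a ih).
rewrite [in RHS](complex_eta c) /Cintegral /=; congr (_ +i* _).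
  rewrite -(RintegralZl _ mD fr) -(RintegralZl _ mD fi) -RintegralB//; [|exact: Z..].
  by apply: eq_Rintegral => x _; rewrite cReM.
rewrite -(RintegralZl _ mD fr) -(RintegralZl _ mD fi) -RintegralD//; [|exact: Z..].
by apply: eq_Rintegral => x _; rewrite cImM.
Qed.

Lemma CintegralN D f : measurable D -> Cintegrable mu D f ->
  Cintegral mu D (fun x => - f x) = - Cintegral mu D f.
Proof.
move=> mD cf; rewrite -mulN1r -CintegralZ//.
by apply: eq_Cintegral => x _; rewrite mulN1r.
Qed.

Lemma CintegralB D f g : measurable D ->
  Cintegrable mu D f -> Cintegrable mu D g ->
  Cintegral mu D (fun x => f x - g x) = Cintegral mu D f - Cintegral mu D g.
Proof.
by move=> mD cf cg; rewrite CintegralD// ?CintegralN//; exact: CintegrableN.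
Qed.

Lemma Cintegral_setU (A B : set T) f : measurable A -> measurable B ->
  Cintegrable mu (A `|` B) f -> [disjoint A & B] ->
  Cintegral mu (A `|` B) f = Cintegral mu A f + Cintegral mu B f.
Proof. by move=> mA mB [fr fi] AB; rewrite /Cintegral !Rintegral_setU. Qed.

(** The factor 2 comes from bounding the real and the imaginary part separately; it accounts for
    many of the factors 2 in later estimates. *)
Lemma normc_Cintegral_le D f : measurable D -> Cintegrable mu D f ->
  normc (Cintegral mu D f) <= 2 * Rintegral mu D (fun x => normc (f x)).
Proof.
move=> mD cf; have [fr fi] := cf.
apply: (le_trans (normc_le_ReIm _)); rewrite mulr_natl mulr2n /=.
have inf := integrable_normc mD cf.
apply: lerD; apply: (le_trans (le_normr_Rintegral mD _)) => //.
- apply: le_Rintegral => //; first exact: integrable_norm.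
  by move=> x _; exact: normr_Re_le.
- apply: le_Rintegral => //; first exact: integrable_norm.
  by move=> x _; exact: normr_Im_le.
Qed.

Lemma le_Rintegral_subset (A D : set T) (f : T -> R) :
  measurable A -> measurable D -> A `<=` D -> mu.-integrable D (EFin \o f) ->
  (forall x, D x -> 0 <= f x) -> Rintegral mu A f <= Rintegral mu D f.
Proof.
move=> mA mD AD intf f0; rewrite /Rintegral fine_le//.
- by apply: integrable_fin_num => //; exact: integrableS intf.
- exact: integrable_fin_num.
- apply: ge0_subset_integral => //.
    by have /measurable_int := intf.
Qed.

(** The square of the L2 norm as a real number. As [Rintegral] sends an infinite value to 0, it is
    meaningful only for [f] in [L2], where [sqL2norm] equals it. *)
Definition l2 D f : R := Rintegral mu D (fun x => normc (f x) ^+ 2).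

Lemma l2_ge0 D f : 0 <= l2 D f.
Proof. by apply: Rintegral_ge0 => x _; rewrite sqr_ge0. Qed.

Lemma L2_integrable D f : measurable D -> L2 mu D f ->
  mu.-integrable D (EFin \o (fun x => normc (f x) ^+ 2)).
Proof.
move=> mD [mf foo]; apply/integrableP; split.
  by apply/measurable_EFinP; apply: measurable_funX; exact: measurable_normc.
apply: le_lt_trans foo; rewrite le_eqVlt; apply/orP; left; apply/eqP.
by apply: eq_integral => x _ /=; rewrite ger0_norm// sqr_ge0.
Qed.

Lemma integrable_L2 D f : measurable D -> Cmeasurable D f ->
  mu.-integrable D (EFin \o (fun x => normc (f x) ^+ 2)) -> L2 mu D f.
Proof.
move=> mD mf /integrableP[_ foo]; split => //.
apply: le_lt_trans foo; rewrite le_eqVlt; apply/orP; left; apply/eqP.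
by apply: eq_integral => x _ /=; rewrite ger0_norm// sqr_ge0.
Qed.

Lemma sqL2normE D f : measurable D -> L2 mu D f -> sqL2norm mu D f = (l2 D f)%:E.
Proof.
move=> mD /(L2_integrable mD)/integrable_fin_num/fineK; rewrite /l2 /Rintegral.
by move=> ->.
Qed.

Lemma L2S (A D : set T) f : measurable A -> measurable D -> A `<=` D ->
  L2 mu D f -> L2 mu A f.
Proof.
move=> mA mD AD Lf; apply: integrable_L2 => //.
  by apply: CmeasurableS AD _ => //; case: Lf.
exact: integrableS AD (L2_integrable mD Lf).
Qed.

Lemma L2M_Cintegrable D f g : measurable D -> L2 mu D f -> L2 mu D g ->
  Cintegrable mu D (fun x => f x * g x).
Proof.
move=> mD Lf Lg.
apply: (@le_Cintegrable _ _ (fun x => normc (f x) ^+ 2 + normc (g x) ^+ 2) mD).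
- by apply: CmeasurableM; [case: Lf|case: Lg].
- exact: (integrableD mD (L2_integrable mD Lf) (L2_integrable mD Lg)).
move=> x Dx; rewrite normcM.
have := sqr_ge0 (normc (f x) - normc (g x)).
have := mulr_ge0 (normc_ge0 (f x)) (normc_ge0 (g x)).
nra.
Qed.

(** Minimising [t * a + b / t] over positive [t] gives twice the product of the square roots. *)
Lemma le_sqrtM_of_AMGM (x a b : R) : 0 <= a -> 0 <= b ->
  (forall t, 0 < t -> 2 * x <= t * a + b / t) -> x <= Num.sqrt a * Num.sqrt b.
Proof.
move=> a0 b0 h; apply/ler_addgt0Pr => e e0.
set p := Num.sqrt a; set q := Num.sqrt b.
have p0 : 0 <= p by exact: sqrtr_ge0.
have q0 : 0 <= q by exact: sqrtr_ge0.
(* The minimiser [q / p] is not a positive number when a norm vanishes, so it is shifted to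
   [(q + n) / (p + n)], at a cost of at most [n * (p + q) / 2], which [hn] keeps below [e]. *)
have [n n0 hn] : exists2 n : R, 0 < n & n * (p + q + n) <= e.
  exists (Num.min 1 (e / (p + q + 1))).
    by rewrite lt_min ltr01/= divr_gt0// ltr_wpDl// addr_ge0.
  set n := Num.min _ _.
  have n1 : n <= 1 by rewrite ge_min lexx.
  have n2 : n <= e / (p + q + 1) by rewrite ge_min lexx orbT.
  have pq : 0 < p + q + 1 by rewrite ltr_wpDl// addr_ge0.
  rewrite ler_pdivlMr// in n2.
  have n0 : 0 <= n by rewrite le_min ler01/= divr_ge0// ltW.
  apply: le_trans n2; rewrite ler_wpM2l//; lra.
have pn : 0 < p + n by rewrite ltr_wpDl.
have qn : 0 < q + n by rewrite ltr_wpDl.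
have := h ((q + n) / (p + n)) (divr_gt0 qn pn).
rewrite -(sqr_sqrtr a0) -(sqr_sqrtr b0) -/p -/q invf_div.
have -> : (q + n) / (p + n) * p ^+ 2 = (q + n) * p * (p / (p + n)) by ring.
have -> : q ^+ 2 * ((p + n) / (q + n)) = (p + n) * q * (q / (q + n)) by ring.
have pp : p / (p + n) <= 1 by rewrite ler_pdivrMr// mul1r lerDl ltW.
have qq : q / (q + n) <= 1 by rewrite ler_pdivrMr// mul1r lerDl ltW.
have := ler_wpM2l (mulr_ge0 (ltW qn) p0) pp.
have := ler_wpM2l (mulr_ge0 (ltW pn) q0) qq.
move: hn; nra.
Qed.

(** Young's inequality [2 p q <= t p^2 + q^2 / t] is integrated for each [t] and optimised
    afterwards, so that vanishing norms need no separate case. *)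
Lemma cauchy_schwarz D f g : measurable D -> L2 mu D f -> L2 mu D g ->
  Rintegral mu D (fun x => normc (f x * g x)) <=
  Num.sqrt (l2 D f) * Num.sqrt (l2 D g).
Proof.
move=> mD Lf Lg; apply: le_sqrtM_of_AMGM; [exact: l2_ge0..|].
move=> t t0.
have I := integrable_normc mD (L2M_Cintegrable mD Lf Lg).
have If := L2_integrable mD Lf.
have Ig := L2_integrable mD Lg.
rewrite -(RintegralZl _ mD I) /l2 -(RintegralZl _ mD If) -(RintegralZr _ mD Ig).
have E1 : mu.-integrable D (EFin \o (fun x => t * normc (f x) ^+ 2)).
  exact: (integrableZl mD t If).
have E2 : mu.-integrable D (EFin \o (fun x => normc (g x) ^+ 2 / t)).
  apply: (eq_integrable mD _ _ _ (integrableZl mD t^-1 Ig)) => // x _ /=.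
  by rewrite -EFinM mulrC.
rewrite -RintegralD//; apply: le_Rintegral => //.
- exact: (integrableZl mD 2 I).
- exact: (integrableD mD E1 E2).
- move=> x _; rewrite normcM.
  have := sqr_ge0 (t * normc (f x) - normc (g x)).
  set p := normc (f x); set q := normc (g x) => pq.
  rewrite -subr_ge0.
  have -> : t * p ^+ 2 + q ^+ 2 / t - 2 * (p * q) = (t * p - q) ^+ 2 / t.
    by field; rewrite gt_eqF.
  by rewrite divr_ge0// ltW.
Qed.

Lemma L1_le_L2 D f : measurable D -> (mu D < +oo)%E -> L2 mu D f ->
  Cintegrable mu D f /\
  Rintegral mu D (fun x => normc (f x)) <=
    Num.sqrt (l2 D f) * Num.sqrt (fine (mu D)).
Proof.
move=> mD Dfin Lf.
have L1 : L2 mu D (fun=> 1).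
  apply: (integrable_L2 mD (Cmeasurable_cst D 1)).
  rewrite normc1 expr1n.
  by apply: measurable_bounded_integrable => //; exists 1; split => // M M1 x _;
    rewrite normr1 ltW.
split.
  by have := L2M_Cintegrable mD Lf L1; under eq_fun do rewrite mulr1.
have := cauchy_schwarz mD Lf L1.
under eq_Rintegral do rewrite mulr1.
by rewrite {2}/l2 normc1 expr1n Rintegral_cst// mul1r.
Qed.

Lemma L2D D f g : measurable D -> L2 mu D f -> L2 mu D g ->
  L2 mu D (fun x => f x + g x).
Proof.
move=> mD Lf Lg; apply: integrable_L2 => //.
  by apply: CmeasurableD; [case: Lf|case: Lg].
have := integrableZl mD 2
  (integrableD mD (L2_integrable mD Lf) (L2_integrable mD Lg)).
apply: le_integrable => //.
  apply/measurable_EFinP; apply: measurable_funX; apply: measurable_normc.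
  by apply: CmeasurableD; [case: Lf|case: Lg].
move=> x Dx /=; rewrite lee_fin !ger0_norm ?mulr_ge0 ?addr_ge0 ?sqr_ge0 ?normc_ge0//.
have := le_normcD (f x) (g x).
have := normc_ge0 (f x + g x).
have := normc_ge0 (f x); have := normc_ge0 (g x).
have := sqr_ge0 (normc (f x) - normc (g x)).
set p := normc (f x + g x); nra.
Qed.

(** The bound on [g] is only almost everywhere, to suit the potential [V] in L^infinity. *)
Lemma L2_bddM D f g (M : R) : measurable D -> Cmeasurable D g ->
  {ae mu, forall x, D x -> normc (g x) <= M} -> L2 mu D f ->
  L2 mu D (fun x => g x * f x).
Proof.
move=> mD mg gM Lf; split.
  by apply: CmeasurableM => //; case: Lf.
have mfn : measurable_fun D (EFin \o (fun x => M ^+ 2 * normc (f x) ^+ 2) : T -> \bar R).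
  by have /measurable_int := integrableZl mD (M ^+ 2) (L2_integrable mD Lf).
apply: (@le_lt_trans _ _ (\int[mu]_(x in D) (M ^+ 2 * normc (f x) ^+ 2)%:E)%E).
  apply: ae_ge0_le_integral => //.
  - by move=> x _; rewrite lee_fin sqr_ge0.
  - apply/measurable_EFinP; apply: measurable_funX; apply: measurable_normc.
    by apply: CmeasurableM => //; case: Lf.
  - by move=> x _; rewrite lee_fin mulr_ge0// sqr_ge0.
  - apply: filterS gM => x gM Dx; rewrite lee_fin normcM exprMn.
    by rewrite ler_wpM2r ?sqr_ge0// lerXn2r ?nnegrE ?normc_ge0// ?gM//
      (le_trans _ (gM Dx))// normc_ge0.
by have := integrable_lty mD (integrableZl mD (M ^+ 2) (L2_integrable mD Lf)).
Qed.

Lemma L2Z D f (c : R[i]) : measurable D -> L2 mu D f ->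
  L2 mu D (fun x => c * f x).
Proof.
move=> mD; apply: (@L2_bddM D f (fun=> c) (normc c) mD (Cmeasurable_cst D c)).
exact: aeW.
Qed.

Lemma L2B D f g : measurable D -> L2 mu D f -> L2 mu D g ->
  L2 mu D (fun x => f x - g x).
Proof.
move=> mD Lf Lg; apply: L2D => //.
by have := L2Z (-1) mD Lg; under eq_fun do rewrite mulN1r.
Qed.

End Cintegral.

(** * Measure and integration by parts in the plane *)

Section plane_measurability.
Context {R : realType}.
Local Notation T2 := (measurableTypeR R * measurableTypeR R)%type.

Lemma ball2P (x y : R * R) (e : R) :
  ball x e y <-> `|x.1 - y.1| < e /\ `|x.2 - y.2| < e.
Proof. by []. Qed.

Lemma open_ball2 (U : set (R * R)) (x : R * R) : open U -> U x ->
  exists2 e : R, 0 < e & forall y, `|x.1 - y.1| < e -> `|x.2 - y.2| < e -> U y.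
Proof.
move=> oU Ux; have /nbhs_ballP[e /= e0 eU] : nbhs x U by exact: open_nbhs_nbhs.
by exists e => // y h1 h2; apply: eU; exact/ball2P.
Qed.

(** Measurable sets of the plane are generated by products, while openness refers to the norm
    topology: boxes with rational corners, countable in number, connect the two. Boxes not contained
    in [U] are replaced by the empty set. *)
Lemma open_measurable2 (U : set (R * R)) : open U -> measurable (U : set T2).
Proof.
move=> oU.
pose box (q : (rat * rat) * (rat * rat)) : set T2 :=
  `]ratr q.1.1, ratr q.1.2[%classic `*` `]ratr q.2.1, ratr q.2.2[%classic.
have -> : U = \bigcup_(q in [set: (rat * rat) * (rat * rat)])
    (if `[< box q `<=` U >] then box q else set0).
  apply/seteqP; split => [x Ux|x [q _]]; last first.
    by case: ifPn => // /asboolP; apply.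
  have [e e0 eU] := open_ball2 oU Ux.
  have e2 : 0 < e / 2 by rewrite divr_gt0.
  have [a] := @rat_in_itvoo R (x.1 - e) x.1 (ltac:(lra)).
  have [b] := @rat_in_itvoo R x.1 (x.1 + e) (ltac:(lra)).
  have [c] := @rat_in_itvoo R (x.2 - e) x.2 (ltac:(lra)).
  have [d] := @rat_in_itvoo R x.2 (x.2 + e) (ltac:(lra)).
  rewrite !in_itv/= => /andP[d1 d2] /andP[c1 c2] /andP[b1 b2] /andP[a1 a2].
  exists ((a, b), (c, d)) => //; rewrite ifT.
    by split => /=; rewrite in_itv/=; apply/andP; split.
  apply/asboolP => y [/=]; rewrite !in_itv/= => /andP[y1 y2] /andP[y3 y4].
  by apply: eU; rewrite ltr_distlC; apply/andP; split; lra.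
apply: countable_bigcupT_measurable; first exact: countableP.
move=> q; case: ifPn => // _; apply: measurableX; exact: measurable_itv.
Qed.

Lemma closed_measurable2 (U : set (R * R)) : closed U -> measurable (U : set T2).
Proof.
by move=> cU; rewrite -(setCK U); apply: measurableC; apply: open_measurable2;
  rewrite openC.
Qed.

Lemma continuous_measurable2 (f : R * R -> R) (D : set (R * R)) :
  continuous f -> measurable_fun (D : set T2) (f : T2 -> measurableTypeR R).
Proof.
move=> cf; apply: measurable_funTS.
apply: (measurability _ (RGenOpens.measurableE R)).
move=> _ [_ [a [b ->] <-]]; rewrite setTI; apply: open_measurable2.
by apply: open_comp; [move=> x _; exact: cf|exact: interval_open].
Qed.

Lemma mu2E (A B : set (measurableTypeR R)) : measurable A -> measurable B ->
  mu2 R (A `*` B) = (lebesgue_measure A * lebesgue_measure B)%E.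
Proof. by move=> mA mB; exact: product_measure1E. Qed.

Definition box (a b c d : R) : set (R * R) := `[a, b]%classic `*` `[c, d]%classic.

Lemma measurable_box a b c d : measurable (box a b c d : set T2).
Proof. by apply: measurableX; exact: measurable_itv. Qed.

Lemma boxP a b c d (x : R * R) :
  box a b c d x <-> [/\ a <= x.1, x.1 <= b, c <= x.2 & x.2 <= d].
Proof.
rewrite /box /= !in_itv/=; split; first by move=> [/andP[-> ->] /andP[-> ->]].
by move=> [-> -> -> ->].
Qed.

Lemma mu2_box a b c d : a <= b -> c <= d ->
  mu2 R (box a b c d) = ((b - a) * (d - c))%:E.
Proof.
move=> ab cd; rewrite mu2E ?measurable_itv// !lebesgue_measure_itv/= !lte_fin.
have E (u v : R) : u <= v ->
    (if (u < v)%R then v%:E - u%:E else 0)%E = (v - u)%:E.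
  by rewrite le_eqVlt => /predU1P[->|->//]; rewrite ltxx subrr.
by rewrite !E// EFinM.
Qed.

Lemma mu2_box_lty a b c d : (mu2 R (box a b c d) < +oo)%E.
Proof.
have [ab|ba] := leP a b; last first.
  rewrite (_ : box _ _ _ _ = set0) ?measure0//.
  by apply/seteqP; split => // x /boxP[]; lra.
have [cd|dc] := leP c d; last first.
  rewrite (_ : box _ _ _ _ = set0) ?measure0//.
  by apply/seteqP; split => // x /boxP[]; lra.
by rewrite mu2_box// ltry.
Qed.

Lemma bounded_sub_box (A : set (R * R)) : bounded_set A ->
  exists2 M : R, 0 < M & A `<=` box (- M) M (- M) M.
Proof.
move=> [M [_ hM]]; exists (`|M| + 1); first by rewrite ltr_wpDl.
move=> x Ax; have /= : `|x| <= `|M| + 1.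
  by apply: hM => //; rewrite (le_lt_trans (ler_norm _))// ltrDl.
rewrite prod_normE ge_max => /andP[].
by rewrite !ler_norml => /andP[? ?] /andP[? ?]; exact/boxP.
Qed.

Lemma mu2_bounded_lty (A : set (R * R)) : measurable (A : set T2) ->
  bounded_set A -> (mu2 R A < +oo)%E.
Proof.
move=> mA /bounded_sub_box[M M0 AM].
apply: le_lt_trans (mu2_box_lty (- M) M (- M) M).
by apply: le_measure => //; rewrite inE//; exact: measurable_box.
Qed.

End plane_measurability.

Section compact_support.
Context {R : realType}.
Local Notation T2 := (measurableTypeR R * measurableTypeR R)%type.

Lemma continuous_compact_support_bounded (f : R * R -> R) (K : set (R * R)) :
  continuous f -> compact K -> (forall x, ~ K x -> f x = 0) ->
  exists M, forall x, `|f x| <= M.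
Proof.
move=> cf cK f0.
have : compact (f @` K).
  by apply: continuous_compact => //; exact: continuous_subspaceT.
move=> /compact_bounded[M [_ hM]]; exists (`|M| + 1) => x.
have [Kx|/f0 ->] := pselect (K x); last by rewrite normr0 addr_ge0.
by apply: hM; [rewrite (le_lt_trans (ler_norm _))// ltrDl|exists x].
Qed.

Lemma integrable_compact_support (f : R * R -> R) (K D : set (R * R)) :
  measurable (D : set T2) ->
  continuous f -> compact K -> (forall x, ~ K x -> f x = 0) ->
  (mu2 R).-integrable D (EFin \o f).
Proof.
move=> mD cf cK f0; apply: (@integrableS _ _ _ _ setT) => //.
have mf := continuous_measurable2 (D := setT) cf.
have [M hM] := continuous_compact_support_bounded cf cK f0.
have mK : measurable (K : set T2).
  by apply: closed_measurable2; apply: compact_closed => //; exact: norm_hausdorff.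
have Kfin : (mu2 R K < +oo)%E.
  by apply: mu2_bounded_lty => //; exact: compact_bounded.
have : (mu2 R).-integrable K (EFin \o f).
  apply: measurable_bounded_integrable => //.
    exact: measurable_funTS.
  exists M; split; first exact: num_real.
  by move=> N MN x _; apply: le_trans (hM x) (ltW MN).
rewrite (integrable_mkcond _ mK); apply: eq_integrable => // x _.
rewrite patchE; case: ifPn => //= /negP nK; rewrite f0// => Kx.
by apply: nK; exact: mem_set.
Qed.

End compact_support.

Section line_derivatives.
Context {R : realType}.

(** The two difference quotients are the same function of [h], so a partial derivative can be
    handled as a one-variable derivative along a line. *)
Lemma is_derive_e1 (F : R * R -> R) (x : R * R) (l : R) :
  is_derive x (e1 R) F l <-> is_derive x.1 (1 : R) (fun t => F (t, x.2)) l.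
Proof.
have E : (fun h : R => h^-1 *: (F (h *: e1 R + x) - F x)) =
    (fun h => h^-1 *: (F (h *: 1 + x.1, x.2) - F (x.1, x.2))).
  apply/funext => h; congr (_ *: (F _ - F _)); last by case: x.
  by rewrite /e1; case: x => a b /=; congr (_, _); rewrite /= scaler0 add0r.
split=> -[dF dE]; (split; first by move: dF; rewrite /derivable E);
  by rewrite -dE /derive E.
Qed.

Lemma is_derive_e2 (F : R * R -> R) (x : R * R) (l : R) :
  is_derive x (e2 R) F l <-> is_derive x.2 (1 : R) (fun t => F (x.1, t)) l.
Proof.
have E : (fun h : R => h^-1 *: (F (h *: e2 R + x) - F x)) =
    (fun h => h^-1 *: (F (x.1, h *: 1 + x.2) - F (x.1, x.2))).
  apply/funext => h; congr (_ *: (F _ - F _)); last by case: x.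
  by rewrite /e2; case: x => a b /=; congr (_, _); rewrite /= scaler0 add0r.
split=> -[dF dE]; (split; first by move: dF; rewrite /derivable E);
  by rewrite -dE /derive E.
Qed.

Lemma continuous_line1 (F : R * R -> R) (b : R) : continuous F ->
  continuous (fun t => F (t, b)).
Proof.
move=> cF t.
apply: (@continuous2_cvg _ _ _ _ _ _ id (fun=> b) (fun u v => F (u, v)) t b).
- by rewrite (_ : (fun z => _) = F); [exact: cF|apply/funext => -[]].
- exact: cvg_id.
- exact: cvg_cst.
Qed.

Lemma continuous_line2 (F : R * R -> R) (a : R) : continuous F ->
  continuous (fun t => F (a, t)).
Proof.
move=> cF t.
apply: (@continuous2_cvg _ _ _ _ _ _ (fun=> a) id (fun u v => F (u, v)) a t).
- by rewrite (_ : (fun z => _) = F); [exact: cF|apply/funext => -[]].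
- exact: cvg_cst.
- exact: cvg_id.
Qed.

Lemma FTC2_is_derive (f F : R -> R) (a b : R) : a <= b -> continuous f ->
  (forall x, is_derive x (1 : R) F (f x)) ->
  (\int[lebesgue_measure]_(x in `[a, b]) (f x)%:E = (F b - F a)%:E)%E.
Proof.
move=> ab cf dF; move: ab; rewrite le_eqVlt => /predU1P[<-|ab].
  by rewrite set_itv1 integral_set1 subrr.
have cF : continuous F.
  by move=> x; apply/differentiable_continuous/derivable1_diffP; have [] := dF x.
rewrite (@continuous_FTC2 _ f F) ?EFinB//.
- exact: continuous_subspaceT.
- split.
  + by move=> x _; have [] := dF x.
  + by apply: cvg_at_right_filter; exact: cF.
  + by apply: cvg_at_left_filter; exact: cF.
- by move=> x _; rewrite derive1E; have [_ ->] := dF x.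
Qed.

End line_derivatives.

Section divergence.
Context {R : realType}.
Local Notation T2 := (measurableTypeR R * measurableTypeR R)%type.

Lemma integral_line0 (f F : R -> R) (M : R) : 0 < M -> continuous f ->
  (forall x, is_derive x (1 : R) F (f x)) ->
  (forall x, M < `|x| -> F x = 0) -> (forall x, M < `|x| -> f x = 0) ->
  (\int[lebesgue_measure]_x (f x)%:E = 0)%E.
Proof.
move=> M0 cf dF F0 f0.
(* The margin 1 puts the endpoints where [F] is known to vanish, strictly beyond [M]. *)
have := @FTC2_is_derive R f F (- (M + 1)) (M + 1) (ltac:(lra)) cf dF.
rewrite !F0; first last.
- by rewrite ger0_norm; lra.
- by rewrite ler0_norm; lra.
rewrite subrr integral_mkcond => h0; rewrite -[RHS]h0; apply: eq_integral => x _.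
rewrite patchE; case: ifPn => // /negP; rewrite inE/= in_itv/= => h.
rewrite f0// ltNge; apply/negP; rewrite ler_norml => /andP[? ?]; apply: h.
by apply/andP; split; lra.
Qed.

(** The divergence theorem without boundary term: by Fubini with the variable of [e] innermost, each
    line contributes the difference of two values of [F] beyond its support. *)
Lemma integral_derive_compact_support (F G : R * R -> R) (K : set (R * R)) e :
  e = e1 R \/ e = e2 R ->
  (forall x, is_derive x e F (G x)) -> continuous G -> compact K ->
  (forall x, ~ K x -> F x = 0) -> (forall x, ~ K x -> G x = 0) ->
  Rintegral (mu2 R) setT G = 0.
Proof.
move=> he dF cG cK F0 G0.
have iG := integrable_compact_support measurableT cG cK G0.
have [M M0 KM] := bounded_sub_box (compact_bounded cK).
have nK (a b : R) : M < `|a| \/ M < `|b| -> ~ K (a, b).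
  by move=> h /KM/boxP[/= h1 h2 h3 h4]; case: h; rewrite ltNge => /negP; apply;
    rewrite ler_norml; apply/andP; split.
rewrite /Rintegral /mu2; case: he => he; subst e.
  rewrite -integral21_prod_meas1//= /fubini_G.
  rewrite (eq_integral (cst 0%E)) ?integral0// => y _.
  apply: (@integral_line0 (fun x => G (x, y)) (fun x => F (x, y)) M M0).
  - exact: continuous_line1.
  - by move=> x; exact: (@is_derive_e1 _ F (x, y) _).1.
  - by move=> x xM; apply: F0; apply: nK; left.
  - by move=> x xM; apply: G0; apply: nK; left.
rewrite -integral12_prod_meas1//= /fubini_F.
rewrite (eq_integral (cst 0%E)) ?integral0// => x _.
apply: (@integral_line0 (fun y => G (x, y)) (fun y => F (x, y)) M M0).
- exact: continuous_line2.
- by move=> y; exact: (@is_derive_e2 _ F (x, y) _).1.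
- by move=> y xM; apply: F0; apply: nK; right.
- by move=> y xM; apply: G0; apply: nK; right.
Qed.

End divergence.

(** * Derivatives and continuity of complex-valued functions *)

Definition is_Cderive {R : realType} (t : R) (f : R -> R[i]) (l : R[i]) :=
  is_derive t (1 : R) (fun u => cRe (f u)) (cRe l) /\
  is_derive t (1 : R) (fun u => cIm (f u)) (cIm l).

Definition Ccontinuous_at {R : realType} {T : topologicalType} (f : T -> R[i]) (x : T) :=
  {for x, continuous (fun u => cRe (f u))} /\
  {for x, continuous (fun u => cIm (f u))}.

Section Cderive.
Context {R : realType}.
Implicit Types (f g : R -> R[i]) (t : R).

Lemma is_Cderive_cst t (c : R[i]) : is_Cderive t (fun=> c) 0.
Proof. by split; exact: is_derive_cst. Qed.

Lemma is_Cderive_affine t (a b : R[i]) : is_Cderive t (fun u => a + u%:C * b) b.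
Proof.
have H (p q : R) : is_derive t (1 : R) (fun u => p + u * q) q.
  have h := is_deriveD (is_derive_cst p t (1:R)) (is_deriveZ q (is_derive_id t (1:R))).
  rewrite (_ : (fun u => _) = cst p + q \*: id).
    by apply: is_derive_eq; rewrite add0r /GRing.scale /= mulr1.
  by apply/funext => u; rewrite mulrC.
split.
  rewrite (_ : (fun u => _) = (fun u => cRe a + u * cRe b))//.
  by apply/funext => u; rewrite cReD cReM /= mul0r subr0.
rewrite (_ : (fun u => _) = (fun u => cIm a + u * cIm b))//.
by apply/funext => u; rewrite cImD cImM /= mul0r addr0.
Qed.

Lemma is_CderiveM t f g l m : is_Cderive t f l -> is_Cderive t g m ->
  is_Cderive t (fun u => f u * g u) (f t * m + g t * l).
Proof.
move=> [fr fi] [gr gi]; split.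
  have := is_deriveB (is_deriveM fr gr) (is_deriveM fi gi).
  rewrite (_ : _ - _ = (fun u => cRe (f u * g u))); last first.
    by apply/funext => u; rewrite cReM.
  move=> h; apply: is_derive_eq; rewrite cReD !cReM /GRing.scale /=; ring.
have := is_deriveD (is_deriveM fr gi) (is_deriveM fi gr).
rewrite (_ : _ + _ = (fun u => cIm (f u * g u))); last first.
  by apply/funext => u; rewrite cImM.
by move=> h; apply: is_derive_eq; rewrite cImD !cImM /GRing.scale /=; ring.
Qed.

Lemma cReV (z : R[i]) : cRe z^-1 =
  cRe z * (cRe z * cRe z + cIm z * cIm z)^-1.
Proof. by case: z => a b; rewrite /= -!expr2. Qed.

Lemma cImV (z : R[i]) : cIm z^-1 =
  - cIm z * (cRe z * cRe z + cIm z * cIm z)^-1.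
Proof. by case: z => a b; rewrite /= -!expr2 mulNr. Qed.

Lemma sqrReIm_neq0 (z : R[i]) : z != 0 ->
  cRe z * cRe z + cIm z * cIm z != 0.
Proof.
case: z => a b; rewrite eq_complex /= -!expr2 => h.
by rewrite paddr_eq0 ?sqr_ge0// !sqrf_eq0.
Qed.

Lemma is_CderiveV t f l : f t != 0 -> is_Cderive t f l ->
  is_Cderive t (fun u => (f u)^-1) (- l / (f t) ^+ 2).
Proof.
move=> ft0 [fr fi].
have n0 := sqrReIm_neq0 ft0.
have dN0 : is_derive t (1 : R) (fun u => cRe (f u) * cRe (f u) +
    cIm (f u) * cIm (f u)) _ :=
  is_deriveD (is_deriveM fr fr) (is_deriveM fi fi).
have dN := @is_deriveV _ (fun u => cRe (f u) * cRe (f u) +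
  cIm (f u) * cIm (f u)) t _ _ n0 dN0.
split.
  have := is_deriveM fr dN.
  rewrite (_ : _ * _ = (fun u => cRe (f u)^-1)); last first.
    by apply/funext => u; rewrite cReV.
  move=> h; apply: is_derive_eq.
  rewrite [f t ^+ 2]expr2 (invfM (f t)) !(cReM, cImM, cReV, cImV, cReN, cImN).
  by rewrite /GRing.scale /=; field; exact: n0.
have := is_deriveM (is_deriveN fi) dN.
rewrite (_ : _ * _ = (fun u => cIm (f u)^-1)); last first.
  by apply/funext => u; rewrite cImV.
move=> h; apply: is_derive_eq.
rewrite [f t ^+ 2]expr2 (invfM (f t)) !(cReM, cImM, cReV, cImV, cReN, cImN).
by rewrite !fctE /GRing.scale /=; field; exact: n0.
Qed.

Lemma is_CderiveX t f l n : is_Cderive t f l ->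
  is_Cderive t (fun u => (f u) ^+ n.+1) (n.+1%:R * f t ^+ n * l).
Proof.
move=> dl; elim: n => [|n ih].
  by rewrite expr0 mulr1 mul1r.
have := is_CderiveM dl ih.
suff -> : f t * (n.+1%:R * f t ^+ n * l) + f t ^+ n.+1 * l =
  n.+2%:R * f t ^+ n.+1 * l by [].
by rewrite exprS -[n.+2]addn1 natrD; ring.
Qed.

Lemma is_Cderive_exprV t f l n : f t != 0 -> is_Cderive t f l ->
  is_Cderive t (fun u => (f u) ^- n.+1) (- n.+1%:R * l * f t ^- n.+2).
Proof.
move=> ft0 dl; have := is_CderiveV (expf_neq0 n.+1 ft0) (is_CderiveX n dl).
suff -> : - (n.+1%:R * f t ^+ n * l) / f t ^+ n.+1 ^+ 2 =
  - n.+1%:R * l * f t ^- n.+2 by [].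
by rewrite !exprS; field; rewrite expf_neq0.
Qed.

End Cderive.

Section Ccontinuous.
Context {R : realType} {T : topologicalType}.
Implicit Types (f g : T -> R[i]) (x : T).

Lemma Ccontinuous_atD f g x : Ccontinuous_at f x -> Ccontinuous_at g x ->
  Ccontinuous_at (fun u => f u + g u) x.
Proof.
move=> [fr fi] [gr gi]; split.
  rewrite (_ : (fun u => _) = (fun u => cRe (f u) + cRe (g u))).
    exact: cvgD.
  by apply/funext => u; rewrite cReD.
rewrite (_ : (fun u => _) = (fun u => cIm (f u) + cIm (g u))).
  exact: cvgD.
by apply/funext => u; rewrite cImD.
Qed.

Lemma Ccontinuous_atM f g x : Ccontinuous_at f x -> Ccontinuous_at g x ->
  Ccontinuous_at (fun u => f u * g u) x.
Proof.
move=> [fr fi] [gr gi]; split.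
  rewrite (_ : (fun u => _) = (fun u => cRe (f u) * cRe (g u) -
      cIm (f u) * cIm (g u))).
    by apply: cvgB; exact: cvgM.
  by apply/funext => u; rewrite cReM.
rewrite (_ : (fun u => _) = (fun u => cRe (f u) * cIm (g u) +
    cIm (f u) * cRe (g u))).
  by apply: cvgD; exact: cvgM.
by apply/funext => u; rewrite cImM.
Qed.

Lemma Ccontinuous_at_cst (c : R[i]) x : Ccontinuous_at (fun=> c) x.
Proof. by split; exact: cvg_cst. Qed.

Lemma Ccontinuous_at_real (f : T -> R) x : {for x, continuous f} ->
  Ccontinuous_at (fun u => (f u)%:C) x.
Proof. by move=> cf; split => //; exact: cvg_cst. Qed.

Lemma Ccontinuous_atV f x : f x != 0 -> Ccontinuous_at f x ->
  Ccontinuous_at (fun u => (f u)^-1) x.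
Proof.
move=> fx0 [fr fi]; have n0 := sqrReIm_neq0 fx0.
have cN : {for x, continuous (fun u => (cRe (f u) * cRe (f u) +
  cIm (f u) * cIm (f u))^-1)}.
  by apply: (cvgV n0); apply: cvgD; exact: cvgM.
split.
  rewrite (_ : (fun u => _) = (fun u => cRe (f u) * (cRe (f u) *
      cRe (f u) + cIm (f u) * cIm (f u))^-1)).
    exact: cvgM.
  by apply/funext => u; rewrite cReV.
rewrite (_ : (fun u => _) = (fun u => - cIm (f u) * (cRe (f u) *
    cRe (f u) + cIm (f u) * cIm (f u))^-1)).
  by apply: cvgM => //; exact: cvgN.
by apply/funext => u; rewrite cImV.
Qed.

Lemma Ccontinuous_atX f n x : Ccontinuous_at f x ->
  Ccontinuous_at (fun u => (f u) ^+ n) x.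
Proof.
move=> cf; elim: n => [|n ih]; first exact: Ccontinuous_at_cst.
rewrite (_ : (fun u => _) = (fun u => f u * f u ^+ n)).
  exact: Ccontinuous_atM.
by apply/funext => u; rewrite exprS.
Qed.

Lemma Ccontinuous_at_exprV f n x : f x != 0 -> Ccontinuous_at f x ->
  Ccontinuous_at (fun u => (f u) ^- n) x.
Proof.
move=> fx0 cf; apply: Ccontinuous_atV; first exact: expf_neq0.
exact: Ccontinuous_atX.
Qed.

End Ccontinuous.

(** * Improper integrals of inverse powers of affine functions *)

Section half_line.
Context {R : realType}.
Local Notation leb := (@lebesgue_measure R).

(* Applying the nonnegative improper FTC to [g] and to [g + f]. *)
Lemma dominated_FTC2y (f F g G : R -> R) (a l m : R) :
  continuous f -> continuous g ->
  (forall t, is_derive t (1 : R) F (f t)) ->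
  (forall t, is_derive t (1 : R) G (g t)) ->
  (forall t, `|f t| <= g t) ->
  F x @[x --> +oo] --> l -> G x @[x --> +oo] --> m ->
  leb.-integrable `[a, +oo[ (EFin \o f) /\
  Rintegral leb `[a, +oo[ f = l - F a.
Proof.
move=> cf cg dF dG fg Fl Gm.
have key (h H : R -> R) (k : R) : continuous h ->
    (forall t, is_derive t (1 : R) H (h t)) -> (forall t, 0 <= h t) ->
    H x @[x --> +oo] --> k ->
    leb.-integrable `[a, +oo[ (EFin \o h) /\ Rintegral leb `[a, +oo[ h = k - H a.
  move=> ch dH h0 Hk.
  have cH : continuous H.
    by move=> x; apply/differentiable_continuous/derivable1_diffP; have [] := dH x.
  have E : (\int[leb]_(x in `[a, +oo[) (h x)%:E = k%:E - (H a)%:E)%E.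
    apply: ge0_continuous_FTC2y => //.
    - exact: continuous_subspaceT.
    - by apply: cvg_at_right_filter; exact: cH.
    - by move=> x _; rewrite derive1E; have [_ ->] := dH x.
  split; last by rewrite /Rintegral E.
  apply/integrableP; split.
    by apply/measurable_EFinP/measurable_funTS; exact: continuous_measurable_fun.
  suff -> : (\int[leb]_(x in `[a, +oo[) `|(EFin \o h) x| =
      \int[leb]_(x in `[a, +oo[) (h x)%:E)%E by rewrite E -EFinB ltry.
  by apply: eq_integral => x _ /=; rewrite ger0_norm.
have g0 t : 0 <= g t by rewrite (le_trans _ (fg t)).
have [ig Ig] := key g G m cg dG g0 Gm.
have [igf Igf] : leb.-integrable `[a, +oo[ (EFin \o (fun x => f x + g x)) /\
    Rintegral leb `[a, +oo[ (fun x => f x + g x) = (l + m) - (F a + G a).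
  apply: (key _ (fun x => F x + G x)).
  - by move=> x; apply: cvgD; [exact: cf|exact: cg].
  - by move=> t; have := fg t; rewrite ler_norml; lra.
  - exact: cvgD.
have if_ : leb.-integrable `[a, +oo[ (EFin \o f).
  apply: le_integrable ig => //.
    by apply/measurable_EFinP/measurable_funTS; exact: continuous_measurable_fun.
  by move=> x _ /=; rewrite lee_fin (le_trans (fg x))// ler_norm.
split => //; move: Igf; rewrite RintegralD// Ig => /(canRL (addrK _)) ->; ring.
Qed.

(** The mirror image at [-oo]: for a nonnegative integrand the substitution [t -> -t] leads back to
    the half-line from [-a] to [+oo]. *)
Lemma dominated_FTC2Ny (f F g G : R -> R) (a l m : R) :
  continuous f -> continuous g ->
  (forall t, is_derive t (1 : R) F (f t)) ->
  (forall t, is_derive t (1 : R) G (g t)) ->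
  (forall t, `|f t| <= g t) ->
  F x @[x --> -oo] --> l -> G x @[x --> -oo] --> m ->
  leb.-integrable `]-oo, a] (EFin \o f) /\
  Rintegral leb `]-oo, a] f = F a - l.
Proof.
move=> cf cg dF dG fg Fl Gm.
have key (h H : R -> R) (k : R) : continuous h ->
    (forall t, is_derive t (1 : R) H (h t)) -> (forall t, 0 <= h t) ->
    H x @[x --> -oo] --> k ->
    leb.-integrable `]-oo, a] (EFin \o h) /\ Rintegral leb `]-oo, a] h = H a - k.
  move=> ch dH h0 Hk.
  have cH : continuous H.
    by move=> x; apply/differentiable_continuous/derivable1_diffP; have [] := dH x.
  have E : (\int[leb]_(x in `]-oo, a]) (h x)%:E = (H a - k)%:E)%E.
    rewrite -{1}(opprK a) ge0_integration_by_substitutionNy//; last first.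
      exact: continuous_subspaceT.
    rewrite (@ge0_continuous_FTC2y _ (h \o -%R) (fun x => - H (- x)) _ (- k)).
    - by rewrite opprK -EFinB opprK addrC.
    - by move=> x _; exact: h0.
    - apply: continuous_subspaceT => x.
      by apply: continuous_comp; [exact: oppr_continuous|exact: ch].
    - by apply: cvgN; exact/cvgNy_compNP.
    - move=> x _.
      have : is_derive x (1 : R) (- (H \o -%R)) (- (h (- x) * - 1)).
        by apply: is_deriveN; apply: is_derive1_comp.
      by move=> [].
    - apply: cvg_at_right_filter; apply: cvgN.
      by apply: continuous_comp; [exact: oppr_continuous|exact: cH].
    - move=> x _; rewrite derive1E.
      have : is_derive x (1 : R) (- (H \o -%R)) (- (h (- x) * - 1)).
        by apply: is_deriveN; apply: is_derive1_comp.
      by move=> [_]; rewrite mulrN1 opprK.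
  split; last by rewrite /Rintegral E.
  apply/integrableP; split.
    by apply/measurable_EFinP/measurable_funTS; exact: continuous_measurable_fun.
  suff -> : (\int[leb]_(x in `]-oo, a]) `|(EFin \o h) x| =
      \int[leb]_(x in `]-oo, a]) (h x)%:E)%E by rewrite E ltry.
  by apply: eq_integral => x _ /=; rewrite ger0_norm.
have g0 t : 0 <= g t by rewrite (le_trans _ (fg t)).
have [ig Ig] := key g G m cg dG g0 Gm.
have [igf Igf] : leb.-integrable `]-oo, a] (EFin \o (fun x => f x + g x)) /\
    Rintegral leb `]-oo, a] (fun x => f x + g x) = (F a + G a) - (l + m).
  apply: (key _ (fun x => F x + G x)).
  - by move=> x; apply: cvgD; [exact: cf|exact: cg].
  - by move=> t; have := fg t; rewrite ler_norml; lra.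
  - exact: cvgD.
have if_ : leb.-integrable `]-oo, a] (EFin \o f).
  apply: le_integrable ig => //.
    by apply/measurable_EFinP/measurable_funTS; exact: continuous_measurable_fun.
  by move=> x _ /=; rewrite lee_fin (le_trans (fg x))// ler_norm.
split => //; move: Igf; rewrite RintegralD// Ig => /(canRL (addrK _)) ->; ring.
Qed.

Section affine_power.
Variables (p q : R).
Hypothesis q0 : q != 0.
Local Notation A t := (t%:C - (p +i* q)).

Let sqr_normA t : normc (A t) ^+ 2 = (t - p) ^+ 2 + q ^+ 2.
Proof. by rewrite sqr_normcE /= sub0r sqrrN. Qed.

Lemma affine_neq0 t : A t != 0.
Proof.
apply/negP => /eqP A0; have := sqr_normA t; rewrite A0 normc0 expr0n /= => /esym/eqP.
by rewrite paddr_eq0 ?sqr_ge0// !sqrf_eq0 (negbTE q0) andbF.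
Qed.

Let normA_ge t : `|q| <= normc (A t).
Proof.
rewrite -(ler_pXn2r (n:=2))// ?nnegrE ?normc_ge0// sqr_normA real_normK ?num_real//.
by rewrite lerDr sqr_ge0.
Qed.

Let dA t : is_Cderive t (fun u => A u) 1.
Proof.
have := is_Cderive_affine t (- (p +i* q)) 1.
rewrite (_ : (fun u => _ + _ * _) = (fun u => A u))//.
by apply/funext => u; rewrite mulr1 addrC.
Qed.

Let cA (t : R) : Ccontinuous_at (fun u : R => A u) t.
Proof.
apply: Ccontinuous_atD; last exact: Ccontinuous_at_cst.
by apply: Ccontinuous_at_real; exact: cvg_id.
Qed.

Let F n t := - (n.+1%:R)^-1 * (A t) ^- n.+1.

Let dF n t : is_Cderive t (F n) ((A t) ^- n.+2).
Proof.
have := is_CderiveM (is_Cderive_cst t (- (n.+1%:R)^-1))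
  (is_Cderive_exprV n (affine_neq0 t) (dA t)).
suff -> : - n.+1%:R^-1 * (- n.+1%:R * 1 * A t ^- n.+2) + A t ^- n.+1 * 0 =
  A t ^- n.+2 by [].
rewrite mulr0 addr0 mulr1 mulNr mulrN mulNr opprK mulrA mulVf ?mul1r//.
Qed.

(** A primitive of [((t - p)^2 + q^2)^-1] with finite limits at both ends, so that this function can
    serve as the dominating one. *)
Let G (t : R) := `|q| ^-1 * atan ((t - p) / `|q|).

Let aq0 : 0 < `|q|. Proof. by rewrite normr_gt0. Qed.

Let dG t : is_derive t (1 : R) G ((t - p) ^+ 2 + q ^+ 2)^-1.
Proof.
have d1 : is_derive t (1 : R) (fun u => (u - p) / `|q|) (`|q|^-1).
  have := is_deriveZ (`|q|^-1) (is_deriveB (is_derive_id t (1:R)) (is_derive_cst p t (1:R))).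
  rewrite subr0 /GRing.scale /= mulr1.
  by rewrite (_ : _ \*: _ = (fun u => (u - p) / `|q|))//; apply/funext => u /=; rewrite mulrC.
have d2 := is_deriveZ (`|q|^-1) (@is_derive1_comp _ atan (fun u => (u - p) / `|q|) t _ _
  (is_derive1_atan ((t - p) / `|q|)) d1).
apply: is_derive_eq; rewrite /GRing.scale /=.
have -> : q ^+ 2 = `|q| ^+ 2 by rewrite real_normK ?num_real.
field; apply/andP; split; last by rewrite gt_eqF.
by rewrite gt_eqF// ltr_wpDl ?sqr_ge0// exprn_gt0.
Qed.

Let pos t : 0 < (t - p) ^+ 2 + q ^+ 2.
Proof. by rewrite ltr_wpDl ?sqr_ge0// exprn_even_gt0. Qed.

Let cG' : continuous (fun t => ((t - p) ^+ 2 + q ^+ 2)^-1).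
Proof.
move=> t; apply: cvgV; first by rewrite gt_eqF// pos.
apply: cvgD; last exact: cvg_cst.
by apply: (@cvgM _ _ _ _ (fun x => x - p) (fun x => x - p));
  (apply: cvgB; [exact: cvg_id|exact: cvg_cst]).
Qed.

(** Of the [n + 2] factors, [n] are bounded by [|q|^-1]; the other two give the integrable
    Lorentzian. *)
Let domA n t : normc ((A t) ^- n.+2) <= `|q| ^- n * ((t - p) ^+ 2 + q ^+ 2)^-1.
Proof.
rewrite -sqr_normA normcV normc_expr -addn2 exprD invfM ler_wpM2r//.
  by rewrite invr_ge0 sqr_ge0.
by rewrite lef_pV2 ?posrE ?exprn_gt0 ?(lt_le_trans aq0)// lerXn2r ?nnegrE ?normc_ge0 ?normA_ge.
Qed.

Let vanish n t : `|t - p| != 0 -> normc (F n t) <= `|q| ^- n * `|t - p|^-1.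
Proof.
move=> t0; rewrite /F normcM normcN.
have tpos : 0 < `|t - p| by rewrite lt_neqAle eq_sym t0 normr_ge0.
have tA : `|t - p| <= normc (A t).
  rewrite -(ler_pXn2r (n:=2))// ?nnegrE ?normc_ge0// sqr_normA.
  by rewrite real_normK ?num_real// lerDl sqr_ge0.
have -> : normc (n.+1%:R^-1 : R[i]) = n.+1%:R^-1.
  by rewrite normcV (_ : n.+1%:R = (n.+1%:R : R)%:C) ?normcR ?ger0_norm// rmorph_nat.
apply: (@le_trans _ _ (normc (A t ^- n.+1))).
  rewrite ler_piMl ?normc_ge0// invf_le1 ?ler1n//.
rewrite normcV normc_expr exprSr invfM ler_pM ?invr_ge0 ?exprn_ge0 ?normc_ge0//.
  by rewrite lef_pV2 ?posrE ?exprn_gt0 ?(lt_le_trans aq0)// lerXn2r ?nnegrE ?normc_ge0 ?normA_ge.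
by rewrite lef_pV2 ?posrE// (lt_le_trans tpos).
Qed.

Let cvg_F n (h : R[i] -> R) (hle : forall z, `|h z| <= normc z) :
  (h (F n t) @[t --> +oo] --> 0) * (h (F n t) @[t --> -oo] --> 0).
Proof.
have key (FF : set_system R) : ProperFilter FF ->
    (forall e, 0 < e -> \forall t \near FF, e < `|t - p|) -> h (F n t) @[t --> FF] --> 0.
  move=> FFF hF; apply/cvgr0Pnorm_le => e e0.
  have k0 : 0 < `|q| ^- n by rewrite invr_gt0 exprn_gt0.
  have ke : 0 < `|q| ^- n / e by exact: divr_gt0.
  apply: filterS (hF _ ke) => t ht.
  have tp : 0 < `|t - p| by exact: lt_trans ht.
  apply: (le_trans (hle _)); apply: (le_trans (vanish n (lt0r_neq0 tp))).
  by rewrite ler_pdivrMr// mulrC -ler_pdivrMr// ltW.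
split.
  apply: key => e e0; near=> t.
  have : p + e < t by near: t; apply: nbhs_pinfty_gt; exact: num_real.
  by move=> ?; rewrite gtr0_norm; lra.
apply: key => e e0; near=> t.
have : t < p - e by near: t; apply: nbhs_ninfty_lt; exact: num_real.
by move=> ?; rewrite ltr0_norm; lra.
Unshelve. all: by end_near. Qed.

Let cvg_G : (G t @[t --> +oo] --> `|q|^-1 * (pi / 2)) *
  (G t @[t --> -oo] --> `|q|^-1 * - (pi / 2)).
Proof.
split.
  apply: cvgMl_tmp.
  apply: (@cvg_comp _ _ _ (fun t => (t - p) / `|q|) atan _ _ _ _ (@cvgy_atan R)).
  apply/cvgryPge => M; near=> t.
  rewrite ler_pdivlMr// lerBrDr.
  by near: t; apply: nbhs_pinfty_ge; exact: num_real.
apply: cvgMl_tmp; apply/cvgNy_compNP.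
rewrite (_ : _ \o _ = - (fun t => atan ((t + p) / `|q|))); last first.
  by apply/funext => t /=; rewrite fctE -atanN; congr atan; ring.
apply: cvgN.
apply: (@cvg_comp _ _ _ (fun t => (t + p) / `|q|) atan _ _ _ _ (@cvgy_atan R)).
apply/cvgryPge => M; near=> t.
rewrite ler_pdivlMr// -lerBlDr.
by near: t; apply: nbhs_pinfty_ge; exact: num_real.
Unshelve. all: by end_near. Qed.

Let c_exprV n (t : R) : Ccontinuous_at (fun u : R => (A u) ^- n) t.
Proof. by apply: Ccontinuous_at_exprV; [exact: affine_neq0|exact: cA]. Qed.

(** The primitive [F n] tends to 0 at infinity, so only the endpoint survives. Real and imaginary
    parts share the majorant of [domA]. *)
Lemma Cintegral_affine_exprV_y (a : R) n :
  Cintegrable leb `[a, +oo[ (fun t => (A t) ^- n.+2) /\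
  Cintegral leb `[a, +oo[ (fun t => (A t) ^- n.+2) = (n.+1%:R)^-1 * (A a) ^- n.+1.
Proof.
have dG2 t : is_derive t (1 : R) (fun u => `|q| ^- n * G u)
    (`|q| ^- n * ((t - p) ^+ 2 + q ^+ 2)^-1).
  exact: (is_deriveZ (`|q| ^- n) (dG t)).
have cG2 : continuous (fun t => `|q| ^- n * ((t - p) ^+ 2 + q ^+ 2)^-1).
  by move=> t; apply: cvgMl_tmp; exact: cG'.
have hG2 : (fun t => `|q| ^- n * G t) x @[x --> +oo] --> `|q| ^- n * (`|q|^-1 * (pi / 2)).
  by apply: cvgMl_tmp; exact: cvg_G.1.
have [i1 e1] := @dominated_FTC2y (fun t => cRe (A t ^- n.+2))
  (fun t => cRe (F n t)) _ _ a 0 _ (fun t => (c_exprV n.+2 t).1) cG2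
  (fun t => (dF n t).1) dG2 (fun t => le_trans (normr_Re_le _) (domA n t))
  (cvg_F n (@normr_Re_le R)).1 hG2.
have [i2 e2] := @dominated_FTC2y (fun t => cIm (A t ^- n.+2))
  (fun t => cIm (F n t)) _ _ a 0 _ (fun t => (c_exprV n.+2 t).2) cG2
  (fun t => (dF n t).2) dG2 (fun t => le_trans (normr_Im_le _) (domA n t))
  (cvg_F n (@normr_Im_le R)).1 hG2.
split=> //; rewrite /Cintegral e1 e2 !sub0r -cReN -cImN -complex_eta /F mulNr opprK//.
Qed.

Lemma Cintegral_affine_exprV_Ny (a : R) n :
  Cintegrable leb `]-oo, a] (fun t => (A t) ^- n.+2) /\
  Cintegral leb `]-oo, a] (fun t => (A t) ^- n.+2) = - (n.+1%:R)^-1 * (A a) ^- n.+1.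
Proof.
have dG2 t : is_derive t (1 : R) (fun u => `|q| ^- n * G u)
    (`|q| ^- n * ((t - p) ^+ 2 + q ^+ 2)^-1).
  exact: (is_deriveZ (`|q| ^- n) (dG t)).
have cG2 : continuous (fun t => `|q| ^- n * ((t - p) ^+ 2 + q ^+ 2)^-1).
  by move=> t; apply: cvgMl_tmp; exact: cG'.
have hG2 : (fun t => `|q| ^- n * G t) x @[x --> -oo] --> `|q| ^- n * (`|q|^-1 * - (pi / 2)).
  by apply: cvgMl_tmp; exact: cvg_G.2.
have [i1 e1] := @dominated_FTC2Ny (fun t => cRe (A t ^- n.+2))
  (fun t => cRe (F n t)) _ _ a 0 _ (fun t => (c_exprV n.+2 t).1) cG2
  (fun t => (dF n t).1) dG2 (fun t => le_trans (normr_Re_le _) (domA n t))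
  (cvg_F n (@normr_Re_le R)).2 hG2.
have [i2 e2] := @dominated_FTC2Ny (fun t => cIm (A t ^- n.+2))
  (fun t => cIm (F n t)) _ _ a 0 _ (fun t => (c_exprV n.+2 t).2) cG2
  (fun t => (dF n t).2) dG2 (fun t => le_trans (normr_Im_le _) (domA n t))
  (cvg_F n (@normr_Im_le R)).2 hG2.
by split=> //; rewrite /Cintegral e1 e2 !subr0 -complex_eta.
Qed.

End affine_power.

End half_line.

(** * Sectors *)

Section sector_geometry.
Context {R : realType}.
Local Notation T2 := (measurableTypeR R * measurableTypeR R)%type.
Implicit Types (c x y : R * R) (a b t : R).

(** [acos] sees only the ratio of abscissa to radius, hence an angle between 0 and [pi] and an
    absolute value on the ordinate; the sign is put back by [Carg]. *)
Lemma polar_decomp y : y <> 0 ->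
  let r := Num.sqrt (y.1 ^+ 2 + y.2 ^+ 2) in
  let t := acos (y.1 / r) in
  [/\ 0 < r, 0 <= t <= pi, y.1 = r * cos t & `|y.2| = r * sin t].
Proof.
move=> y0 r t.
have r0 : 0 < r.
  rewrite sqrtr_gt0 lt_neqAle eq_sym addr_ge0 ?sqr_ge0// andbT.
  apply/negP; rewrite paddr_eq0 ?sqr_ge0// !sqrf_eq0 => /andP[/eqP h1 /eqP h2].
  by apply: y0; case: y h1 h2 {r t} => a b /= -> ->.
have rr : r ^+ 2 = y.1 ^+ 2 + y.2 ^+ 2 by rewrite sqr_sqrtr// addr_ge0 ?sqr_ge0.
have ler : `|y.1| <= r.
  by rewrite -(ler_pXn2r (n:=2))// ?nnegrE ?(ltW r0)// real_normK ?num_real// rr lerDl sqr_ge0.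
have le1 : -1 <= y.1 / r <= 1.
  rewrite ler_pdivlMr// ler_pdivrMr// mulN1r mul1r.
  by move: ler; rewrite ler_norml.
split => //.
- by rewrite acos_ge0// acos_lepi.
- by rewrite /t acosK ?in_itv//= mulrC divfK ?gt_eqF.
- rewrite /t sin_acos//.
  have -> : 1 - (y.1 / r) ^+ 2 = (y.2 / r) ^+ 2.
    rewrite !exprMn !exprVn rr; field.
    by rewrite -rr gt_eqF// exprn_gt0.
  by rewrite sqrtr_sqr normrM normfV (gtr0_norm r0) mulrC divfK ?gt_eqF.
Qed.

Lemma Carg_cases y :
  let t := acos (y.1 / Num.sqrt (y.1 ^+ 2 + y.2 ^+ 2)) in
  Carg y = if 0 <= y.2 then t else - t.
Proof. by []. Qed.

(* The aperture of the cone [-B |y2| < y1] is twice the larger of [|tm|, |tM|]. *)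
Lemma sector_sub_cone (tm tM : R) : - pi < tm -> tm < tM -> tM < pi ->
  exists2 B : R, 0 < B & forall c x, sector c tm tM x ->
    - (B * `|x.2 - c.2|) < x.1 - c.1.
Proof.
move=> htm hlt htM.
pose T := Num.max (- tm) tM.
have T0 : 0 < T by rewrite lt_max; case: (ltP 0 tM) => h; rewrite ?orbT//; lra.
have Tpi : T < pi by rewrite gt_max; apply/andP; split; lra.
have s0 : 0 < sin T by rewrite sin_gt0_pi//; apply/andP.
have B0 : 0 < (1 + `|cos T|) / sin T by rewrite divr_gt0// ltr_pwDl.
(* For an obtuse [T] any slope above [|cos T| / sin T] suffices; the added 1 leaves a strict margin
   and keeps the slope positive. At an acute [t] the bound is trivial, the abscissa being
   positive. *)
exists ((1 + `|cos T|) / sin T) => // c x [xc].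
have y0 : x - c <> 0 by move=> /subr0_eq.
have [r0 /andP[t0 tpi] e1 e2] := polar_decomp y0.
rewrite Carg_cases; set y := x - c in y0 r0 t0 tpi e1 e2 *.
rewrite -[x.1 - c.1]/(y.1) -[x.2 - c.2]/(y.2).
set r := Num.sqrt _ in r0 t0 tpi e1 e2 *; set t := acos _ in t0 tpi e1 e2 *.
move=> hC.
have tT : t < T.
  by move: hC; rewrite lt_max; case: ifP => _ /andP[h1 h2]; apply/orP;
    [right|left; lra].
have ct : cos T < cos t by rewrite ltr_cos// in_itv/=; apply/andP; split; lra.
rewrite e2 e1.
have st : 0 <= sin t by rewrite sin_ge0_pi//; apply/andP.
have [c0|c0] := ltP 0 (cos t).
  rewrite (@le_lt_trans _ _ 0)//; last exact: mulr_gt0.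
  by rewrite oppr_le0 mulr_ge0 ?(ltW B0)// mulr_ge0// ltW.
have cT0 : cos T < 0 by lra.
rewrite ltr0_norm//.
have S1 : sin T ^+ 2 + cos T ^+ 2 = 1 by rewrite addrC cos2Dsin2.
have S2 : sin t ^+ 2 + cos t ^+ 2 = 1 by rewrite addrC cos2Dsin2.
have -> : - ((1 - cos T) / sin T * (r * sin t)) =
    r * (- ((1 - cos T) * sin t) / sin T) by field; rewrite gt_eqF.
rewrite ltr_pM2l// ltr_pdivrMr//.
have [st0|st0] := eqVneq (sin t) 0.
  have : cos t = -1.
    have : (cos t - 1) * (cos t + 1) = 0 by move: S2; rewrite st0; lra.
    by move/eqP; rewrite mulf_eq0 => /orP[] /eqP h; lra.
  have : -1 < cos T.
    have := sqr_ge0 (cos T + 1); have : 0 < sin T ^+ 2 by rewrite exprn_gt0.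
    nra.
  by lra.
have stp : 0 < sin t by rewrite lt_neqAle eq_sym st0.
have sTt : sin T < sin t.
  by rewrite -(ltr_pXn2r (n:=2))// ?nnegrE ?(ltW s0)//; nra.
have h1 : - cos t < 1 - cos T by lra.
have := ltr_pM2l stp (- cos t) (1 - cos T); rewrite h1 => h2.
have : - cos t * sin T <= - cos t * sin t by rewrite ler_wpM2l ?(ltW sTt)//; lra.
by move: h2; rewrite -subr_gt0 => h2 h3; lra.
Qed.

(** Both sides express the sign of [sin (b - a)], with [b - a] strictly between [-pi] and [pi]. *)
Lemma lt_sin_cos a b : 0 <= a <= pi -> 0 < b < pi ->
  (a < b) = (sin a * cos b < cos a * sin b).
Proof.
move=> /andP[a0 api] /andP[b0 bpi].
have E : cos a * sin b - sin a * cos b = sin (b - a) by rewrite sinB; ring.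
rewrite -[RHS]subr_gt0 E.
have [ab|ba|->] := ltgtP a b.
- by apply/esym/sin_gt0_pi; apply/andP; split; lra.
- apply/esym/negbTE; rewrite -leNgt -opprB sinN oppr_le0.
  by apply: sin_ge0_pi; apply/andP; split; lra.
- by rewrite subrr sin0 ltxx.
Qed.

Definition cot t := cos t / sin t.

(** At height [|y.2|] the ray of angle [b] has abscissa [|y.2| * cot b]: angular conditions become
    conditions on the abscissa alone, which is what integration along horizontal lines requires. *)
Lemma acos_lt_cot y b : y.2 != 0 -> 0 < b < pi ->
  (acos (y.1 / Num.sqrt (y.1 ^+ 2 + y.2 ^+ 2)) < b) = (`|y.2| * cot b < y.1) /\
  (b < acos (y.1 / Num.sqrt (y.1 ^+ 2 + y.2 ^+ 2))) = (y.1 < `|y.2| * cot b).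
Proof.
move=> y2 b0.
have y0 : y <> 0 by move=> h; move: y2; rewrite h eqxx.
have [r0 ht e1 e2] := polar_decomp y0.
set r := Num.sqrt _ in r0 ht e1 e2 *; set t := acos _ in ht e1 e2 *.
have sb : 0 < sin b by rewrite sin_gt0_pi.
have s0 : 0 < sin t.
  by rewrite -(pmulr_rgt0 _ r0) -e2 normr_gt0.
split.
  rewrite (lt_sin_cos ht b0) e1 e2 /cot mulrA ltr_pdivrMr//.
  by rewrite -!mulrA ltr_pM2l.
rewrite e1 e2 /cot mulrA ltr_pdivlMr// -!mulrA ltr_pM2l//.
have t0 : 0 < t < pi.
  case/andP: ht => t0 tp; rewrite !lt_neqAle t0 tp !andbT; apply/andP; split.
    by apply/negP => /eqP h; move: s0; rewrite -h sin0 ltxx.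
  by apply/negP => /eqP h; move: s0; rewrite h sinpi ltxx.
rewrite lt_sin_cos//; first by rewrite mulrC [X in _ = (_ < X)]mulrC.
by case/andP: b0 => *; apply/andP; split; exact: ltW.
Qed.

(** A horizontal section of an angular region at distance [t] from the axis through the vertex, [u]
    being the abscissa. For [b <= 0] the region does not enter the half-plane and the section is
    empty; for [a <= 0] it is unbounded to the right, hence the guarded upper bound. *)
Definition slice a b t (u : R) : Prop :=
  0 < b /\ t * cot b < u /\ (0 < a -> u < t * cot a).

Lemma acos_slice y a b : y.2 != 0 -> - pi < a -> a < b -> b < pi ->
  (a < acos (y.1 / Num.sqrt (y.1 ^+ 2 + y.2 ^+ 2)) < b) <-> slice a b `|y.2| y.1.
Proof.
move=> y2 ha ab hb.
have y0 : y <> 0 by move=> h; move: y2; rewrite h eqxx.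
have [r0 /andP[t0 tp] e1 e2] := polar_decomp y0.
set r := Num.sqrt _ in r0 t0 tp e1 e2 *; set t := acos _ in t0 tp e1 e2 *.
have tpos : 0 < t.
  rewrite lt_neqAle t0 andbT; apply/negP => /eqP h.
  by move: y2; rewrite -normr_eq0 e2 -h sin0 mulr0 eqxx.
split.
  move=> /andP[at_ tb]; have b0 : 0 < b by exact: lt_trans tb.
  split => //; have [<- _] := acos_lt_cot y2 (introT andP (conj b0 hb)).
  split => // a0; have hab : 0 < a < pi by rewrite a0 (lt_trans ab).
  by have [_ <-] := acos_lt_cot y2 hab.
move=> [b0 [hb1 ha1]].
have [E _] := acos_lt_cot y2 (introT andP (conj b0 hb)).
rewrite /t E hb1 andbT; have [a0|a0] := ltP 0 a; last exact: le_lt_trans tpos.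
have hab : 0 < a < pi by rewrite a0 (lt_trans ab).
by have [_ ->] := acos_lt_cot y2 hab; exact: ha1.
Qed.

Lemma sector_upper c x tm tM : - pi < tm -> tm < tM -> tM < pi -> c.2 < x.2 ->
  sector c tm tM x <-> slice tm tM (x.2 - c.2) (x.1 - c.1).
Proof.
move=> h1 h2 h3 x2; have y2 : 0 < (x - c).2 by rewrite subr_gt0.
rewrite /sector /= Carg_cases ltW//.
have := @acos_slice (x - c) tm tM (lt0r_neq0 y2) h1 h2 h3.
rewrite gtr0_norm// => <-; split => [[]//|]; split => // xc.
by move: x2; rewrite xc ltxx.
Qed.

(** Reflection in the horizontal axis turns the angles [(tm, tM)] into [(-tM, -tm)], so one notion
    of slice serves both half-planes. *)
Lemma sector_lower c x tm tM : - pi < tm -> tm < tM -> tM < pi -> x.2 < c.2 ->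
  sector c tm tM x <-> slice (- tM) (- tm) (c.2 - x.2) (x.1 - c.1).
Proof.
move=> h1 h2 h3 x2; have y2 : (x - c).2 < 0 by rewrite subr_lt0.
rewrite /sector /= Carg_cases leNgt y2 /=.
have := @acos_slice (x - c) (- tM) (- tm) (ltr0_neq0 y2).
rewrite ltr0_norm// opprB => <-; [|lra..].
split; first by move=> [_ /andP[? ?]]; apply/andP; split; lra.
move=> /andP[? ?]; split; last by apply/andP; split; lra.
by move=> xc; move: x2; rewrite xc ltxx.
Qed.

(** On this line [Carg] takes only the values 0, to the right of the vertex, and [pi], to the left;
    the latter is excluded by [tM < pi]. *)
Lemma sector_middle c x tm tM : - pi < tm -> tm < tM -> tM < pi -> x.2 = c.2 ->
  sector c tm tM x <-> [/\ c.1 < x.1, tm < 0 & 0 < tM].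
Proof.
move=> h1 h2 h3 x2; have y2 : (x - c).2 = 0 by rewrite /= x2 subrr.
rewrite /sector /= Carg_cases y2 lexx expr0n addr0 sqrtr_sqr.
have [y1|y1|y1] := ltgtP c.1 x.1.
- have p1 : 0 < (x - c).1 by rewrite subr_gt0.
  rewrite gtr0_norm// divff ?gt_eqF// acos1; split.
    by move=> [_ /andP[]].
  move=> [_ -> ->]; split => // xc; by move: y1; rewrite xc ltxx.
- have p1 : (x - c).1 < 0 by rewrite subr_lt0.
  rewrite ltr0_norm// invrN mulrN divff ?lt_eqF// acosN1; split; last by case.
  by move=> [_ /andP[_]]; lra.
- split; last by case.
  move=> [xc _]; exfalso; apply: xc.
  by case: x c x2 y1 {y2} => [? ?] [? ?] /= -> ->.
Qed.

Lemma continuous_fst2 : continuous (fst : R * R -> R).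
Proof. by move=> x; exact: cvg_fst. Qed.

Lemma continuous_snd2 : continuous (snd : R * R -> R).
Proof. by move=> x; exact: cvg_snd. Qed.

Lemma open_gt0 (f : R * R -> R) : continuous f -> open [set x | 0 < f x].
Proof.
move=> cf; rewrite (_ : mkset _ = f @^-1` [set u | 0 < u]) //.
by apply: open_comp => //; exact: open_gt.
Qed.

Lemma measurable_slice c a b (k : R) :
  measurable ([set x | slice a b (k * (x.2 - c.2)) (x.1 - c.1)] : set T2).
Proof.
have cl (u : R) : continuous (fun x : R * R => x.1 - c.1 - k * (x.2 - c.2) * u).
  move=> x; apply: cvgB.
    by apply: cvgB; [exact: continuous_fst2|exact: cvg_cst].
  apply: cvgMr_tmp; apply: cvgMl_tmp.
  by apply: cvgB; [exact: continuous_snd2|exact: cvg_cst].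
have [b0|b0] := ltP 0 b; last first.
  rewrite (_ : mkset _ = set0); first exact: measurable0.
  by apply/seteqP; split => x // [/=]; rewrite ltNge b0.
have m1 := open_measurable2 (open_gt0 (cl (cot b))).
have [a0|a0] := ltP 0 a.
  have cn : continuous (fun x : R * R => - (x.1 - c.1 - k * (x.2 - c.2) * cot a)).
    by move=> x; apply: cvgN; exact: cl.
  have m2 := open_measurable2 (open_gt0 cn).
  have := measurableI _ _ m1 m2; congr (measurable _).
  apply/seteqP; split => x; rewrite /slice /= subr_gt0 ?oppr_gt0 ?subr_lt0.
    by move=> [h1 h2].
  by move=> [_ [h1 h2]]; split => //; exact: h2.
move: m1; congr (measurable _).
apply/seteqP; split => x; rewrite /slice /= subr_gt0.
  by move=> h; do 2 split => //; rewrite ltNge a0.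
by move=> [_ []].
Qed.

(** [Carg] jumps across a half-line, so measurability is read off the slices: above the axis, below
    it and on it, the sector is cut out by affine inequalities. *)
Lemma measurable_sector c tm tM : - pi < tm -> tm < tM -> tM < pi ->
  measurable (sector c tm tM : set T2).
Proof.
move=> h1 h2 h3.
have cy : continuous (fun x : R * R => x.2 - c.2).
  by move=> x; apply: cvgB; [exact: continuous_snd2|exact: cvg_cst].
have cx : continuous (fun x : R * R => x.1 - c.1).
  by move=> x; apply: cvgB; [exact: continuous_fst2|exact: cvg_cst].
have mU := open_measurable2 (open_gt0 cy).
have cn : continuous (fun x : R * R => - (x.2 - c.2)).
  by move=> x; apply: cvgN; exact: cy.
have mL := open_measurable2 (open_gt0 cn).
have mX := open_measurable2 (open_gt0 cx).
have -> : sector c tm tM =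
  ([set x | 0 < x.2 - c.2] `&` [set x | slice tm tM (1 * (x.2 - c.2)) (x.1 - c.1)])
  `|` ([set x | 0 < - (x.2 - c.2)] `&`
       [set x | slice (- tM) (- tm) (-1 * (x.2 - c.2)) (x.1 - c.1)])
  `|` ((~` [set x | 0 < x.2 - c.2] `&` ~` [set x | 0 < - (x.2 - c.2)]) `&`
       (if (tm < 0) && (0 < tM) then [set x | 0 < x.1 - c.1] else set0)).
  apply/seteqP; split => x.
    have [x2|x2|x2] := ltgtP c.2 x.2.
    - move=> /(sector_upper h1 h2 h3 x2) h; left; left; split => /=.
        by rewrite subr_gt0.
      by rewrite mul1r.
    - move=> /(sector_lower h1 h2 h3 x2) h; left; right; split => /=.
        by rewrite opprB subr_gt0.
      by rewrite mulN1r opprB.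
    - move=> /(sector_middle h1 h2 h3 (esym x2)) [h -> ->]; right; split => /=.
        by rewrite x2 subrr oppr0 ltxx.
      by rewrite subr_gt0.
  move=> [[[/=]|[/=]]|[/= [/negP + /negP]]].
  - rewrite subr_gt0 mul1r => x2 h; exact/(sector_upper h1 h2 h3 x2).
  - rewrite opprB subr_gt0 mulN1r opprB => x2 h; exact/(sector_lower h1 h2 h3 x2).
  - rewrite opprB !subr_gt0 -!leNgt => l1 l2.
    have x2 : x.2 = c.2 by apply/eqP; rewrite eq_le l1 l2.
    case: ifP => // /andP[m0 M0] /=; rewrite subr_gt0 => x1.
    by apply/(sector_middle h1 h2 h3 x2).
apply: measurableU.
  by apply: measurableU; apply: measurableI => //; exact: measurable_slice.
apply: measurableI; first by apply: measurableI; exact: measurableC.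
by case: ifP.
Qed.

End sector_geometry.

(** * The holomorphic test functions *)

Section slices.
Context {R : realType}.
Local Notation T2 := (measurableTypeR R * measurableTypeR R)%type.
Local Notation leb := (@lebesgue_measure R).

Lemma mu2_tonelli (f : T2 -> \bar R) : measurable_fun setT f ->
  (forall x, (0 <= f x)%E) ->
  (\int[mu2 R]_x f x = \int[leb]_y \int[leb]_x f (x, y))%E.
Proof. by move=> mf f0; exact: fubini_tonelli2. Qed.

(** Fubini with the abscissa innermost. The two half-planes have different slice formulas, and the
    line at height [c] that separates them is null. *)
Lemma Rintegral_horizontal_slices (W : set (R * R)) (g : R * R -> R) (c : R)
    (Hm Hp : R -> R) : measurable (W : set T2) ->
  (mu2 R).-integrable W (EFin \o g) ->
  (forall y, y < c -> let S := [set u | W (u, y)] in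
     leb.-integrable S (EFin \o (fun u => g (u, y))) /\
     Rintegral leb S (fun u => g (u, y)) = Hm y) ->
  (forall y, c < y -> let S := [set u | W (u, y)] in
     leb.-integrable S (EFin \o (fun u => g (u, y))) /\
     Rintegral leb S (fun u => g (u, y)) = Hp y) ->
  leb.-integrable `]-oo, c] (EFin \o Hm) ->
  leb.-integrable `[c, +oo[ (EFin \o Hp) ->
  Rintegral (mu2 R) W g = Rintegral leb `]-oo, c] Hm + Rintegral leb `[c, +oo[ Hp.
Proof.
move=> mW ig Em Ep im ip.
have igT : (mu2 R).-integrable setT ((EFin \o g) \_ W) by rewrite -integrable_mkcond.
have GE y : fubini_G leb ((EFin \o g) \_ W) y =
    (\int[leb]_(u in [set u | W (u, y)]) (g (u, y))%:E)%E.
  rewrite /fubini_G [RHS]integral_mkcond; apply: eq_integral => u _.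
  rewrite !patchE; congr (if _ then _ else _).
have mG : measurable_fun setT (fubini_G leb ((EFin \o g) \_ W)).
  exact: measurable_fubini_G igT.
rewrite /Rintegral integral_mkcond -[in LHS](integral21_prod_meas1 igT).
have -> : [set: measurableTypeR R] = `]-oo, c[%classic `|` `[c, +oo[%classic.
  by rewrite -itv_bndbnd_setU ?bnd_simp// -set_itvNyy.
rewrite integral_setU//; last 2 first.
- exact: measurable_funTS.
- apply/disj_setPLR => u /=; rewrite !in_itv/= andbT => uc.
  by apply/negP; rewrite -ltNge.
have -> : (\int[leb]_(x in `]-oo, c[) fubini_G leb ((EFin \o g) \_ W) x =
    \int[leb]_(x in `]-oo, c]) (Hm x)%:E)%E.
  rewrite -integral_itv_bndo_bndc; last first.
    apply: measurable_funS (measurable_int _ im) => //.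
    by apply: subset_itvl; rewrite bnd_simp.
  apply: eq_integral => y; rewrite inE/= in_itv/= => yc.
  rewrite GE; have [h1 <-] := Em y yc; rewrite /Rintegral fineK//.
  apply: integrable_fin_num h1.
  by have := measurable_ysection y mW; congr (measurable _);
    apply/seteqP; split => u; rewrite /ysection/= inE.
have -> : (\int[leb]_(x in `[c, +oo[) fubini_G leb ((EFin \o g) \_ W) x =
    \int[leb]_(x in `[c, +oo[) (Hp x)%:E)%E.
  rewrite -!integral_itv_obnd_cbnd; first last.
  - exact: measurable_funTS.
  - apply: measurable_funS (measurable_int _ ip) => //.
    by apply: subset_itvr; rewrite bnd_simp.
  apply: eq_integral => y; rewrite inE/= in_itv/= andbT => yc.
  rewrite GE; have [h1 <-] := Ep y yc; rewrite /Rintegral fineK//.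
  apply: integrable_fin_num h1.
  by have := measurable_ysection y mW; congr (measurable _);
    apply/seteqP; split => u; rewrite /ysection/= inE.
by rewrite fineD//; apply: integrable_fin_num.
Qed.

Lemma Cintegral_horizontal_slices (W : set (R * R)) (g : R * R -> R[i]) (c : R)
    (Hm Hp : R -> R[i]) : measurable (W : set T2) ->
  Cintegrable (mu2 R) W g ->
  (forall y, y < c -> let S := [set u | W (u, y)] in
     Cintegrable leb S (fun u => g (u, y)) /\
     Cintegral leb S (fun u => g (u, y)) = Hm y) ->
  (forall y, c < y -> let S := [set u | W (u, y)] in
     Cintegrable leb S (fun u => g (u, y)) /\
     Cintegral leb S (fun u => g (u, y)) = Hp y) ->
  Cintegrable leb `]-oo, c] Hm -> Cintegrable leb `[c, +oo[ Hp ->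
  Cintegral (mu2 R) W g = Cintegral leb `]-oo, c] Hm + Cintegral leb `[c, +oo[ Hp.
Proof.
move=> mW [gr gi] Em Ep [mr mi] [pr pi_].
rewrite /Cintegral.
rewrite (@Rintegral_horizontal_slices _ _ c (fun y => cRe (Hm y))
  (fun y => cRe (Hp y)) mW gr)//; first last.
- by move=> y yc; have [[h1 h2] h3] := Ep y yc; split => //; rewrite -h3.
- by move=> y yc; have [[h1 h2] h3] := Em y yc; split => //; rewrite -h3.
rewrite (@Rintegral_horizontal_slices _ _ c (fun y => cIm (Hm y))
  (fun y => cIm (Hp y)) mW gi)//; first last.
- by move=> y yc; have [[h1 h2] h3] := Ep y yc; split => //; rewrite -h3.
- by move=> y yc; have [[h1 h2] h3] := Em y yc; split => //; rewrite -h3.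
Qed.

Lemma Cintegral_exprV_y (b : R[i]) (a : R) n : cIm b != 0 ->
  Cintegrable leb `[a, +oo[ (fun t : R => (t%:C - b) ^- n.+2) /\
  Cintegral leb `[a, +oo[ (fun t : R => (t%:C - b) ^- n.+2) =
    (n.+1%:R)^-1 * (a%:C - b) ^- n.+1.
Proof. by case: b => p q /= q0; exact: Cintegral_affine_exprV_y. Qed.

Lemma Cintegral_exprV_Ny (b : R[i]) (a : R) n : cIm b != 0 ->
  Cintegrable leb `]-oo, a] (fun t : R => (t%:C - b) ^- n.+2) /\
  Cintegral leb `]-oo, a] (fun t : R => (t%:C - b) ^- n.+2) =
    - (n.+1%:R)^-1 * (a%:C - b) ^- n.+1.
Proof. by case: b => p q /= q0; exact: Cintegral_affine_exprV_Ny. Qed.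

Lemma Im_inv_neq0 (b : R[i]) : cIm b != 0 -> cIm b^-1 != 0.
Proof.
move=> b0; rewrite cImV mulf_neq0 ?oppr_eq0// invr_neq0// -!expr2.
by rewrite paddr_eq0 ?sqr_ge0// !sqrf_eq0 (negbTE b0) andbF.
Qed.

Lemma Im_neq0 (b : R[i]) : cIm b != 0 -> b != 0.
Proof. by apply: contraNN => /eqP ->. Qed.

Let factor (b : R[i]) (c t : R) : cIm b != 0 ->
  1 + (t - c)%:C * b = b * (t%:C - (c%:C - b^-1)).
Proof.
by move=> /Im_neq0 b0; rewrite rmorphB /=; field.
Qed.

Let Im_factor (b : R[i]) (c : R) : cIm b != 0 ->
  cIm (c%:C - b^-1) != 0.
Proof.
by move=> /Im_inv_neq0 b0; rewrite cImD cImN /= add0r oppr_eq0.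
Qed.

(** Factoring out [b] turns the integrand into an inverse power of [t] minus the non-real number
    [c - b^-1], for which the half-line formula is known. *)
Lemma Cintegral_lin_exprV_y (b : R[i]) (c a : R) n : cIm b != 0 ->
  Cintegrable leb `[a, +oo[ (fun t : R => (1 + (t - c)%:C * b) ^- n.+2) /\
  Cintegral leb `[a, +oo[ (fun t : R => (1 + (t - c)%:C * b) ^- n.+2) =
    (n.+1%:R * b)^-1 * (1 + (a - c)%:C * b) ^- n.+1.
Proof.
move=> b0; have [i1 e1] := @Cintegral_exprV_y _ a n (Im_factor c b0).
have E : (fun t : R => (1 + (t - c)%:C * b) ^- n.+2) =
    (fun t => b ^- n.+2 * (t%:C - (c%:C - b^-1)) ^- n.+2).
  by apply/funext => t; rewrite (factor _ _ b0) exprMn invfM.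
rewrite E; split; first exact: CintegrableZ.
rewrite CintegralZ// e1 (factor _ _ b0) exprMn.
rewrite [b ^+ n.+2]exprS !invfM; ring.
Qed.

Lemma Cintegral_lin_exprV_Ny (b : R[i]) (c a : R) n : cIm b != 0 ->
  Cintegrable leb `]-oo, a] (fun t : R => (1 + (t - c)%:C * b) ^- n.+2) /\
  Cintegral leb `]-oo, a] (fun t : R => (1 + (t - c)%:C * b) ^- n.+2) =
    - ((n.+1%:R * b)^-1 * (1 + (a - c)%:C * b) ^- n.+1).
Proof.
move=> b0; have [i1 e1] := @Cintegral_exprV_Ny _ a n (Im_factor c b0).
have E : (fun t : R => (1 + (t - c)%:C * b) ^- n.+2) =
    (fun t => b ^- n.+2 * (t%:C - (c%:C - b^-1)) ^- n.+2).
  by apply/funext => t; rewrite (factor _ _ b0) exprMn invfM.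
rewrite E; split; first exact: CintegrableZ.
rewrite CintegralZ// e1 (factor _ _ b0) exprMn.
rewrite [b ^+ n.+2]exprS !invfM; ring.
Qed.

End slices.

(** * The kernel on horizontal lines and its Lorentzian majorant *)

Section hker.
Context {R : realType}.
Local Notation leb := (@lebesgue_measure R).
Local Notation T2 := (measurableTypeR R * measurableTypeR R)%type.

Definition zrel (c x : R * R) : R[i] := (x.1 - c.1) +i* (x.2 - c.2).

(** The test function [u_s] is the case [n = 6]; the exponent stays free because 7 and 8 arise from
    its derivatives. *)
Definition hker (s : R) (c : R * R) n (x : R * R) : R[i] :=
  (1 + s%:C * zrel c x) ^- n.

(* [\int_u^oo (1 + s (x + iy))^-6 dx], with [u] the abscissa at height [t] of
   the ray of angle [th]; there is no such ray when [th <= 0]. *)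
Definition ray_integral (s y t th : R) : R[i] :=
  if 0 < th then (5%:R * s%:C)^-1 * (1 + s%:C * ((t * cot th) +i* y)) ^- 5
  else 0.

Lemma cot_lt (a b : R) : 0 < a -> a < b -> b < pi -> cot b < cot a.
Proof.
move=> a0 ab bpi; rewrite /cot -subr_gt0.
have sa : 0 < sin a by apply: sin_gt0_pi; apply/andP; split; lra.
have sb : 0 < sin b by apply: sin_gt0_pi; apply/andP; split; lra.
have -> : cos a / sin a - cos b / sin b = sin (b - a) / (sin a * sin b).
  by rewrite sinB; field; rewrite !gt_eqF.
by rewrite divr_gt0 ?mulr_gt0//; apply: sin_gt0_pi; apply/andP; split; lra.
Qed.

(** A slice is the half-line beyond the ray of angle [b] with the half-line beyond the ray of angle
    [a], if there is one, removed. The signed height [y] and the distance [t] are kept apart so that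
    both half-planes are covered. *)
Lemma Cintegral_slice (s y c t a b : R) : 0 < s -> y != 0 -> 0 < t ->
  - pi < a -> a < b -> b < pi ->
  let S := [set u | slice a b t (u - c)] in
  let f := fun u : R => (1 + s%:C * ((u - c) +i* y)) ^- 6 in
  Cintegrable leb S f /\
  Cintegral leb S f = ray_integral s y t b - ray_integral s y t a.
Proof.
move=> s0 y0 t0 ha ab hb S f.
have sC : s%:C != 0 :> R[i] by rewrite eq_complex /= gt_eqF.
(* The zero of the affine factor [1 + s (u - c + i y)], off the real line because [y != 0]. *)
pose b' : R[i] := (c - s^-1) -i* y.
have b'0 : cIm b' != 0 by rewrite /= oppr_eq0.
have fE (u : R) : 1 + s%:C * ((u - c) +i* y) = s%:C * (u%:C - b').
  apply/eqP; rewrite eq_complex /= !mul0r !subr0 !addr0 add0r opprK.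
  by apply/andP; split; apply/eqP; [field; rewrite gt_eqF|ring].
have H (u : R) : Cintegrable leb `[c + u, +oo[ f /\
    Cintegral leb `[c + u, +oo[ f = (5%:R * s%:C)^-1 * (1 + s%:C * (u +i* y)) ^- 5.
  have [i1 e1] := @Cintegral_exprV_y R b' (c + u) 4 b'0.
  have E : f = (fun v => s%:C ^- 6 * (v%:C - b') ^- 6).
    by apply/funext => v; rewrite /f fE exprMn invfM.
  rewrite E; split; first exact: CintegrableZ.
  have -> : 1 + s%:C * (u +i* y) = s%:C * ((c + u)%:C - b').
    by rewrite -fE (addrC c) addrK.
  rewrite CintegralZ// e1 exprMn.
  by rewrite [s%:C ^+ 6]exprS !invfM; ring.
have Ho (u : R) : Cintegrable leb `]c + u, +oo[ f /\
    Cintegral leb `]c + u, +oo[ f = (5%:R * s%:C)^-1 * (1 + s%:C * (u +i* y)) ^- 5.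
  have [i1 <-] := H u.
  have i2 : Cintegrable leb `]c + u, +oo[ f.
    by apply: CintegrableS i1 => //; apply: subset_itvr; rewrite bnd_simp.
  split => //; rewrite /Cintegral !Rintegral_itv_obnd_cbnd//.
    by case: i2.
  by case: i2.
have [b0|b0] := ltP 0 b; last first.
  have -> : S = set0 by apply/seteqP; split => u // [/=]; rewrite ltNge b0.
  rewrite /ray_integral !ltNge b0 (le_trans (ltW ab) b0) /= subrr.
  split; first by split; exact: integrable_set0.
  by rewrite /Cintegral !Rintegral_set0.
have [a0|a0] := ltP 0 a; last first.
  have -> : S = `]c + t * cot b, +oo[%classic.
    apply/seteqP; split => u /=; rewrite in_itv/= andbT addrC -ltrBrDr.
      by move=> [_ []].
    by move=> h; do 2 split => //; rewrite ltNge a0.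
  have [i1 e1] := Ho (t * cot b); split => //.
  by rewrite e1 /ray_integral b0 ltNge a0 /= subr0.
have cab : t * cot b < t * cot a by rewrite ltr_pM2l// cot_lt.
have [i1 e1] := Ho (t * cot b); have [i2 e2] := H (t * cot a).
have SE : `]c + t * cot b, +oo[%classic = S `|` `[c + t * cot a, +oo[%classic.
  apply/seteqP; split => u /=; rewrite !in_itv/= !andbT.
    move=> h; have [h1|h1] := leP (c + t * cot a) u; first by right.
    by left; split => //; split=> *; lra.
  by case=> [[_ [h1 _]]|h1]; lra.
have mS : measurable S.
  rewrite (_ : S = `]c + t * cot b, c + t * cot a[%classic)//.
  apply/seteqP; split => u /=; rewrite in_itv/=.
    by move=> [_ [h1 h2]]; apply/andP; split; have := h2 a0; lra.
  by move=> /andP[h1 h2]; split => //; split => *; lra.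
have iS : Cintegrable leb S f.
  by apply: CintegrableS i1 => //; rewrite SE; left.
split => //.
have : Cintegral leb `]c + t * cot b, +oo[ f =
    Cintegral leb S f + Cintegral leb `[c + t * cot a, +oo[ f.
  rewrite SE Cintegral_setU//; first by rewrite -SE.
  apply/disj_setPLR => u [_ [_ h]] /=; rewrite in_itv/= andbT => h'.
  by have := h a0; lra.
by rewrite e1 e2 /ray_integral a0 b0 => ->; rewrite addrK.
Qed.

Definition lorentz (t : R) : R := (1 + t ^+ 2)^-1.

Lemma lorentz_gt0 t : 0 < lorentz t.
Proof. by rewrite invr_gt0 ltr_pwDl// sqr_ge0. Qed.

Lemma lorentz_le1 t : lorentz t <= 1.
Proof. by rewrite invf_le1 ?lerDl ?sqr_ge0// ltr_pwDl// sqr_ge0. Qed.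

Lemma continuous_lorentz (s c : R) : continuous (fun t : R => lorentz (s * (t - c))).
Proof.
move=> t; apply: cvgV; first by rewrite gt_eqF// ltr_pwDl// sqr_ge0.
apply: cvgD; first exact: cvg_cst.
by apply: (@cvgM _ _ _ _ (fun t => s * (t - c)) (fun t => s * (t - c)));
  apply: cvgMl_tmp; apply: cvgB; [exact: cvg_id|exact: cvg_cst|exact: cvg_id|exact: cvg_cst].
Qed.

Lemma integral_lorentz (s c : R) : 0 < s ->
  (\int[leb]_t (lorentz (s * (t - c)))%:E = (pi / s)%:E)%E.
Proof.
move=> s0.
have ds t : is_derive t (1 : R) (fun t => s * (t - c)) s.
  have := is_deriveZ s (is_deriveB (is_derive_id t (1:R)) (is_derive_cst c t (1:R))).
  by rewrite subr0 /GRing.scale /= mulr1.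
have dG t : is_derive t (1 : R) (fun t => s^-1 * atan (s * (t - c))) (lorentz (s * (t - c))).
  have d2 := is_deriveZ (s^-1) (@is_derive1_comp _ atan (fun t => s * (t - c)) t _ _
    (is_derive1_atan (s * (t - c))) (ds t)).
  by apply: is_derive_eq; rewrite /GRing.scale /= mulrCA mulVf ?mulr1// gt_eqF.
have b0 t : `|lorentz (s * (t - c))| <= lorentz (s * (t - c)) by rewrite gtr0_norm ?lorentz_gt0.
have Gy : s^-1 * atan (s * (t - c)) @[t --> +oo] --> s^-1 * (pi / 2).
  apply: cvgMl_tmp.
  apply: (@cvg_comp _ _ _ (fun t => s * (t - c)) atan _ _ _ _ (@cvgy_atan R)).
  apply/cvgryPge => M; near=> t.
  rewrite mulrC -ler_pdivrMr// lerBrDr.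
  by near: t; apply: nbhs_pinfty_ge; exact: num_real.
have GNy : s^-1 * atan (s * (t - c)) @[t --> -oo] --> s^-1 * - (pi / 2).
  apply: cvgMl_tmp; apply/cvgNy_compNP.
  rewrite (_ : _ \o _ = - (fun t => atan (s * (t + c)))); last first.
    by apply/funext => t /=; rewrite fctE -atanN; congr atan; ring.
  apply: cvgN.
  apply: (@cvg_comp _ _ _ (fun t => s * (t + c)) atan _ _ _ _ (@cvgy_atan R)).
  apply/cvgryPge => M; near=> t.
  rewrite mulrC -ler_pdivrMr// -lerBlDr.
  by near: t; apply: nbhs_pinfty_ge; exact: num_real.
have [i1 e1] := @dominated_FTC2y _ _ _ _ _ c _ _ (@continuous_lorentz s c)
  (@continuous_lorentz s c) dG dG b0 Gy Gy.
have [i2 e2] := @dominated_FTC2Ny _ _ _ _ _ c _ _ (@continuous_lorentz s c)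
  (@continuous_lorentz s c) dG dG b0 GNy GNy.
have mb : measurable_fun setT (EFin \o (fun t => lorentz (s * (t - c)))).
  by apply/measurable_EFinP; apply: continuous_measurable_fun; exact: continuous_lorentz.
have -> : [set: R] = `]-oo, c[%classic `|` `[c, +oo[%classic.
  by rewrite -itv_bndbnd_setU ?bnd_simp// -set_itvNyy.
rewrite integral_setU//; last 2 first.
- exact: measurable_funTS.
- apply/disj_setPLR => u /=; rewrite !in_itv/= andbT => uc.
  by apply/negP; rewrite -ltNge.
rewrite integral_itv_bndo_bndc; last exact: measurable_funTS.
rewrite -(fineK (integrable_fin_num _ i1))// -(fineK (integrable_fin_num _ i2))//.
move: e1 e2; rewrite /Rintegral => -> ->.
rewrite subrr mulr0 atan0 mulr0 !subr0 sub0r -EFinD; congr (_%:E).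
by field; rewrite gt_eqF.
Unshelve. all: by end_near. Qed.

(** A product of one-variable functions rather than a radial one, so that its integral over the
    plane is the square of an arctangent integral. *)
Definition lorentz2 s (c x : R * R) := lorentz (s * (x.1 - c.1)) * lorentz (s * (x.2 - c.2)).

Lemma lorentz2_gt0 s c x : 0 < lorentz2 s c x.
Proof. by rewrite mulr_gt0// lorentz_gt0. Qed.

Lemma integrable_lorentz2 (s : R) c : 0 < s ->
  (mu2 R).-integrable setT (EFin \o lorentz2 s c) /\
  Rintegral (mu2 R) setT (lorentz2 s c) = (pi / s) ^+ 2.
Proof.
move=> s0.
have mb : measurable_fun setT (lorentz2 s c : T2 -> measurableTypeR R).
  apply: continuous_measurable2 => x; apply: cvgM.
    apply: (@continuous_comp _ _ _ fst (fun t => lorentz (s * (t - c.1)))).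
      exact: continuous_fst2.
    exact: continuous_lorentz.
  apply: (@continuous_comp _ _ _ snd (fun t => lorentz (s * (t - c.2)))).
    exact: continuous_snd2.
  exact: continuous_lorentz.
have E : (\int[mu2 R]_x (lorentz2 s c x)%:E = ((pi / s) ^+ 2)%:E)%E.
  rewrite (@mu2_tonelli R (fun x => (lorentz2 s c x)%:E)); first last.
  - by move=> x; rewrite lee_fin ltW// lorentz2_gt0.
  - exact/measurable_EFinP.
  transitivity (\int[leb]_y ((pi / s)%:E * (lorentz (s * (y - c.2)))%:E))%E.
    apply: eq_integral => y _; rewrite /lorentz2 /=.
    under eq_integral do rewrite mulrC EFinM.
    rewrite ge0_integralZl//.
    - by rewrite integral_lorentz// muleC.
    - by apply/measurable_EFinP; apply: continuous_measurable_fun; exact: continuous_lorentz.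
    - by move=> u _; rewrite lee_fin ltW// lorentz_gt0.
    - by rewrite lee_fin ltW// lorentz_gt0.
  rewrite ge0_integralZl//.
  - by rewrite integral_lorentz// -EFinM expr2.
  - by apply/measurable_EFinP; apply: continuous_measurable_fun; exact: continuous_lorentz.
  - by move=> y _; rewrite lee_fin ltW// lorentz_gt0.
  - by rewrite lee_fin divr_ge0 ?pi_ge0// ltW.
split; last by rewrite /Rintegral E.
apply/integrableP; split; first exact/measurable_EFinP.
suff -> : (\int[mu2 R]_x `|(EFin \o lorentz2 s c) x| =
    \int[mu2 R]_x (lorentz2 s c x)%:E)%E by rewrite E ltry.
by apply: eq_integral => x _ /=; rewrite gtr0_norm// lorentz2_gt0.
Qed.

End hker.

Local Notation edist := Defs.edist.

(** * Lower bounds on the affine factor and decay of the kernel *)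

Section kernel_bounds.
Context {R : realType}.
Local Notation leb := (@lebesgue_measure R).
Local Notation T2 := (measurableTypeR R * measurableTypeR R)%type.
Implicit Types (s : R) (c x : R * R).

Lemma normc_zrel c x : normc (zrel c x) = edist x c.
Proof. by rewrite normcE2. Qed.

Lemma eudist_ge0 x y : 0 <= edist x y.
Proof. exact: sqrtr_ge0. Qed.

Lemma sqr_edist x c : edist x c ^+ 2 = (x.1 - c.1) ^+ 2 + (x.2 - c.2) ^+ 2.
Proof. by rewrite sqr_sqrtr// addr_ge0 ?sqr_ge0. Qed.

(** Meant for a [k0] that serves every [s]: the affine factor then neither vanishes nor grows more
    slowly than [s |x - c|]. *)
Definition coercive (k0 s : R) (c x : R * R) :=
  k0 * (1 + s ^+ 2 * edist x c ^+ 2) <= normc (1 + s%:C * zrel c x) ^+ 2.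

Lemma cone_coercive (B s : R) c x : 0 < B -> 0 <= s ->
  - (B * `|x.2 - c.2|) < x.1 - c.1 -> coercive (3 * B ^+ 2 + 2)^-1 s c x.
Proof.
move=> B0 s0 hx; rewrite /coercive sqr_normcE sqr_edist /zrel /= !mul0r !subr0 !addr0 add0r.
have D0 : 0 < 3 * B ^+ 2 + 2 by have := sqr_ge0 B; lra.
rewrite mulrC ler_pdivrMr//.
set X := x.1 - c.1 in hx *; set Y := x.2 - c.2 in hx *.
have YY : `|Y| ^+ 2 = Y ^+ 2 by rewrite real_normK ?num_real.
have hX : - (B * `|s * Y|) <= s * X.
  by rewrite normrM (ger0_norm s0) mulrCA -mulrN ler_wpM2l// ltW.
have -> : s ^+ 2 * (X ^+ 2 + Y ^+ 2) = (s * X) ^+ 2 + (s * Y) ^+ 2 by ring.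
have BB := sqr_ge0 B.
move: hX; set u := s * X; set v := s * Y => hX.
have vv : `|v| ^+ 2 = v ^+ 2 by rewrite real_normK ?num_real.
have v0 := normr_ge0 v.
have [u0|u0] := leP 0 u.
  have := sqr_ge0 v; have := sqr_ge0 u; nra.
have uu : u ^+ 2 <= B ^+ 2 * v ^+ 2.
  rewrite -vv -exprMn -[u]opprK sqrrN lerXn2r ?nnegrE//; first by lra.
    by rewrite mulr_ge0// ltW.
  by lra.
(* The constant comes from [1 + u^2 + (1 + 2 u)^2 = 2 (1 + u)^2 + 3 u^2] together with
   [u^2 <= B^2 v^2]. *)
have := sqr_ge0 (1 + 2 * u); have := sqr_ge0 v; have := sqr_ge0 (1 + u).
nra.
Qed.

Lemma coercive_neq0 k0 s c x : 0 < k0 -> coercive k0 s c x ->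
  1 + s%:C * zrel c x != 0.
Proof.
move=> k0p; rewrite /coercive => h; apply/negP => /eqP E; move: h.
rewrite E normc0 expr0n /= leNgt mulr_gt0// ltr_pwDl//.
by rewrite mulr_ge0// sqr_ge0.
Qed.

Lemma hker_le k0 s c x n : 0 < k0 -> coercive k0 s c x ->
  normc (hker s c n.*2 x) <= k0 ^- n * (1 + s ^+ 2 * edist x c ^+ 2) ^- n.
Proof.
move=> k0p h; rewrite /hker normcV normc_expr -muln2 mulnC exprM.
have p : 0 < k0 * (1 + s ^+ 2 * edist x c ^+ 2).
  by rewrite mulr_gt0// ltr_pwDl// mulr_ge0// sqr_ge0.
rewrite -invfM -exprMn lef_pV2 ?posrE ?exprn_gt0 ?(normc_gt0 (coercive_neq0 k0p h))//.
by rewrite lerXn2r ?nnegrE ?(ltW p) ?sqr_ge0.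
Qed.

(** With nonnegative [u] and [v] this is [(1 + u) (1 + v) <= (1 + u + v)^2]. *)
Lemma lorentz2_ge s c x : (1 + s ^+ 2 * edist x c ^+ 2) ^- 2 <= lorentz2 s c x.
Proof.
rewrite /lorentz2 /lorentz -invfM sqr_edist.
set a := x.1 - c.1; set b := x.2 - c.2.
have p1 : 0 < 1 + (s * a) ^+ 2 by rewrite ltr_pwDl// sqr_ge0.
have p2 : 0 < 1 + (s * b) ^+ 2 by rewrite ltr_pwDl// sqr_ge0.
have E : s ^+ 2 * (a ^+ 2 + b ^+ 2) = (s * a) ^+ 2 + (s * b) ^+ 2 by ring.
have q1 := sqr_ge0 (s * a); have q2 := sqr_ge0 (s * b).
rewrite E; set u := (s * a) ^+ 2 in q1 p1 *; set v := (s * b) ^+ 2 in q2 p2 *.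
have p3 : 0 < 1 + (u + v) by lra.
rewrite lef_pV2 ?posrE ?mulr_gt0 ?exprn_gt0//; nra.
Qed.

(** Of the three factors [(1 + s^2 r^2)^-1] given by the exponent 6, one is bounded by 1 and two go
    into the Lorentzian. *)
Lemma hker_lorentz2 k0 s c x : 0 < k0 -> coercive k0 s c x ->
  normc (hker s c 6 x) <= k0 ^- 3 * lorentz2 s c x.
Proof.
move=> k0p h; apply: le_trans (hker_le 3 k0p h) _.
have k3 : 0 <= k0 ^- 3 by rewrite invr_ge0 exprn_ge0// ltW.
rewrite ler_wpM2l//; apply: le_trans (lorentz2_ge s c x).
have p : 1 <= 1 + s ^+ 2 * edist x c ^+ 2 by rewrite lerDl mulr_ge0 ?sqr_ge0.
have p0 := lt_le_trans ltr01 p.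
by rewrite lef_pV2 ?posrE ?exprn_gt0// (ler_weXn2l p).
Qed.

(** The weight is [r^al = s^(-al) (s r)^al], and [(s r)^al <= 1 + s^2 r^2] uses up one of the three
    decaying factors; two are left for the Lorentzian. This is what the exponent 6 is for. *)
Lemma hker_moment k0 s c x (al : R) : 0 < k0 -> 0 < s -> 0 <= al -> al <= 1 ->
  coercive k0 s c x ->
  edist x c `^ al * normc (hker s c 6 x) <= k0 ^- 3 * s `^ (- al) * lorentz2 s c x.
Proof.
move=> k0p s0 a0 a1 h.
set r := edist x c; have r0 : 0 <= r by exact: eudist_ge0.
set q := 1 + s ^+ 2 * r ^+ 2.
have q1 : 1 <= q by rewrite lerDl mulr_ge0 ?sqr_ge0.
have q0 : 0 < q by exact: lt_le_trans q1.
have E : r `^ al = s `^ (- al) * (s * r) `^ al.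
  rewrite powRM ?(ltW s0)// mulrA -powRD; last by rewrite (gt_eqF s0) implybT.
  by rewrite addNr powRr0 mul1r.
have hq : (s * r) `^ al <= q.
  have sr0 : 0 <= s * r by rewrite mulr_ge0// ltW.
  have [sr1|sr1] := leP (s * r) 1.
    have : (s * r) `^ al <= 1 `^ al by apply: ge0_ler_powR; rewrite ?nnegrE.
    by rewrite powR1 => h1; exact: le_trans h1 q1.
  apply: (@le_trans _ _ ((s * r) `^ 1)).
    by apply: ler_powR => //; exact: ltW.
  rewrite powRr1// /q -exprMn.
  have := sqr_ge0 (s * r - 1); nra.
have hk := hker_le 3 k0p h.
rewrite E -/r -/q in hk *.
have sa : 0 <= s `^ (- al) by exact: powR_ge0.
have k3 : 0 <= k0 ^- 3 by rewrite invr_ge0 exprn_ge0// ltW.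
rewrite -mulrA [k0 ^- 3 * _]mulrC -mulrA ler_wpM2l//.
apply: (@le_trans _ _ (q * (k0 ^- 3 * q ^- 3))).
  by apply: (ler_pM (powR_ge0 _ _) (normc_ge0 _)).
rewrite mulrCA ler_wpM2l//.
apply: le_trans (lorentz2_ge s c x); rewrite -/r -/q.
by rewrite (exprS q 2) invfM mulrA divff ?mul1r// gt_eqF.
Qed.

Lemma normc_affine_le s c x : 0 <= s -> s * edist x c - 1 <= normc (1 + s%:C * zrel c x).
Proof.
move=> s0; have := le_normcB (1 + s%:C * zrel c x) 1.
rewrite addrAC subrr add0r normcM normcR (ger0_norm s0) normc_zrel normc1; lra.
Qed.

Lemma Ccontinuous_affine s c x : Ccontinuous_at (fun x : R * R => 1 + s%:C * zrel c x) x.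
Proof.
apply: Ccontinuous_atD; first exact: Ccontinuous_at_cst.
apply: Ccontinuous_atM; first exact: Ccontinuous_at_cst.
split => /=.
  by apply: cvgB; [exact: continuous_fst2|exact: cvg_cst].
by apply: cvgB; [exact: continuous_snd2|exact: cvg_cst].
Qed.

End kernel_bounds.

Section measurable_kernel.
Context {R : realType}.
Local Notation T2 := (measurableTypeR R * measurableTypeR R)%type.

Lemma Cmeasurable_continuous (D : set (R * R)) (f : R * R -> R[i]) :
  (forall x, Ccontinuous_at f x) -> Cmeasurable (D : set T2) f.
Proof.
by move=> cf; split; apply: continuous_measurable2 => x; have [] := cf x.
Qed.

Lemma Cmeasurable_inv d (T : measurableType d) (D : set T) (f : T -> R[i]) :
  Cmeasurable D f -> Cmeasurable D (fun x => (f x)^-1).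
Proof.
move=> [fr fi].
(* Inversion sends 0 to 0 and is discontinuous there, so the point 0 and its complement are treated
   separately. *)
have mV : measurable_fun setT (fun u : measurableTypeR R => u^-1 : measurableTypeR R).
  rewrite -(setUv [set 0]); apply/measurable_funU; [exact: measurable_set1|exact: measurableC|split].
    exact: measurable_fun_set1.
  apply: open_continuous_measurable_fun; first by rewrite openC; exact: closed_eq.
  by move=> u; rewrite inE => /eqP u0; exact: inv_continuous.
have mN : measurable_fun D (fun x => (cRe (f x) * cRe (f x) +
    cIm (f x) * cIm (f x))^-1 : measurableTypeR R).
  by apply: measurableT_comp => //; apply: measurable_funD; exact: measurable_funM.
split.
  by under eq_fun do rewrite cReV; exact: measurable_funM.
under eq_fun do rewrite cImV; apply: measurable_funM => //.
exact: measurableT_comp.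
Qed.

Lemma Cmeasurable_exp d (T : measurableType d) (D : set T) (f : T -> R[i]) n :
  Cmeasurable D f -> Cmeasurable D (fun x => (f x) ^+ n).
Proof.
move=> mf; elim: n => [|n ih]; first exact: Cmeasurable_cst.
by under eq_fun do rewrite exprS; exact: CmeasurableM.
Qed.

Lemma Cmeasurable_hker (D : set (R * R)) s c n :
  Cmeasurable (D : set T2) (@hker R s c n).
Proof.
apply: Cmeasurable_inv; apply: Cmeasurable_exp.
by apply: Cmeasurable_continuous => x; exact: Ccontinuous_affine.
Qed.

End measurable_kernel.

(** * Exact integral of the kernel over the sector *)

Section sector_integral.
Context {R : realType}.
Local Notation leb := (@lebesgue_measure R).
Local Notation T2 := (measurableTypeR R * measurableTypeR R)%type.

Lemma sector_coercive (tm tM : R) : - pi < tm -> tm < tM -> tM < pi ->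
  exists B k0 : R, [/\ 0 < B, 0 < k0, k0 <= 1,
    forall c x, sector c tm tM x -> - (B * `|x.2 - c.2|) < x.1 - c.1 &
    forall c x s, 0 <= s -> sector c tm tM x -> coercive k0 s c x].
Proof.
move=> h1 h2 h3; have [B B0 hB] := sector_sub_cone h1 h2 h3.
have D1 : 1 <= 3 * B ^+ 2 + 2 by have := sqr_ge0 B; lra.
exists B, (3 * B ^+ 2 + 2)^-1; split => //.
- by rewrite invr_gt0; lra.
- by rewrite invf_le1//; lra.
- by move=> c x s s0 /hB; exact: cone_coercive.
Qed.

(** Equals [sin t * e^(-i t)], the integral of [e^(-2 i theta)] for [theta] from 0 to [t]: the
    angular part of the sector integral in polar coordinates. *)
Definition sector_phase (t : R) : R[i] := (sin t * cos t) -i* (sin t ^+ 2).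

(** The factor 1/20 is the radial part, the integral of [r (1 + r)^-6] over the positive
    half-line. *)
Definition sector_const (tm tM : R) : R[i] :=
  (20%:R)^-1 * (sector_phase tM - sector_phase tm).

(** The difference of phases is [sin (tM - tm) e^(-i (tM + tm))], and [tM - tm] lies strictly
    between 0 and [2 pi], where the sine vanishes only at [pi]. *)
Lemma sector_const_neq0 (tm tM : R) : - pi < tm -> tm < tM -> tM < pi ->
  tM - tm <> pi -> sector_const tm tM != 0.
Proof.
move=> h1 h2 h3 h4; rewrite mulf_neq0// ?invr_neq0 ?pnatr_eq0//.
have E : sector_phase tM - sector_phase tm =
    (sin (tM - tm))%:C * (cos (tM + tm) -i* sin (tM + tm)).
  have S1 := cos2Dsin2 tM; have S2 := cos2Dsin2 tm.
  apply/eqP; rewrite eq_complex /= !mul0r subr0 addr0 sinB cosD sinD.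
  move: S1 S2; set a := sin tM; set b := cos tM; set c := sin tm; set d := cos tm.
  move=> S1 S2; apply/andP; split; apply/eqP.
    have -> : (a * d - b * c) * (b * d - a * c) =
      a * b * (d ^+ 2 + c ^+ 2) - c * d * (b ^+ 2 + a ^+ 2) by ring.
    by rewrite S1 S2 !mulr1.
  have -> : (a * d - b * c) * - (a * d + b * c) =
    - (a ^+ 2 * (d ^+ 2 + c ^+ 2)) + c ^+ 2 * (b ^+ 2 + a ^+ 2) by ring.
  by rewrite S1 S2 !mulr1 opprK.
rewrite E mulf_neq0//; last first.
  rewrite eq_complex /= oppr_eq0; apply/negP => /andP[/eqP e1 /eqP e2].
  by have := cos2Dsin2 (tM + tm); rewrite e1 e2 expr0n /= addr0 => /eqP; rewrite eq_sym oner_eq0.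
rewrite eq_complex /= eqxx andbT.
have [l|g|e] := ltgtP (tM - tm) pi; last by [].
  by rewrite gt_eqF//; apply: sin_gt0_pi; apply/andP; split; lra.
rewrite -[tM - tm](subrK pi) sinDpi oppr_eq0 gt_eqF//.
by apply: sin_gt0_pi; apply/andP; split; lra.
Qed.

Lemma integrable_hker_sector (tm tM s : R) c : - pi < tm -> tm < tM -> tM < pi ->
  0 < s -> Cintegrable (mu2 R) (sector c tm tM) (hker s c 6).
Proof.
move=> h1 h2 h3 s0; have mW := measurable_sector c h1 h2 h3.
have [B [k0 [_ k0p _ _ hco]]] := sector_coercive h1 h2 h3.
have [ib _] := integrable_lorentz2 c s0.
have ig : (mu2 R).-integrable (sector c tm tM)
    (EFin \o (fun x => k0 ^- 3 * lorentz2 s c x)).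
  apply: (@integrableS _ _ _ _ setT) => //.
  exact: (integrableZl measurableT (k0 ^- 3) ib).
apply: (le_Cintegrable mW _ ig); first exact: Cmeasurable_hker.
by move=> x Wx; apply: hker_lorentz2 => //; apply: hco => //; exact: ltW.
Qed.

(** Since [cot t + i = e^(i t) / sin t], the inverse is [sin t e^(-i t)]; the sign [e] selects the
    upper or the lower half-plane. *)
Lemma cot_phase (s t : R) (sg : bool) : 0 < s -> 0 < t < pi ->
  let e : R[i] := (-1) ^+ sg in
  (s%:C * (cot t +i* 0 + e * 'i))^-1 =
    s%:C^-1 * ((sin t * cos t)%:C - e * 'i * (sin t ^+ 2)%:C).
Proof.
move=> s0 t0 e; have st : 0 < sin t by exact: sin_gt0_pi.
have S1 := cos2Dsin2 t.
have stC : (sin t)%:C != 0 :> R[i] by rewrite eq_complex /= gt_eqF.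
have ee : e ^+ 2 = 1 by rewrite /e sqrr_sign.
have ii : ('i : R[i]) ^+ 2 = -1 by exact: sqr_i.
have cE : cot t +i* 0 = (cos t)%:C / (sin t)%:C :> R[i].
  by rewrite /cot -rmorphV ?unitfE ?gt_eqF// -rmorphM.
have S1C : (cos t)%:C ^+ 2 + (sin t)%:C ^+ 2 = 1 :> R[i].
  by rewrite -!rmorphXn -rmorphD S1.
have nz : (cos t)%:C + e * 'i * (sin t)%:C != 0.
  apply/negP => /eqP z0.
  have : ((cos t)%:C + e * 'i * (sin t)%:C) * ((cos t)%:C - e * 'i * (sin t)%:C) = 1.
    transitivity ((cos t)%:C ^+ 2 - e ^+ 2 * 'i ^+ 2 * (sin t)%:C ^+ 2); first by ring.
    by rewrite ee ii mul1r mulN1r opprK.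
  by rewrite z0 mul0r => /eqP; rewrite eq_sym oner_eq0.
rewrite invfM; congr (_ * _); rewrite cE.
have -> : (cos t)%:C / (sin t)%:C + e * 'i =
  ((cos t)%:C + e * 'i * (sin t)%:C) / (sin t)%:C by field.
rewrite invf_div; apply: (mulIf nz); rewrite divfK//.
rewrite rmorphM rmorphXn.
have -> : ((sin t)%:C * (cos t)%:C - e * 'i * (sin t)%:C ^+ 2) *
   ((cos t)%:C + e * 'i * (sin t)%:C) =
  (sin t)%:C * ((cos t)%:C ^+ 2 - e ^+ 2 * 'i ^+ 2 * (sin t)%:C ^+ 2) by ring.
by rewrite ee ii mul1r mulN1r opprK S1C mulr1.
Qed.

(** Along the ray [z] is the height times [cot t + i], so the integrand is again an inverse power of
    an affine function. The two successive integrations produce [5 * 4 = 20]. *)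
Lemma Cintegral_ray_y (s c t : R) : 0 < s -> t < pi ->
  Cintegrable leb `[c, +oo[ (fun y => ray_integral s (y - c) (y - c) t) /\
  Cintegral leb `[c, +oo[ (fun y => ray_integral s (y - c) (y - c) t) =
    if 0 < t then (20%:R * s%:C ^+ 2)^-1 * sector_phase t else 0.
Proof.
move=> s0 tpi; rewrite /ray_integral; have [t0|t0] := ltP 0 t; last first.
  split; last by rewrite /Cintegral /Rintegral /= integral0.
  by split; exact: integrable0.
pose b : R[i] := s%:C * (cot t +i* 0 + (-1) ^+ false * 'i).
have bE : b = (s * cot t) +i* s.
  by rewrite /b expr0 mul1r; apply/eqP; rewrite eq_complex /= !(mul0r, add0r, addr0, mulr1, subr0) !eqxx.
have b0 : cIm b != 0 by rewrite bE /= gt_eqF.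
have [i1 e1] := Cintegral_lin_exprV_y c c 3 b0.
have E : (fun y : R => (5%:R * s%:C)^-1 * (1 + s%:C * (((y - c) * cot t) +i* (y - c))) ^- 5) =
    (fun y => (5%:R * s%:C)^-1 * (1 + (y - c)%:C * b) ^- 5).
  apply/funext => y; congr (_ * (1 + _) ^- 5); rewrite bE.
  by apply/eqP; rewrite eq_complex /= !mul0r !subr0 !addr0; apply/andP; split; apply/eqP; ring.
rewrite E; split; first exact: CintegrableZ.
have bV := @cot_phase s t false s0 (introT andP (conj t0 tpi)).
rewrite CintegralZ// e1 subrr mul0r addr0 expr1n invr1 mulr1 [(4%:R * b)^-1]invfM [b^-1]bV.
have -> : (sin t * cos t)%:C - (-1) ^+ false * 'i * (sin t ^+ 2)%:C = sector_phase t.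
  by rewrite /sector_phase expr0 mul1r; apply/eqP;
    rewrite eq_complex /= !(mul0r, mul1r, mulr0, subr0, add0r, addr0) ?oppr0 ?addr0 !eqxx.
have sC : s%:C != 0 :> R[i] by rewrite eq_complex /= gt_eqF.
by field.
Qed.

(** In the lower half-plane the direction is [cot t - i]. Its phase [sin t e^(i t)] equals
    [- sector_phase (- t)], which restores the true angle of the ray. *)
Lemma Cintegral_ray_Ny (s c t : R) : 0 < s -> t < pi ->
  Cintegrable leb `]-oo, c] (fun y => ray_integral s (y - c) (c - y) t) /\
  Cintegral leb `]-oo, c] (fun y => ray_integral s (y - c) (c - y) t) =
    if 0 < t then - ((20%:R * s%:C ^+ 2)^-1 * sector_phase (- t)) else 0.
Proof.
move=> s0 tpi; rewrite /ray_integral; have [t0|t0] := ltP 0 t; last first.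
  split; last by rewrite /Cintegral /Rintegral /= integral0.
  by split; exact: integrable0.
pose b : R[i] := s%:C * (cot t +i* 0 + (-1) ^+ true * 'i).
have bE : b = (s * cot t) -i* s.
  by rewrite /b expr1 mulN1r; apply/eqP;
    rewrite eq_complex /= !(mul0r, add0r, addr0, mulr1, subr0, oppr0, mulrN) !eqxx.
have b0 : cIm (- b) != 0 by rewrite bE /= opprK gt_eqF.
have [i1 e1] := Cintegral_lin_exprV_Ny c c 3 b0.
have E : (fun y : R => (5%:R * s%:C)^-1 * (1 + s%:C * (((c - y) * cot t) +i* (y - c))) ^- 5) =
    (fun y => (5%:R * s%:C)^-1 * (1 + (y - c)%:C * - b) ^- 5).
  apply/funext => y; congr (_ * (1 + _) ^- 5); rewrite bE.
  by apply/eqP; rewrite eq_complex /= !mul0r !subr0 !addr0; apply/andP; split; apply/eqP; ring.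
rewrite E; split; first exact: CintegrableZ.
have bV := @cot_phase s t true s0 (introT andP (conj t0 tpi)).
rewrite CintegralZ// e1 subrr mul0r addr0 expr1n invr1 mulr1.
have -> : (4%:R * - b)^-1 = - (4%:R^-1 * b^-1) by rewrite mulrN invrN invfM.
rewrite opprK [b^-1]bV.
have -> : (sin t * cos t)%:C - (-1) ^+ true * 'i * (sin t ^+ 2)%:C = - sector_phase (- t).
  rewrite /sector_phase expr1 mulN1r sinN cosN sqrrN; apply/eqP; rewrite eq_complex /=.
  by rewrite !(mul0r, mul1r, mulr0, subr0, add0r, addr0, mulNr, opprK, oppr0) !eqxx.
have sC : s%:C != 0 :> R[i] by rewrite eq_complex /= gt_eqF.
by field.
Qed.

Lemma Cintegral_hker_sector (tm tM s : R) c : - pi < tm -> tm < tM -> tM < pi ->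
  0 < s -> Cintegral (mu2 R) (sector c tm tM) (hker s c 6) =
    s%:C ^- 2 * sector_const tm tM.
Proof.
move=> h1 h2 h3 s0; have mW := measurable_sector c h1 h2 h3.
have mpi : - tm < pi by lra.
have [ip1 ep1] := Cintegral_ray_y c.2 s0 h3.
have [ip2 ep2] := Cintegral_ray_y c.2 s0 (lt_trans h2 h3).
have [im1 em1] := Cintegral_ray_Ny c.2 s0 mpi.
have Mpi : - tM < pi by lra.
have [im2 em2] := Cintegral_ray_Ny c.2 s0 Mpi.
rewrite (@Cintegral_horizontal_slices _ _ _ c.2
  (fun y => ray_integral s (y - c.2) (c.2 - y) (- tm) -
            ray_integral s (y - c.2) (c.2 - y) (- tM))
  (fun y => ray_integral s (y - c.2) (y - c.2) tM -
            ray_integral s (y - c.2) (y - c.2) tm) mW); first last.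
- exact: CintegrableB.
- exact: CintegrableB.
- move=> y yc S; have y0 : 0 < y - c.2 by rewrite subr_gt0.
  have -> : S = [set u | slice tm tM (y - c.2) (u - c.1)].
    apply/seteqP; split => u; first by move/(sector_upper h1 h2 h3) => /=; exact.
    by move=> h; apply/(sector_upper h1 h2 h3).
  exact: (@Cintegral_slice R s (y - c.2) c.1 (y - c.2) tm tM s0 (lt0r_neq0 y0) y0).
- move=> y yc S; have y0 : 0 < c.2 - y by rewrite subr_gt0.
  have -> : S = [set u | slice (- tM) (- tm) (c.2 - y) (u - c.1)].
    apply/seteqP; split => u; first by move/(sector_lower h1 h2 h3) => /=; exact.
    by move=> h; apply/(sector_lower h1 h2 h3).
  have y1 : y - c.2 != 0 by rewrite lt_eqF// subr_lt0.
  apply: (@Cintegral_slice R s (y - c.2) c.1 (c.2 - y) (- tM) (- tm) s0 y1 y0); lra.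
- exact: integrable_hker_sector.
rewrite !CintegralB// ep1 ep2 em1 em2 !oppr_gt0 !opprK /sector_const.
have sC : s%:C != 0 :> R[i] by rewrite eq_complex /= gt_eqF.
have P0 : sector_phase 0 = 0 :> R[i].
  by rewrite /sector_phase sin0 mul0r expr0n oppr0.
(* A bounding ray of angle [t] lies in one of the two open half-planes, or on the axis, where its
   phase vanishes; so the partial contributions add up to the full one. *)
have key t : (if 0 < t then (20%:R * s%:C ^+ 2)^-1 * sector_phase t else 0) +
   (if t < 0 then (20%:R * s%:C ^+ 2)^-1 * sector_phase t else 0) =
   (20%:R * s%:C ^+ 2)^-1 * sector_phase t.
  by have [_|_|<-] := ltgtP 0 t; rewrite ?addr0 ?add0r// P0 mulr0.
have keyN t : (if t < 0 then - ((20%:R * s%:C ^+ 2)^-1 * sector_phase t) else 0) =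
   - (if t < 0 then (20%:R * s%:C ^+ 2)^-1 * sector_phase t else 0).
  by case: ifP; rewrite ?oppr0.
rewrite !keyN.
have -> : s%:C ^- 2 * (20%:R^-1 * (sector_phase tM - sector_phase tm)) =
  (20%:R * s%:C ^+ 2)^-1 * sector_phase tM - (20%:R * s%:C ^+ 2)^-1 * sector_phase tm.
  by field.
by rewrite -[X in _ = X - _]key -[X in _ = _ - X]key; ring.
Qed.

End sector_integral.

(** * Weak derivatives and H^1_0 *)

Section test_functions.
Context {R : realType}.
Local Notation T2 := (measurableTypeR R * measurableTypeR R)%type.
Implicit Types (Omega K : set (R * R)) (phi : R * R -> R).

Definition axis (e : R * R) := e = e1 R \/ e = e2 R.

Lemma near_notin (K : set (R * R)) x : closed K -> ~ K x ->
  \forall y \near x, ~ K y.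
Proof.
by move=> cK nK; apply: open_nbhs_nbhs; split => //; exact: closed_openC.
Qed.

Lemma test_functionP Omega phi e : axis e -> test_function Omega phi ->
  exists K : set (R * R), [/\ compact K, closed K, K `<=` Omega &
    [/\ continuous phi, continuous (fun x => 'D_e phi x),
        forall x, is_derive x e phi ('D_e phi x),
        forall x, ~ K x -> phi x = 0 & forall x, ~ K x -> 'D_e phi x = 0]].
Proof.
move=> he [hC [K [cK KO phi0]]]; have clK : closed K.
  by apply: compact_closed => //; exact: norm_hausdorff.
have [cphi dphi c1 c2] := hC 1%N; clear hC.
exists K; split; [exact: cK|exact: clK|exact: KO|].
split; [exact: cphi| | |exact: phi0|].
- by case: he => ->; [exact: c1|exact: c2].
- by move=> x; apply: DeriveDef; last exact: erefl; case: he => ->; have [] := dphi x.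
move=> x nK; have : is_derive x e phi 0.
  apply: (near_eq_is_derive _ (is_derive_cst (0 : R) x e)).
  by apply: filterS (near_notin clK nK) => y /phi0 ->.
by move=> [].
Qed.

(** [h] is controlled only on [Omega]; outside the closed set [K] the product is locally zero, which
    gives continuity across the boundary. *)
Lemma continuous_patch Omega K (h phi : R * R -> R) : closed K -> K `<=` Omega ->
  (forall x, Omega x -> {for x, continuous h}) -> continuous phi ->
  (forall x, ~ K x -> phi x = 0) -> continuous (fun x => h x * phi x).
Proof.
move=> cK KO ch cphi phi0 x; have [Kx|nK] := pselect (K x).
  by apply: cvgM; [exact: ch (KO _ Kx)|exact: cphi].
apply: cvg_near_cst; rewrite (phi0 _ nK) mulr0.
by apply: filterS (near_notin cK nK) => y /phi0 ->; rewrite mulr0.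
Qed.

(** Off the support of [phi] the product [f * phi] is zero, so it has a continuous derivative along
    [e] on the whole plane, with compact support, and the integral of that derivative is 0. *)
Lemma weak_ibp Omega phi e (f f' : R * R -> R) : axis e -> open Omega ->
  test_function Omega phi ->
  (forall x, Omega x -> is_derive x e f (f' x)) ->
  (forall x, Omega x -> {for x, continuous f}) ->
  (forall x, Omega x -> {for x, continuous f'}) ->
  [/\ (mu2 R).-integrable Omega (EFin \o (fun x => f x * 'D_e phi x)),
      (mu2 R).-integrable Omega (EFin \o (fun x => f' x * phi x)) &
      Rintegral (mu2 R) Omega (fun x => f x * 'D_e phi x) =
      - Rintegral (mu2 R) Omega (fun x => f' x * phi x)].
Proof.
move=> he oO hphi df cf cf'.
have [K [cK clK KO [cphi cdphi dphi phi0 dphi0]]] := test_functionP he hphi.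
have mO := open_measurable2 oO.
have c1 := continuous_patch clK KO cf cdphi dphi0.
have c2 := continuous_patch clK KO cf' cphi phi0.
have z1 x : ~ K x -> f x * 'D_e phi x = 0 by move=> /dphi0 ->; rewrite mulr0.
have z2 x : ~ K x -> f' x * phi x = 0 by move=> /phi0 ->; rewrite mulr0.
have i1 := integrable_compact_support mO c1 cK z1.
have i2 := integrable_compact_support mO c2 cK z2.
split => //; apply/eqP; rewrite -addr_eq0 -RintegralD// Rintegral_mkcond.
have := @integral_derive_compact_support R (fun x => f x * phi x)
  (fun x => f x * 'D_e phi x + f' x * phi x) K e he.
move=> Z; apply/eqP; rewrite -[RHS]Z //; clear Z.
- apply: eq_Rintegral => x _; rewrite patchE; case: ifPn => // /negP nO.
  have nK : ~ K x by move=> /KO Ox; apply: nO; rewrite inE.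
  by rewrite z1// z2// addr0.
- move=> x; have [Kx|nK] := pselect (K x).
    have := is_deriveM (df _ (KO _ Kx)) (dphi x).
    by move=> h; apply: is_derive_eq; rewrite /GRing.scale /= [phi x * _]mulrC.
  rewrite z1// z2// addr0.
  apply: (near_eq_is_derive _ (is_derive_cst (0 : R) x e)).
  by apply: filterS (near_notin clK nK) => y /phi0 ->; rewrite mulr0.
- by move=> x; apply: cvgD; [exact: c1|exact: c2].
- by move=> x /phi0 ->; rewrite mulr0.
- by move=> x nK; rewrite z1// z2// addr0.
Qed.

Lemma weak_partial_C1 Omega e (Psi Psi' : R * R -> R[i]) : axis e -> open Omega ->
  (forall x, Omega x -> is_derive x e (fun y => cRe (Psi y)) (cRe (Psi' x))) ->
  (forall x, Omega x -> is_derive x e (fun y => cIm (Psi y)) (cIm (Psi' x))) ->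
  (forall x, Omega x -> Ccontinuous_at Psi x) ->
  (forall x, Omega x -> Ccontinuous_at Psi' x) ->
  weak_partial Omega e Psi Psi'.
Proof.
move=> he oO dr di c c' phi hphi.
have [_ _ er] := weak_ibp he oO hphi dr (fun x Ox => (c x Ox).1) (fun x Ox => (c' x Ox).1).
have [_ _ ei] := weak_ibp he oO hphi di (fun x Ox => (c x Ox).2) (fun x Ox => (c' x Ox).2).
have ReE (a : R[i]) (b : R) : cRe (a * b%:C) = cRe a * b.
  by rewrite cReM /= mulr0 subr0.
have ImE (a : R[i]) (b : R) : cIm (a * b%:C) = cIm a * b.
  by rewrite cImM /= mulr0 add0r.
rewrite /Cintegral /=.
under eq_Rintegral do rewrite ReE.
under [X in _ +i* X]eq_Rintegral do rewrite ImE.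
rewrite er ei; congr (- _ +i* - _); apply: eq_Rintegral => x _.
  by rewrite ReE.
by rewrite ImE.
Qed.

End test_functions.

(** * The kernel as a function in H^1 *)

Section hker_H1.
Context {R : realType}.
Local Notation T2 := (measurableTypeR R * measurableTypeR R)%type.
Implicit Types (s : R) (c x : R * R).

Lemma is_Cderive_hker1 s c n x : 1 + s%:C * zrel c x != 0 ->
  is_derive x (e1 R) (fun y => cRe (hker s c n.+1 y))
    (cRe (- n.+1%:R * s%:C * hker s c n.+2 x)) /\
  is_derive x (e1 R) (fun y => cIm (hker s c n.+1 y))
    (cIm (- n.+1%:R * s%:C * hker s c n.+2 x)).
Proof.
move=> A0.
have E t : 1 + s%:C * zrel c (t, x.2) =
    (1 + s%:C * ((- c.1) +i* (x.2 - c.2))) + t%:C * s%:C.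
  apply/eqP; rewrite eq_complex /zrel /= !(mul0r, mulr0, subr0, addr0, add0r).
  by apply/andP; split; apply/eqP; ring.
have A0' : (fun t => (1 + s%:C * ((- c.1) +i* (x.2 - c.2))) + t%:C * s%:C) x.1 != 0.
  by rewrite /= -E -surjective_pairing.
have := @is_Cderive_exprV _ x.1 (fun t => (1 + s%:C * ((- c.1) +i* (x.2 - c.2))) + t%:C * s%:C)
  _ n A0' (is_Cderive_affine x.1 _ s%:C).
rewrite /= -E -surjective_pairing.
rewrite (_ : (fun u => _) = (fun t => hker s c n.+1 (t, x.2))); last first.
  by apply/funext => t; rewrite /hker E.
move=> [h1 h2]; split.
  by apply/(is_derive_e1 (fun y => cRe (hker s c n.+1 y)) x).
by apply/(is_derive_e1 (fun y => cIm (hker s c n.+1 y)) x).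
Qed.

(** The extra factor ['i] compared with the direction [e1] is the Cauchy-Riemann equation;
    holomorphy of the kernel enters through it. *)
Lemma is_Cderive_hker2 s c n x : 1 + s%:C * zrel c x != 0 ->
  is_derive x (e2 R) (fun y => cRe (hker s c n.+1 y))
    (cRe ('i * (- n.+1%:R * s%:C * hker s c n.+2 x))) /\
  is_derive x (e2 R) (fun y => cIm (hker s c n.+1 y))
    (cIm ('i * (- n.+1%:R * s%:C * hker s c n.+2 x))).
Proof.
move=> A0.
have E t : 1 + s%:C * zrel c (x.1, t) =
    (1 + s%:C * ((x.1 - c.1) +i* (- c.2))) + t%:C * (s%:C * 'i).
  apply/eqP; rewrite eq_complex /zrel /= !(mul0r, mulr0, subr0, addr0, add0r, mulr1).
  by apply/andP; split; apply/eqP; ring.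
have A0' : (fun t => (1 + s%:C * ((x.1 - c.1) +i* (- c.2))) + t%:C * (s%:C * 'i)) x.2 != 0.
  by rewrite /= -E -surjective_pairing.
have := @is_Cderive_exprV _ x.2 (fun t => (1 + s%:C * ((x.1 - c.1) +i* (- c.2))) + t%:C * (s%:C * 'i))
  _ n A0' (is_Cderive_affine x.2 _ (s%:C * 'i)).
rewrite /= -E -surjective_pairing.
rewrite (_ : (fun u => _) = (fun t => hker s c n.+1 (x.1, t))); last first.
  by apply/funext => t; rewrite /hker E.
have -> : - n.+1%:R * (s%:C * 'i) / (1 + s%:C * zrel c x) ^+ n.+2 =
  'i * (- n.+1%:R * s%:C * hker s c n.+2 x) by rewrite /hker; ring.
move=> [h1 h2]; split.
  by apply/(is_derive_e2 (fun y => cRe (hker s c n.+1 y)) x).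
by apply/(is_derive_e2 (fun y => cIm (hker s c n.+1 y)) x).
Qed.

Lemma Ccontinuous_hker s c n x : 1 + s%:C * zrel c x != 0 ->
  Ccontinuous_at (hker s c n) x.
Proof.
by move=> A0; apply: Ccontinuous_at_exprV => //; exact: Ccontinuous_affine.
Qed.

Lemma weak_partial_hker Omega s c n : open Omega ->
  (forall x, Omega x -> 1 + s%:C * zrel c x != 0) ->
  weak_partial Omega (e1 R) (hker s c n.+1)
    (fun x => - n.+1%:R * s%:C * hker s c n.+2 x) /\
  weak_partial Omega (e2 R) (hker s c n.+1)
    (fun x => 'i * (- n.+1%:R * s%:C * hker s c n.+2 x)).
Proof.
move=> oO A0; split.
  apply: (weak_partial_C1 (or_introl erefl) oO).
  - by move=> x /A0 /(is_Cderive_hker1 n)[].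
  - by move=> x /A0 /(is_Cderive_hker1 n)[].
  - by move=> x /A0 ?; exact: Ccontinuous_hker.
  - move=> x /A0 ?; apply: Ccontinuous_atM; first exact: Ccontinuous_at_cst.
    exact: Ccontinuous_hker.
apply: (weak_partial_C1 (or_intror erefl) oO).
- by move=> x /A0 /(is_Cderive_hker2 n)[].
- by move=> x /A0 /(is_Cderive_hker2 n)[].
- by move=> x /A0 ?; exact: Ccontinuous_hker.
- move=> x /A0 ?; apply: Ccontinuous_atM; first exact: Ccontinuous_at_cst.
  apply: Ccontinuous_atM; first exact: Ccontinuous_at_cst.
  exact: Ccontinuous_hker.
Qed.

Lemma bounded_L2 d (T : measurableType d) (mu : {measure set T -> \bar R})
    (D : set T) (f : T -> R[i]) (M : R) : measurable D -> (mu D < +oo)%E ->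
  Cmeasurable D f -> (forall x : T, D x -> normc (f x) <= M) -> L2 mu D f.
Proof.
move=> mD Dfin mf fM; apply: integrable_L2 => //.
apply: measurable_bounded_integrable => //.
  by apply: measurable_funX; exact: measurable_normc.
exists (M ^+ 2); split; first exact: num_real.
move=> N MN x Dx /=; rewrite ger0_norm ?sqr_ge0// (le_trans _ (ltW MN))//.
by rewrite lerXn2r ?nnegrE ?normc_ge0 ?fM// (le_trans _ (fM _ Dx))// normc_ge0.
Qed.

Lemma L2_hker Omega s c n (dl : R) : open Omega -> bounded_set Omega -> 0 < dl ->
  (forall x, Omega x -> dl <= normc (1 + s%:C * zrel c x)) ->
  L2 (mu2 R) Omega (hker s c n).
Proof.
move=> oO bO d0 hd; have mO := open_measurable2 oO.
apply: (bounded_L2 mO (mu2_bounded_lty mO bO) (M := dl ^- n)).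
  exact: Cmeasurable_hker.
move=> x Ox; rewrite /hker normcV normc_expr.
have h := hd x Ox.
by rewrite lef_pV2 ?posrE ?exprn_gt0// ?(lt_le_trans d0)// lerXn2r ?nnegrE ?(ltW d0) ?normc_ge0.
Qed.

Lemma H1_hker Omega s c n (dl : R) : open Omega -> bounded_set Omega -> 0 < dl ->
  (forall x, Omega x -> dl <= normc (1 + s%:C * zrel c x)) ->
  H1 Omega (hker s c n.+1) (fun x => (- n.+1%:R * s%:C * hker s c n.+2 x,
    'i * (- n.+1%:R * s%:C * hker s c n.+2 x))).
Proof.
move=> oO bO d0 hd; have mO := open_measurable2 oO.
have A0 x : Omega x -> 1 + s%:C * zrel c x != 0.
  by move=> /hd; apply: contraTneq => ->; rewrite normc0 -ltNge.
have [w1 w2] := weak_partial_hker n oO A0.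
have Lk m := L2_hker m oO bO d0 hd.
by split; [exact: Lk|exact: (L2Z _ mO (Lk _))|
  exact: (L2Z _ mO (L2Z _ mO (Lk _)))|exact: w1|exact: w2].
Qed.

End hker_H1.

Section H10.
Context {R : realType}.
Local Notation T2 := (measurableTypeR R * measurableTypeR R)%type.
Implicit Types (Omega : set (R * R)) (u : R * R -> R[i]).

Lemma sqL2norm_ge0 d (T : measurableType d) (mu : {measure set T -> \bar R})
  (D : set T) (f : T -> R[i]) : (0 <= sqL2norm mu D f)%E.
Proof. by apply: integral_ge0 => x _; rewrite lee_fin sqr_ge0. Qed.

Lemma poweR_half_le (x : \bar R) (M : R) : (0 <= x)%E -> 0 <= M ->
  (x `^ 2^-1 <= M%:E)%E -> (x <= (M ^+ 2)%:E)%E.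
Proof.
move=> x0 M0; rewrite poweR12_sqrt// => h.
rewrite -lee_sqrt ?lee_fin ?sqr_ge0//.
by rewrite EFin_expe sqrte_sqr gee0_abs.
Qed.

Lemma H1norm_le Omega u Du (M : R) : 0 <= M -> (H1norm Omega u Du <= M%:E)%E ->
  [/\ (sqL2norm (mu2 R) Omega u <= (M ^+ 2)%:E)%E,
      (sqL2norm (mu2 R) Omega (fun x => (Du x).1) <= (M ^+ 2)%:E)%E &
      (sqL2norm (mu2 R) Omega (fun x => (Du x).2) <= (M ^+ 2)%:E)%E].
Proof.
move=> M0 h.
set a := sqL2norm (mu2 R) Omega u.
set b := sqL2norm (mu2 R) Omega (fun x => (Du x).1).
set d := sqL2norm (mu2 R) Omega (fun x => (Du x).2).
have a0 : (0 <= a)%E by exact: sqL2norm_ge0.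
have b0 : (0 <= b)%E by exact: sqL2norm_ge0.
have d0 : (0 <= d)%E by exact: sqL2norm_ge0.
have := poweR_half_le (adde_ge0 (adde_ge0 a0 b0) d0) M0 h.
move=> H; split; apply: le_trans H.
- by rewrite -addeA leeDl// adde_ge0.
- by rewrite addeAC leeDr// adde_ge0.
- by rewrite leeDr// adde_ge0.
Qed.

Lemma H10_approx Omega u Du (eps : R) : 0 < eps -> H10 Omega u Du ->
  exists phi : R * R -> R[i],
    [/\ test_function Omega (fun x => cRe (phi x)),
        test_function Omega (fun x => cIm (phi x)),
        (sqL2norm (mu2 R) Omega (fun x => u x - phi x)%R <= (eps ^+ 2)%:E)%E,
        (sqL2norm (mu2 R) Omega (fun x => (Du x).1 - Cpartial (e1 R) phi x)%R
          <= (eps ^+ 2)%:E)%E &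
        (sqL2norm (mu2 R) Omega (fun x => (Du x).2 - Cpartial (e2 R) phi x)%R
          <= (eps ^+ 2)%:E)%E].
Proof.
move=> e0 [_ [phi [tphi cphi]]].
have : \forall n \near \oo, (H1norm Omega (fun x => u x - phi n x)%R
    (fun x => Du x - Cgrad (phi n) x)%R < eps%:E)%E.
  apply: (cphi [set y | (y < eps%:E)%E]); exists eps => //= r.
  by rewrite /ball_ /= sub0r normrN lte_fin; exact: le_lt_trans (ler_norm _).
move=> [n _ /(_ n (leqnn n))] /= /ltW /(H1norm_le (ltW e0)) [h1 h2 h3].
have [t1 t2] := tphi n; exists (phi n).
by split; [exact: t1|exact: t2|exact: h1|exact: h2|exact: h3].
Qed.

End H10.

(** * Integration by parts against H^1_0 and the orthogonality relation *)

Section H10_calculus.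
Context {R : realType}.
Local Notation T2 := (measurableTypeR R * measurableTypeR R)%type.
Local Notation leb := (@lebesgue_measure R).
Implicit Types (Omega : set (R * R)) (u : R * R -> R[i]).

Lemma continuous_compact_support_L2 (D K : set (R * R)) (f : R * R -> R[i]) :
  measurable (D : set T2) -> compact K ->
  continuous (fun x => cRe (f x)) -> continuous (fun x => cIm (f x)) ->
  (forall x, ~ K x -> f x = 0) -> L2 (mu2 R) D f.
Proof.
move=> mD cK cr ci f0; apply: (integrable_L2 mD).
  by split; exact: continuous_measurable2.
rewrite (_ : (fun x => _) = (fun x => cRe (f x) * cRe (f x) +
    cIm (f x) * cIm (f x))); last first.
  by apply/funext => x; rewrite sqr_normcE !expr2.
apply: (integrable_compact_support mD _ cK).
  by move=> x; apply: cvgD; apply: cvgM; [exact: cr|exact: cr|exact: ci|exact: ci].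
by move=> x /f0 ->; rewrite mulr0 addr0.
Qed.

Lemma test_function_L2 Omega (D : set (R * R)) e (phi : R * R -> R[i]) :
  measurable (D : set T2) -> axis e ->
  test_function Omega (fun x => cRe (phi x)) ->
  test_function Omega (fun x => cIm (phi x)) ->
  L2 (mu2 R) D phi /\ L2 (mu2 R) D (Cpartial e phi).
Proof.
move=> mD he /(test_functionP he)[K1 [cK1 _ _ [c1 d1 _ z1 dz1]]].
move=> /(test_functionP he)[K2 [cK2 _ _ [c2 d2 _ z2 dz2]]].
have cK := compactU cK1 cK2.
have nU x : ~ (K1 `|` K2) x -> ~ K1 x /\ ~ K2 x.
  by move=> n; split => h; apply: n; [left|right].
split; apply: (continuous_compact_support_L2 mD cK).
- exact: c1.
- exact: c2.
- by move=> x /nU[n1 n2]; rewrite (complex_eta (phi x)) z1// z2.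
- exact: d1.
- exact: d2.
- by move=> x /nU[n1 n2]; rewrite /Cpartial dz1// dz2.
Qed.

Lemma l2_le d (T : measurableType d) (mu : {measure set T -> \bar R}) (D : set T)
    (f : T -> R[i]) (e : R) : measurable D -> L2 mu D f -> 0 <= e ->
  (sqL2norm mu D f <= (e ^+ 2)%:E)%E -> Num.sqrt (l2 mu D f) <= e.
Proof.
move=> mD Lf e0; rewrite (sqL2normE mD Lf) lee_fin => h.
by rewrite -[leRHS]ger0_norm// -sqrtr_sqr ler_wsqrtr.
Qed.

Lemma normc_Cintegral_mul_le d (T : measurableType d) (mu : {measure set T -> \bar R})
    (D : set T) (f g : T -> R[i]) : measurable D -> L2 mu D f -> L2 mu D g ->
  normc (Cintegral mu D (fun x => f x * g x)) <=
    2 * (Num.sqrt (l2 mu D f) * Num.sqrt (l2 mu D g)).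
Proof.
move=> mD Lf Lg.
apply: le_trans (normc_Cintegral_le mD (L2M_Cintegrable mD Lf Lg)) _.
by rewrite ler_wpM2l//; exact: cauchy_schwarz.
Qed.

(** For a test function in place of [u] this is the definition of the weak derivative of [Psi]; both
    sides are continuous in the L2 norm, so the identity passes to limits. *)
Lemma approx_ibp Omega e u v Psi Psi' : open Omega -> axis e ->
  L2 (mu2 R) Omega u -> L2 (mu2 R) Omega v ->
  L2 (mu2 R) Omega Psi -> L2 (mu2 R) Omega Psi' ->
  weak_partial Omega e Psi Psi' ->
  (forall eps : R, 0 < eps -> exists phi : R * R -> R[i],
    [/\ test_function Omega (fun x => cRe (phi x)),
        test_function Omega (fun x => cIm (phi x)),
        (sqL2norm (mu2 R) Omega (fun x => u x - phi x)%R <= (eps ^+ 2)%:E)%E &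
        (sqL2norm (mu2 R) Omega (fun x => v x - Cpartial e phi x)%R
          <= (eps ^+ 2)%:E)%E]) ->
  Cintegral (mu2 R) Omega (fun x => v x * Psi x) =
  - Cintegral (mu2 R) Omega (fun x => u x * Psi' x).
Proof.
move=> oO he Lu Lv LP LP' wP happrox.
have mO := open_measurable2 oO.
have iv := L2M_Cintegrable mO Lv LP.
have iu := L2M_Cintegrable mO Lu LP'.
apply/eqP; rewrite -addr_eq0; apply/eqP; apply: eq0_normc; apply/eqP.
rewrite eq_le normc_ge0 andbT; apply/ler_addgt0Pr => eps eps0; rewrite add0r.
(* By Cauchy-Schwarz the two replacements cost at most [M] times the approximation radius, which is
   therefore taken as [eps / (M + 1)]; the 1 avoids division by zero. *)
pose M := 2 * (Num.sqrt (l2 (mu2 R) Omega Psi) + Num.sqrt (l2 (mu2 R) Omega Psi')).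
have M0 : 0 <= M by rewrite mulr_ge0// addr_ge0// sqrtr_ge0.
have d0 : 0 < eps / (M + 1) by rewrite divr_gt0// ltr_wpDl.
have [phi [tr ti a1 a2]] := happrox _ d0.
have [Lphi Ldphi] := test_function_L2 mO he tr ti.
have L1 := L2B mO Lu Lphi; have L3 := L2B mO Lv Ldphi.
have b1 := l2_le mO L1 (ltW d0) a1.
have b3 := l2_le mO L3 (ltW d0) a2.
have LR (f : R * R -> R) : L2 (mu2 R) Omega (fun x => (f x)%:C) ->
    Cintegrable (mu2 R) Omega (fun x => Psi x * (f x)%:C) /\
    Cintegrable (mu2 R) Omega (fun x => Psi' x * (f x)%:C).
  by move=> Lf; split; exact: L2M_Cintegrable.
have Lreal (f : R * R -> R) (h : R * R -> R[i]) : L2 (mu2 R) Omega h ->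
    (Cmeasurable (Omega : set T2) (fun x => (f x)%:C)) ->
    (forall x, `|f x| <= normc (h x)) -> L2 (mu2 R) Omega (fun x => (f x)%:C).
  move=> Lh mf fh; apply: (integrable_L2 mO mf).
  apply: le_integrable (L2_integrable mO Lh) => //.
    by apply/measurable_EFinP; apply: measurable_funX; exact: measurable_normc.
  move=> x Ox; change (`|(normc (f x)%:C ^+ 2)%:E| <= `|(normc (h x) ^+ 2)%:E|)%E.
  rewrite !gee0_abs ?lee_fin ?sqr_ge0//.
  by rewrite lerXn2r ?nnegrE ?normc_ge0// normcR.
have mC (f : T2 -> measurableTypeR R) : measurable_fun (Omega : set T2) f ->
    Cmeasurable (Omega : set T2) (fun x => (f x)%:C).
  by move=> mf; split => //=; exact: measurable_cst.
have [[mpr mpi] _] := Lphi; have [[mdr mdi] _] := Ldphi.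
have [i1 i1'] := LR _ (Lreal _ _ Lphi (mC _ mpr) (fun x => normr_Re_le _)).
have [i2 i2'] := LR _ (Lreal _ _ Lphi (mC _ mpi) (fun x => normr_Im_le _)).
have [j1 j1'] := LR _ (Lreal _ _ Ldphi (mC _ mdr) (fun x => normr_Re_le _)).
have [j2 j2'] := LR _ (Lreal _ _ Ldphi (mC _ mdi) (fun x => normr_Im_le _)).
(* [weak_partial] tests only against real functions, so [phi] and its derivative are split into real
   and imaginary parts. *)
have split_re (F : R * R -> R[i]) (h : R * R -> R[i]) :
    (fun x => h x * F x) = (fun x => F x * (cRe (h x))%:C +
      'i * (F x * (cIm (h x))%:C)).
  apply/funext => x; rewrite [in LHS](complexE (h x)) mulrDl.
  by congr (_ + _); [exact: mulrC|rewrite -mulrA; congr (_ * _); exact: mulrC].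
have ibp : Cintegral (mu2 R) Omega (fun x => Cpartial e phi x * Psi x) =
    - Cintegral (mu2 R) Omega (fun x => phi x * Psi' x).
  rewrite !split_re !CintegralD//; try exact: CintegrableZ.
  rewrite !CintegralZ//.
  have := wP _ tr; have := wP _ ti.
  move=> -> ->; ring.
have E : Cintegral (mu2 R) Omega (fun x => v x * Psi x) +
    Cintegral (mu2 R) Omega (fun x => u x * Psi' x) =
    Cintegral (mu2 R) Omega (fun x => (v x - Cpartial e phi x) * Psi x) +
    Cintegral (mu2 R) Omega (fun x => (u x - phi x) * Psi' x).
  under [X in _ = X + _]eq_Cintegral do rewrite mulrBl.
  under [X in _ = _ + X]eq_Cintegral do rewrite mulrBl.
  rewrite !CintegralB//; [|exact: L2M_Cintegrable..].
  rewrite ibp; ring.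
rewrite E; apply: le_trans (le_normcD _ _) _.
have e1_ := normc_Cintegral_mul_le mO L3 LP.
have e2_ := normc_Cintegral_mul_le mO L1 LP'.
apply: le_trans (lerD e1_ e2_) _.
apply: (@le_trans _ _ (eps / (M + 1) * M)).
  have s1 := sqrtr_ge0 (l2 (mu2 R) Omega Psi).
  have s2 := sqrtr_ge0 (l2 (mu2 R) Omega Psi').
  rewrite /M; have := ler_wpM2r s1 b3; have := ler_wpM2r s2 b1; lra.
rewrite mulrAC ler_pdivrMr ?ltr_wpDl// ler_wpM2l ?(ltW eps0)//; lra.
Qed.

Lemma H10_ibp Omega u Du Psi DPsi : open Omega -> H10 Omega u Du ->
  H1 Omega Psi DPsi ->
  Cintegral (mu2 R) Omega (fun x => (Du x).1 * Psi x) =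
    - Cintegral (mu2 R) Omega (fun x => u x * (DPsi x).1) /\
  Cintegral (mu2 R) Omega (fun x => (Du x).2 * Psi x) =
    - Cintegral (mu2 R) Omega (fun x => u x * (DPsi x).2).
Proof.
move=> oO hu [LP LP1 LP2 w1 w2]; have [[Lu Lu1 Lu2 _ _] _] := hu.
split.
  apply: (approx_ibp oO (or_introl erefl) Lu Lu1 LP LP1 w1) => eps e0.
  by have [phi [t1 t2 a1 a2 a3]] := H10_approx e0 hu; exists phi; split;
    [exact: t1|exact: t2|exact: a1|exact: a2].
apply: (approx_ibp oO (or_intror erefl) Lu Lu2 LP LP2 w2) => eps e0.
by have [phi [t1 t2 a1 a2 a3]] := H10_approx e0 hu; exists phi; split;
  [exact: t1|exact: t2|exact: a1|exact: a3].
Qed.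

(** [P - Q] and [P' - Q'] come from integrating the gradient of [w - v] by parts, the second
    carrying the Cauchy-Riemann factor [j]; in [a (P - Q) + j a (P' - Q')] they cancel since
    [1 + j^2 = 0]. The last premise is the equality of the normal derivatives. *)
Let orthogonality_algebra (K a j P Q P' Q' S Aw Av : R[i]) :
  K != 0 -> j ^+ 2 = -1 -> P - Q = - S -> P' - Q' = - (j * S) ->
  a * P + j * a * P' - K * Aw = a * Q + j * a * Q' - K * Av -> Aw - Av = 0.
Proof.
move=> K0 jj e1_ e2_ e3; apply: (mulfI K0); rewrite mulr0.
have -> : K * (Aw - Av) =
    (a * P + j * a * P') - (a * P + j * a * P' - K * Aw) - K * Av by ring.
rewrite e3.
have -> : a * P + j * a * P' - (a * Q + j * a * Q' - K * Av) - K * Av =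
    a * (P - Q) + j * a * (P' - Q') by ring.
rewrite e1_ e2_.
have -> : a * - S + j * a * - (j * S) = - a * S * (1 + j ^+ 2) by ring.
by rewrite jj subrr mulr0.
Qed.

(* As [hker] is holomorphic off its pole, the terms in [Dw - Dv] cancel. *)
Lemma transmission_orthogonality Omega (k : R) V v w Dv Dw s c (dl : R) :
  open Omega -> bounded_set Omega -> 0 < k -> Linfty (mu2 R) Omega V ->
  transmission_eigenfunctions Omega k V v w Dv Dw -> 0 < dl ->
  (forall x, Omega x -> dl <= normc (1 + s%:C * zrel c x)) ->
  L2 (mu2 R) Omega (fun x => (1 + V x) * w x) /\
  Cintegral (mu2 R) Omega (fun x => ((1 + V x) * w x - v x) * hker s c 6 x) = 0.
Proof.
move=> oO bO k0 [mV [MV hMV]] [[Hv Hw] [_ [_ [_ [hu hN]]]]] d0 hd.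
have mO := open_measurable2 oO.
have [Lv Lv1 Lv2 _ _] := Hv; have [Lw Lw1 Lw2 _ _] := Hw.
have Lq : L2 (mu2 R) Omega (fun x => (1 + V x) * w x).
  rewrite (_ : (fun x => _) = (fun x => w x + V x * w x)).
    by apply: L2D => //; exact: (L2_bddM mO mV hMV Lw).
  by apply/funext => x; rewrite mulrDl mul1r.
split => //.
(* [H1_hker n] concerns the exponent [n + 1]. Exponent 6 is the test function in the Neumann
   condition; exponent 7, its derivative up to a constant, is paired with the gradient of [w - v],
   and integration by parts produces exponent 8. *)
have H5 := H1_hker 5 oO bO d0 hd; have H6 := H1_hker 6 oO bO d0 hd.
have L6 := L2_hker 6 oO bO d0 hd; have L7 := L2_hker 7 oO bO d0 hd.
have L8 := L2_hker 8 oO bO d0 hd.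
have [ib1 ib2] := H10_ibp oO hu H6.
have := hN _ _ H5; rewrite /normal_derivative /cdot /=.
set K := (k ^+ 2)%:C.
have K0 : K != 0 by rewrite /K eq_complex /= negb_and sqrf_eq0 gt_eqF.
set a := - 6%:R * s%:C.
have I m (f : R * R -> R[i]) : L2 (mu2 R) Omega f ->
    Cintegrable (mu2 R) Omega (fun x => f x * hker s c m x).
  by move=> Lf; apply: L2M_Cintegrable => //; exact: (L2_hker m oO bO d0 hd).
have expand (D1 D2 f : R * R -> R[i]) : L2 (mu2 R) Omega D1 -> L2 (mu2 R) Omega D2 ->
    L2 (mu2 R) Omega f ->
    Cintegral (mu2 R) Omega (fun x => D1 x * (a * hker s c 7 x) +
      D2 x * ('i * (a * hker s c 7 x)) + - (K * f x) * hker s c 6 x) =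
    a * Cintegral (mu2 R) Omega (fun x => D1 x * hker s c 7 x) +
    'i * a * Cintegral (mu2 R) Omega (fun x => D2 x * hker s c 7 x) -
    K * Cintegral (mu2 R) Omega (fun x => f x * hker s c 6 x).
  move=> l1 l2_ lf.
  rewrite -!CintegralZ//; try exact: I.
  rewrite -CintegralD//; try (apply: CintegrableZ => //; exact: I).
  rewrite -CintegralB//; try (apply: CintegrableZ => //; exact: I).
    by apply: eq_Cintegral => x _; ring.
  by apply: CintegrableD => //; apply: CintegrableZ => //; exact: I.
have -> : (fun x => (Dw x).1 * (a * hker s c 7 x) + (Dw x).2 * ('i * (a * hker s c 7 x)) +
     - (K * (1 + V x) * w x) * hker s c 6 x) = (fun x => (Dw x).1 * (a * hker s c 7 x) +
      (Dw x).2 * ('i * (a * hker s c 7 x)) + - (K * ((1 + V x) * w x)) * hker s c 6 x).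
  by apply/funext => x; rewrite mulrA.
rewrite (expand _ _ _ Lw1 Lw2 Lq) (expand _ _ _ Lv1 Lv2 Lv).
move: ib1 ib2 => /=.
under eq_Cintegral do rewrite mulrBl.
rewrite CintegralB//; try exact: I.
move=> ib1.
under eq_Cintegral do rewrite mulrBl.
rewrite CintegralB//; try exact: I.
move=> ib2.
have X : Cintegral (mu2 R) Omega (fun x => (w x - v x) * ('i * (- 7%:R * s%:C * hker s c 8 x))) =
    'i * Cintegral (mu2 R) Omega (fun x => (w x - v x) * (- 7%:R * s%:C * hker s c 8 x)).
  rewrite -CintegralZ//; first by apply: eq_Cintegral => x _; ring.
  exact: (L2M_Cintegrable mO (L2B mO Lw Lv) (L2Z _ mO L8)).
move: ib2; rewrite X => ib2.
rewrite (_ : (fun x => ((1 + V x) * w x - v x) * hker s c 6 x) =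
  (fun x => ((1 + V x) * w x) * hker s c 6 x - v x * hker s c 6 x)); last first.
  by apply/funext => x; rewrite mulrBl.
rewrite CintegralB//; try exact: I.
have ii : ('i : R[i]) ^+ 2 = -1 by exact: sqr_i.
by move=> h; exact: (orthogonality_algebra K0 ii ib1 ib2 h).
Qed.

End H10_calculus.

(** * Poincare's inequality on horizontal segments *)

Section poincare.
Context {R : realType}.
Local Notation T2 := (measurableTypeR R * measurableTypeR R)%type.
Local Notation leb := (@lebesgue_measure R).
Implicit Types (Omega : set (R * R)) (a b c d : R).

(** [F x] is the integral of [f] from [a] to [x], hence bounded by the total integral of the
    modulus; integrating this constant gives the length. *)
Let poincare_line (f F : R -> R) a b : a <= b -> continuous f ->
  (forall x, is_derive x (1 : R) F (f x)) -> F a = 0 ->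
  (\int[leb]_(x in `[a, b]) `|F x|%:E <=
   (b - a)%:E * \int[leb]_(x in `[a, b]) `|f x|%:E)%E.
Proof.
move=> ab cf dF Fa.
have cF : continuous F.
  by move=> x; apply/differentiable_continuous/derivable1_diffP; have [] := dF x.
have mf : measurable_fun setT (f : measurableTypeR R -> measurableTypeR R).
  exact: continuous_measurable_fun.
have mF : measurable_fun setT (F : measurableTypeR R -> measurableTypeR R).
  exact: continuous_measurable_fun.
have mnf D : measurable_fun D (fun x : measurableTypeR R => `|f x|%:E).
  by apply/measurable_EFinP; apply: measurableT_comp => //; exact: measurable_funTS.
have mnF D : measurable_fun D (fun x : measurableTypeR R => `|F x|%:E).
  by apply/measurable_EFinP; apply: measurableT_comp => //; exact: measurable_funTS.
pose g := (\int[leb]_(x in `[a, b]) `|f x|%:E)%E.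
have Fg x : `[a, b]%classic x -> (`|F x|%:E <= g)%E.
  rewrite /= in_itv/= => /andP[ax xb].
  have := FTC2_is_derive ax cf dF; rewrite Fa subr0 => E.
  have -> : (`|F x|%:E = `|\int[leb]_(u in `[a, x]) (f u)%:E|)%E by rewrite E.
  apply: le_trans (le_abse_integral _ _ _) _ => //.
    by apply/measurable_EFinP; exact: measurable_funTS.
  apply: ge0_subset_integral => //.
  by apply: subset_itvl; rewrite bnd_simp.
apply: (@le_trans _ _ (\int[leb]_(x in `[a, b]) g)%E).
  by apply: ge0_le_integral.
have Ec (r : \bar R) : (\int[leb]_(x in `[a, b]) r = r * (b - a)%:E)%E.
  have hm : leb `[a, b]%classic = (b - a)%:E.
    rewrite lebesgue_measure_itv/= lte_fin; case: ltgtP ab => // -> _.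
    by rewrite subrr.
  by rewrite -hm; exact: integral_cst.
by rewrite Ec muleC.
Qed.

(** On each horizontal segment of the box a test function vanishes at the left end, which lies
    outside [Omega], so it is the integral of its derivative; Tonelli sums over the heights. *)
Lemma poincare_test Omega phi a b c d : a <= b -> test_function Omega phi ->
  (forall y, c <= y <= d -> ~ Omega (a, y)) ->
  Rintegral (mu2 R) (box a b c d) (fun x => `|phi x|) <=
  (b - a) * Rintegral (mu2 R) (box a b c d) (fun x => `|'D_(e1 R) phi x|).
Proof.
move=> ab hphi hO.
have [K [cK clK KO [cphi cd dphi phi0 dphi0]]] :=
  test_functionP (or_introl erefl : axis (e1 R)) hphi.
have mB := measurable_box a b c d.
have cn : continuous (fun x => `|phi x|).
  by move=> x; apply: cvg_norm; exact: cphi.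
have cdn : continuous (fun x => `|'D_(e1 R) phi x|).
  by move=> x; apply: cvg_norm; exact: cd.
have i1 := integrable_compact_support mB cn cK (fun x nK => etrans (congr1 _ (phi0 x nK)) (normr0 _)).
have i2 := integrable_compact_support mB cdn cK (fun x nK => etrans (congr1 _ (dphi0 x nK)) (normr0 _)).
rewrite -lee_fin EFinM /Rintegral !fineK; [|exact: integrable_fin_num..].
have m1 : measurable_fun setT ((fun x : T2 => `|phi x|%:E) \_ (box a b c d : set T2)).
  exact: ((measurable_restrictT _ mB).1 (measurable_int _ i1)).
have m2 : measurable_fun setT ((fun x : T2 => `|'D_(e1 R) phi x|%:E) \_ (box a b c d : set T2)).
  exact: ((measurable_restrictT _ mB).1 (measurable_int _ i2)).
rewrite integral_mkcond [in leRHS]integral_mkcond.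
have p1 (x : T2) : (0 <= ((fun x : T2 => `|phi x|%:E) \_ (box a b c d : set T2)) x)%E.
  by rewrite patchE; case: ifP => // _; rewrite lee_fin.
have p2 (x : T2) : (0 <= ((fun x : T2 => `|'D_(e1 R) phi x|%:E) \_ (box a b c d : set T2)) x)%E.
  by rewrite patchE; case: ifP => // _; rewrite lee_fin.
rewrite (mu2_tonelli m1 p1) (mu2_tonelli m2 p2).
have mG : measurable_fun setT (fun y => \int[leb]_x
    ((fun x : T2 => `|'D_(e1 R) phi x|%:E) \_ (box a b c d : set T2)) (x, y))%E.
  exact: (measurable_fun_fubini_tonelli_G (m1 := leb) _ m2 p2).
have mF : measurable_fun setT (fun y => \int[leb]_x
    ((fun x : T2 => `|phi x|%:E) \_ (box a b c d : set T2)) (x, y))%E.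
  exact: (measurable_fun_fubini_tonelli_G (m1 := leb) _ m1 p1).
rewrite -ge0_integralZl//; last 2 first.
- by move=> y _; apply: integral_ge0 => x _.
- by rewrite lee_fin subr_ge0.
apply: ge0_le_integral => //.
- by move=> y _; apply: integral_ge0 => x _.
- exact: measurable_funeM.
move=> y _.
(* Lines that miss the box contribute 0 on the left-hand side. *)
have [ycd|ycd] := boolP (c <= y <= d); last first.
  rewrite integral0_eq; last first.
    move=> x _; rewrite patchE ifF//; apply/negP; rewrite inE => /boxP[/= _ _ h1 h2].
    by move: ycd; rewrite h1 h2.
  by rewrite mule_ge0// ?lee_fin ?subr_ge0//; apply: integral_ge0 => x _.
have E (h : R * R -> R) : (\int[leb]_x ((fun x : T2 => `|h x|%:E) \_ (box a b c d : set T2)) (x, y) =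
    \int[leb]_(x in `[a, b]) `|h (x, y)|%:E)%E.
  rewrite [RHS]integral_mkcond; apply: eq_integral => x _; rewrite !patchE.
  have -> : ((x, y) \in (box a b c d : set T2)) = (x \in `[a, b]%classic); last by [].
  apply/idP/idP; rewrite !inE.
    by move/boxP => [/= h1 h2 _ _]; rewrite /= in_itv/= h1 h2.
  rewrite /= in_itv/= => /andP[h1 h2]; case/andP: ycd => h3 h4.
  exact/boxP.
rewrite !E; apply: (@poincare_line (fun x => 'D_(e1 R) phi (x, y)) (fun x => phi (x, y))).
- exact: ab.
- exact: (@continuous_line1 _ (fun x => 'D_(e1 R) phi x)).
- by move=> x; exact: (is_derive_e1 phi (x, y) _).1.
- by apply: phi0 => /KO; exact: hO.
Qed.

Lemma Rintegral_setI_support (A B : set (R * R)) (f : R * R -> R) :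
  (forall x, ~ B x -> f x = 0) ->
  Rintegral (mu2 R) (A `&` B) f = Rintegral (mu2 R) A f.
Proof.
move=> f0; rewrite Rintegral_mkcondr; apply: eq_Rintegral => x _.
by rewrite patchE; case: ifPn => // /negP nB; rewrite f0// => Bx; apply: nB; rewrite inE.
Qed.

(** Passage from test functions to the limit: on a set of finite measure closeness in L2 gives
    closeness in L1. The factor 2 comes from applying the real inequality to both components. *)
Lemma poincare_H10 Omega u Du a b c d : open Omega -> a <= b ->
  H10 Omega u Du -> (forall y, c <= y <= d -> ~ Omega (a, y)) ->
  Rintegral (mu2 R) (box a b c d `&` Omega) (fun x => normc (u x)) <=
  2 * (b - a) * Rintegral (mu2 R) (box a b c d `&` Omega) (fun x => normc (Du x).1).
Proof.
move=> oO ab hu hO; set D := box a b c d `&` Omega.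
have mO := open_measurable2 oO.
have mD : measurable (D : set T2) by apply: measurableI => //; exact: measurable_box.
have Dfin : (mu2 R D < +oo)%E.
  apply: le_lt_trans (mu2_box_lty a b c d).
  by apply: le_measure; rewrite ?inE//; [exact: measurable_box|exact: subIsetl].
have [[Lu Lu1 _ _ _] _] := hu.
have DO : D `<=` Omega by exact: subIsetr.
have [iu _] := L1_le_L2 mD Dfin (L2S mD mO DO Lu).
have [iu1 _] := L1_le_L2 mD Dfin (L2S mD mO DO Lu1).
apply/ler_addgt0Pr => eps eps0.
set m := Num.sqrt (fine (mu2 R D)); have m0 : 0 <= m by exact: sqrtr_ge0.
have ba : 0 <= b - a by rewrite subr_ge0.
(* Replacing [u] by a test function costs [dl * m], replacing its derivative [2 (b - a) dl m]. *)
pose M := (1 + 2 * (b - a)) * m.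
have M0 : 0 <= M by rewrite mulr_ge0// addr_ge0// mulr_ge0.
have d0 : 0 < eps / (M + 1) by rewrite divr_gt0// ltr_wpDl.
set dl := eps / (M + 1) in d0.
have [phi [tr ti a1 a2 _]] := H10_approx d0 hu.
have [Lphi Ldphi] := test_function_L2 mO (or_introl erefl : axis (e1 R)) tr ti.
have sm f : L2 (mu2 R) Omega f -> (sqL2norm (mu2 R) Omega f <= (dl ^+ 2)%:E)%E ->
    Cintegrable (mu2 R) D f /\ Rintegral (mu2 R) D (fun x => normc (f x)) <= dl * m.
  move=> Lf fd; have LfD := L2S mD mO DO Lf.
  have [i1 e1_] := L1_le_L2 mD Dfin LfD; split => //.
  apply: le_trans e1_ _; rewrite ler_wpM2r//.
  apply: le_trans (l2_le mO Lf (ltW d0) fd); rewrite ler_wsqrtr//.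
  by apply: le_Rintegral_subset => //; [exact: L2_integrable|move=> x _; exact: sqr_ge0].
have [j1 b1] := sm _ (L2B mO Lu Lphi) a1.
have [j2 b2] := sm _ (L2B mO Lu1 Ldphi) a2.
have [jp _] := L1_le_L2 mD Dfin (L2S mD mO DO Lphi).
have [jd _] := L1_le_L2 mD Dfin (L2S mD mO DO Ldphi).
have nI f : Cintegrable (mu2 R) D f ->
    (mu2 R).-integrable D (EFin \o (fun x => normc (f x))) by exact: integrable_normc.
have rI f : Cintegrable (mu2 R) D f ->
    (mu2 R).-integrable D (EFin \o (fun x => `|cRe (f x)|)).
  by move=> [h _]; exact: (integrable_norm h).
have iI f : Cintegrable (mu2 R) D f ->
    (mu2 R).-integrable D (EFin \o (fun x => `|cIm (f x)|)).
  by move=> [_ h]; exact: (integrable_norm h).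
have P (h : R * R -> R) : test_function Omega h ->
    Rintegral (mu2 R) D (fun x => `|h x|) <=
    (b - a) * Rintegral (mu2 R) D (fun x => `|'D_(e1 R) h x|).
  move=> th; have := poincare_test ab th hO.
  have [K [_ _ KO [_ _ _ h0 dh0]]] := test_functionP (or_introl erefl : axis (e1 R)) th.
  have hz1 x : ~ Omega x -> `|h x| = 0 by move=> nO; rewrite h0 ?normr0// => /KO.
  have hz2 x : ~ Omega x -> `|'D_(e1 R) h x| = 0.
    by move=> nO; rewrite dh0 ?normr0// => /KO.
  by rewrite /D (Rintegral_setI_support _ hz1) (Rintegral_setI_support _ hz2).
have Pphi : Rintegral (mu2 R) D (fun x => normc (phi x)) <=
    2 * (b - a) * Rintegral (mu2 R) D (fun x => normc (Cpartial (e1 R) phi x)).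
  apply: (@le_trans _ _ (Rintegral (mu2 R) D (fun x => `|cRe (phi x)| + `|cIm (phi x)|))).
    apply: le_Rintegral => //; first exact: nI.
      exact: (integrableD mD (rI _ jp) (iI _ jp)).
    by move=> x _; exact: normc_le_ReIm.
  rewrite RintegralD//; [|exact: rI|exact: iI].
  apply: le_trans (lerD (P _ tr) (P _ ti)) _.
  rewrite -mulrDr (mulrC 2) -mulrA ler_wpM2l// mulr_natl mulr2n; apply: lerD.
    apply: le_Rintegral => //; [exact: (rI _ jd)|exact: nI|].
    by move=> x _; exact: (normr_Re_le (Cpartial (e1 R) phi x)).
  apply: le_Rintegral => //; [exact: (iI _ jd)|exact: nI|].
  by move=> x _; exact: (normr_Im_le (Cpartial (e1 R) phi x)).
have tri (f g : R * R -> R[i]) : Cintegrable (mu2 R) D f -> Cintegrable (mu2 R) D g ->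
    Cintegrable (mu2 R) D (fun x => f x - g x) ->
    Rintegral (mu2 R) D (fun x => normc (f x)) <=
    Rintegral (mu2 R) D (fun x => normc (f x - g x)) + Rintegral (mu2 R) D (fun x => normc (g x)).
  move=> cf cg cfg; rewrite -RintegralD//; [|exact: nI..].
  apply: le_Rintegral => //; first exact: nI.
    exact: (integrableD mD (nI _ cfg) (nI _ cg)).
  by move=> x _; have := le_normcD (f x - g x) (g x); rewrite subrK.
have t1 := tri _ _ iu jp j1.
have t2 : Rintegral (mu2 R) D (fun x => normc (Cpartial (e1 R) phi x)) <=
    dl * m + Rintegral (mu2 R) D (fun x => normc (Du x).1).
  have jd2 : Cintegrable (mu2 R) D (fun x => Cpartial (e1 R) phi x - (Du x).1) by exact: CintegrableB.
  apply: le_trans (tri _ _ jd iu1 jd2) _; rewrite lerD2r; apply: le_trans b2.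
  by rewrite le_eqVlt; apply/orP; left; apply/eqP; apply: eq_Rintegral => x _; exact: normcB.
have h1 := ler_wpM2l (mulr_ge0 (ler0n R 2) ba) t2.
have h2 : dl * M <= eps.
  rewrite /dl mulrAC ler_pdivrMr ?ltr_wpDl// ler_wpM2l ?(ltW eps0)//; lra.
move: h1 h2 Pphi t1 b1; rewrite /M.
set I1 := Rintegral _ _ _; set I2 := Rintegral _ _ _; set I3 := Rintegral _ _ _.
set I4 := Rintegral _ _ _; set I5 := Rintegral _ _ _ => *.
nra.
Qed.

End poincare.

(** * Herglotz functions *)

Section herglotz.
Context {R : realType}.
Local Notation T2 := (measurableTypeR R * measurableTypeR R)%type.
Local Notation leb := (@lebesgue_measure R).

Lemma lipschitz1_of_derive (f df : R -> R) (a b : R) :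
  (forall x, is_derive x (1 : R) f (df x)) -> (forall x, `|df x| <= 1) ->
  `|f a - f b| <= `|a - b|.
Proof.
move=> hf hdf.
have cf : continuous f.
  by move=> x; apply/differentiable_continuous/derivable1_diffP; have [] := hf x.
have key (u v : R) : u <= v -> `|f v - f u| <= `|v - u|.
  move=> uv; have [w _ ->] := @MVT_segment _ f df u v uv (fun x _ => hf x) (continuous_subspaceT cf).
  by rewrite normrM ler_piMl.
have [ab|ba] := leP a b; last exact: key (ltW ba).
by rewrite distrC [leRHS]distrC; exact: key.
Qed.

Lemma normc_expiB (a b : R) : normc (expi a - expi b) <= 2 * `|a - b|.
Proof.
apply: le_trans (normc_le_ReIm _) _; rewrite /expi /= mulr_natl mulr2n; apply: lerD.
  apply: (@lipschitz1_of_derive cos (fun x => - sin x)) => x.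
  by rewrite normrN ler_norml sin_geN1 sin_le1.
apply: (@lipschitz1_of_derive sin cos) => x.
by rewrite ler_norml cos_geN1 cos_le1.
Qed.

Lemma normc_expi (a : R) : normc (expi a) = 1.
Proof. by rewrite normcE2 /= cos2Dsin2 sqrtr1. Qed.

Lemma circle_dot_le (t : R) (x : R * R) :
  `|cos t * x.1 + sin t * x.2| <= edist x (0, 0).
Proof.
rewrite -(ler_pXn2r (n:=2))// ?nnegrE ?eudist_ge0// sqr_edist /= !subr0.
rewrite real_normK ?num_real//.
have -> : x.1 ^+ 2 + x.2 ^+ 2 = (cos t ^+ 2 + sin t ^+ 2) * (x.1 ^+ 2 + x.2 ^+ 2).
  by rewrite cos2Dsin2 mul1r.
have := sqr_ge0 (cos t * x.2 - sin t * x.1); lra.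
Qed.

Lemma Cmeasurable_herglotz_integrand (k : R) (g : R * R -> R[i]) x : L2circle g ->
  Cmeasurable (`[0, 2 * pi]%classic : set (measurableTypeR R))
   (fun t : measurableTypeR R => let xi := circle_pt (t : R) in
       expi (k * (xi.1 * x.1 + xi.2 * x.2)) * g xi).
Proof.
move=> [mg _]; apply: CmeasurableM; last exact: mg.
have ca : continuous (fun t : R => k * (cos t * x.1 + sin t * x.2)).
  move=> t; apply: cvgMl_tmp; apply: cvgD; apply: cvgMr_tmp.
    exact: continuous_cos.
  exact: continuous_sin.
split; apply: measurable_funTS; apply: continuous_measurable_fun => t.
  by apply: (@continuous_comp _ _ _ (fun t : R => k * (cos t * x.1 + sin t * x.2)) cos);
    [exact: ca|exact: continuous_cos].
by apply: (@continuous_comp _ _ _ (fun t : R => k * (cos t * x.1 + sin t * x.2)) sin);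
  [exact: ca|exact: continuous_sin].
Qed.

(** For each direction of the circle the phase is [k]-Lipschitz in [x]. One factor 2 of the constant
    is due to [normc_expiB], the other to [normc_Cintegral_le], and [sqrt (2 pi)] to bounding the L1
    norm on the circle by the L2 norm. *)
Lemma herglotz_lipschitz (k M : R) (g : R * R -> R[i]) x y : 0 < k -> 0 <= M ->
  L2circle g -> (L2circle_norm g <= M%:E)%E ->
  normc (herglotz k g x - herglotz k g y) <=
    4 * k * Num.sqrt (2 * pi) * M * edist x y.
Proof.
move=> k0 M0 Lg hM.
set D : set (measurableTypeR R) := `[0, 2 * pi]%classic.
have mD : measurable D by exact: measurable_itv.
have tp : 0 < 2 * pi :> R by rewrite mulr_gt0// pi_gt0.
have mDE : leb D = (2 * pi)%:E.
  by rewrite /D lebesgue_measure_itv/= lte_fin tp sube0.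
have Dfin : (leb D < +oo)%E by rewrite mDE ltry.
have [ig hg] := L1_le_L2 mD Dfin Lg.
have sM : Num.sqrt (l2 leb D (circle_fun g)) <= M.
  by apply: (l2_le mD Lg M0); apply: poweR_half_le => //; exact: sqL2norm_ge0.
have m1 z := Cmeasurable_herglotz_integrand k z Lg.
set F := fun (z : R * R) (t : measurableTypeR R) =>
  expi (k * ((circle_pt (t : R)).1 * z.1 + (circle_pt (t : R)).2 * z.2)) * g (circle_pt (t : R)).
have iF z : Cintegrable leb D (F z).
  apply: (le_Cintegrable mD (m1 z) (integrable_normc mD ig)) => t _.
  by rewrite normcM normc_expi mul1r.
rewrite /herglotz -(CintegralB mD (iF x) (iF y)).
have iFF := CintegrableB mD (iF x) (iF y).
apply: le_trans (normc_Cintegral_le mD iFF) _.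
have e0 : 0 <= edist x y by exact: eudist_ge0.
have := @le_Rintegral _ _ _ leb D (fun t => normc (F x t - F y t))
  (fun t => 2 * k * edist x y * normc (circle_fun g t)) mD (integrable_normc mD iFF)
  (integrableZl mD (2 * k * edist x y) (integrable_normc mD ig)).
rewrite (RintegralZl _ mD (integrable_normc mD ig)) => h.
have {}h : Rintegral leb D (fun t => normc (F x t - F y t)) <=
    2 * k * edist x y * Rintegral leb D (fun t => normc (circle_fun g t)).
  apply: h => t _; rewrite /F -mulrBl normcM ler_wpM2r ?normc_ge0//.
  apply: le_trans (normc_expiB _ _) _; rewrite -mulrBr normrM (gtr0_norm k0).
  rewrite -!mulrA ler_pM2l// ler_pM2l//.
  have := circle_dot_le t (x - y).
  rewrite /circle_pt /edist /= !subr0; apply: le_trans.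
  by rewrite le_eqVlt; apply/orP; left; apply/eqP; congr `|_|; ring.
apply: le_trans (ler_wpM2l (ler0n R 2) h) _.
have c0 : 0 <= 2 * k * edist x y by rewrite !mulr_ge0// ltW.
have hg' : Rintegral leb D (fun t => normc (circle_fun g t)) <= M * Num.sqrt (2 * pi).
  have E2 : Num.sqrt (fine (leb D)) = Num.sqrt (2 * pi) by rewrite mDE.
  by apply: le_trans hg _; rewrite -E2; exact: (ler_wpM2r (sqrtr_ge0 _) sM).
apply: le_trans (ler_wpM2l (ler0n R 2) (ler_wpM2l c0 hg')) _.
by rewrite le_eqVlt; apply/orP; left; apply/eqP; ring.
Qed.

End herglotz.

(** * Boxes shrinking to the vertex *)

Section shrinking.
Context {R : realType}.
Local Notation T2 := (measurableTypeR R * measurableTypeR R)%type.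

(** The left edge is at distance [B rho] because points of the cone with [|x2 - c2| <= rho] satisfy
    [x1 - c1 > -B rho]: the edge misses the sector, while the box contains the part of the sector in
    the ball of radius [rho]. *)
Definition corner_box (B : R) (c : R * R) (rho : R) : set (R * R) :=
  box (c.1 - B * rho) (c.1 + rho) (c.2 - rho) (c.2 + rho).

Lemma corner_box_sub (B : R) c (r1 r2 : R) : 0 < B -> r1 <= r2 ->
  corner_box B c r1 `<=` corner_box B c r2.
Proof.
move=> B0 r12 x /boxP[h1 h2 h3 h4]; apply/boxP.
have Br : B * r1 <= B * r2 by rewrite ler_pM2l.
by split; lra.
Qed.

(** Absolute continuity of the integral: the boxes shrink to the null set [{c}], so dominated
    convergence with majorant [f] applies along [rho = 1/(n+1)], and monotonicity covers the other
    radii. *)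
Lemma integral_corner_box_small (D : set (R * R)) (B : R) c (f : R * R -> R) (eps : R) :
  0 < B -> measurable (D : set T2) -> (mu2 R).-integrable D (EFin \o f) ->
  (forall x, 0 <= f x) -> 0 < eps ->
  exists2 d : R, 0 < d & forall rho, 0 < rho -> rho <= d ->
    Rintegral (mu2 R) (D `&` corner_box B c rho) f <= eps.
Proof.
move=> B0 mD iF f0 eps0.
have mB rho : measurable (corner_box B c rho : set T2) by exact: measurable_box.
have mf := measurable_int _ iF.
pose fn n := (EFin \o f) \_ (corner_box B c (n.+1%:R^-1) : set T2).
have mc : (mu2 R).-negligible [set c].
  exists [set c]; split => //.
    have -> : [set c] = ([set c.1] `*` [set c.2] : set T2).
      apply/seteqP; split => [x -> //|[a b] /= [-> ->]].
      by rewrite -surjective_pairing.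
    by apply: measurableX; exact: measurable_set1.
  have -> : [set c] = ([set c.1] `*` [set c.2] : set T2).
    apply/seteqP; split => [x -> //|[a b] /= [-> ->]].
    by rewrite -surjective_pairing.
  by rewrite mu2E ?lebesgue_measure_set1 ?mul0e//; exact: measurable_set1.
have [] := @dominated_convergence _ _ _ (mu2 R) D mD fn (cst 0%E) (EFin \o f).
- move=> n; apply/(measurable_restrict _ (mB _) mD).
  by apply: measurable_funS mf => //; exact: subIsetl.
- exact: measurable_cst.
- apply: negligibleS mc => x /= h; apply/eqP; apply: contrapT => /eqP xc.
  apply: h => Dx; apply: cvg_near_cst.
  (* If the abscissas differ, [|x1 - c1|] exceeds both [rho] and [B rho] for [rho] below
     [|x1 - c1| / (1 + B)]; otherwise the ordinates differ. *)
  have [e e0 he] : exists2 e : R, 0 < e & forall rho, rho < e -> ~ corner_box B c rho x.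
    have [x1|x1] := eqVneq x.1 c.1.
      have x2 : 0 < `|x.2 - c.2|.
        rewrite normr_gt0 subr_eq0; apply: contraNneq xc => x2.
        by apply/eqP/eqP; rewrite (surjective_pairing x) (surjective_pairing c) x1 x2.
      exists `|x.2 - c.2| => // rho hr /boxP[_ _ h3 h4].
      by move: hr; rewrite ltNge ler_norml => /negP; apply; apply/andP; split; lra.
    have x1' : 0 < `|x.1 - c.1| by rewrite normr_gt0 subr_eq0.
    exists (`|x.1 - c.1| / (1 + B)); first by rewrite divr_gt0// addr_gt0.
    move=> rho; rewrite ltr_pdivlMr ?addr_gt0// => hr /boxP[h1 h2 h3 h4].
    have r0 : 0 <= rho by lra.
    have Br : 0 <= B * rho by rewrite mulr_ge0// ltW.
    by move: hr; rewrite ltNge ler_norml => /negP; apply; apply/andP; split; lra.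
  have := near_infty_natSinv_lt (PosNum e0); apply: filterS => n /= hn.
  by rewrite /fn patchE ifF//; apply/negP; rewrite inE; exact: he.
- exact: iF.
- apply: aeW => x n Dx /=; rewrite /fn patchE.
  by case: ifP => _ /=; rewrite ?normr0 lee_fin// ger0_norm.
move=> _ _; rewrite integral0 => cv.
have : \forall n \near \oo, (\int[mu2 R]_(x in D) fn n x < eps%:E)%E.
  apply: (cv [set y | (y < eps%:E)%E]); exists eps => //= r.
  by rewrite /ball_ /= sub0r normrN lte_fin; exact: le_lt_trans (ler_norm _).
move=> [n _ /(_ n (leqnn n))] /= hn.
have n0 : 0 < n.+1%:R^-1 :> R by rewrite invr_gt0.
exists (n.+1%:R^-1) => // rho rho0 hrho.
have mI r : measurable (D `&` corner_box B c r : set T2) by exact: measurableI.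
have iI r : (mu2 R).-integrable (D `&` corner_box B c r) (EFin \o f).
  by apply: integrableS iF => //; exact: subIsetl.
apply: (@le_trans _ _ (Rintegral (mu2 R) (D `&` corner_box B c n.+1%:R^-1) f)).
  apply: le_Rintegral_subset => //.
  by move=> x [Dx xb]; split => //; apply: corner_box_sub hrho _ xb.
rewrite -lee_fin /Rintegral fineK; last exact: integrable_fin_num.
by rewrite integral_mkcondr; exact: ltW.
Qed.

End shrinking.

(** * Estimates at the corner *)

Lemma ge0_le_integrable {R : realType} d {T : measurableType d}
    (mu : {measure set T -> \bar R}) (D : set T) (f g : T -> R) :
  measurable D -> measurable_fun D (f : T -> measurableTypeR R) ->
  mu.-integrable D (EFin \o g) ->
  (forall x, D x -> 0 <= f x) -> (forall x, D x -> f x <= g x) ->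
  mu.-integrable D (EFin \o f).
Proof.
move=> mD mf ig f0 fg; apply: (le_integrable mD) ig; first exact/measurable_EFinP.
move=> x Dx /=; rewrite lee_fin (ger0_norm (f0 x Dx)).
exact: le_trans (fg x Dx) (ler_norm _).
Qed.

Lemma integrable_cst_lty {R : realType} d {T : measurableType d}
    (mu : {measure set T -> \bar R}) (D : set T) (k : R) :
  measurable D -> (mu D < +oo)%E -> mu.-integrable D (EFin \o (fun=> k)).
Proof.
move=> mD Dfin; apply: measurable_bounded_integrable => //.
exists `|k|; split; first exact: num_real.
by move=> N kN x Dx /=; exact: ltW.
Qed.

Section kernel_integrals.
Context {R : realType}.
Local Notation T2 := (measurableTypeR R * measurableTypeR R)%type.

Lemma continuous_edist (c : R * R) : continuous (fun x : R * R => edist x c).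
Proof.
move=> x; apply: (@continuous_comp _ _ _
  (fun x : R * R => (x.1 - c.1) ^+ 2 + (x.2 - c.2) ^+ 2) Num.sqrt); last exact: sqrt_continuous.
apply: cvgD; under eq_fun do rewrite expr2.
  by rewrite expr2; apply: cvgM; (apply: cvgB; [exact: continuous_fst2|exact: cvg_cst]).
by rewrite expr2; apply: cvgM; (apply: cvgB; [exact: continuous_snd2|exact: cvg_cst]).
Qed.

Lemma open_eball (c : R * R) r : open (eball c r).
Proof.
rewrite (_ : eball c r = (fun x : R * R => edist x c) @^-1` [set t | t < r])//.
by apply: open_comp; [move=> x _; exact: continuous_edist|exact: open_lt].
Qed.

Lemma measurable_eball (c : R * R) r : measurable (eball c r : set T2).
Proof. exact: open_measurable2 (@open_eball c r). Qed.

Lemma edist_norm1 (x c : R * R) : `|x.1 - c.1| <= edist x c.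
Proof. by rewrite -normc_zrel; exact: (normr_Re_le (zrel c x)). Qed.

Lemma edist_norm2 (x c : R * R) : `|x.2 - c.2| <= edist x c.
Proof. by rewrite -normc_zrel; exact: (normr_Im_le (zrel c x)). Qed.

Lemma edist_le_sum (x c : R * R) : edist x c <= `|x.1 - c.1| + `|x.2 - c.2|.
Proof. by rewrite -normc_zrel; exact: (normc_le_ReIm (zrel c x)). Qed.

Variables (tm tM k0 : R) (c : R * R).
Hypotheses (htm : - pi < tm) (htmM : tm < tM) (htM : tM < pi) (k0p : 0 < k0).
Local Notation W := (sector c tm tM).
Hypothesis hco : forall x s, 0 <= s -> W x -> coercive k0 s c x.

Let mW : measurable (W : set T2). Proof. exact: measurable_sector. Qed.

Lemma moment_hker_sector s al : 0 < s -> 0 <= al -> al <= 1 ->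
  (mu2 R).-integrable W (EFin \o (fun x => edist x c `^ al * normc (hker s c 6 x))) /\
  Rintegral (mu2 R) W (fun x => edist x c `^ al * normc (hker s c 6 x)) <=
    k0 ^- 3 * pi ^+ 2 * s `^ (- al) * s ^- 2.
Proof.
move=> s0 a0 a1.
have [il el] := integrable_lorentz2 c s0.
have ilW := integrableS measurableT mW (@subsetT _ _) il.
have iZ := integrableZl mW (k0 ^- 3 * s `^ (- al)) ilW.
have k3 : 0 <= k0 ^- 3 by rewrite invr_ge0 exprn_ge0// ltW.
have hm x : W x -> edist x c `^ al * normc (hker s c 6 x) <=
    k0 ^- 3 * s `^ (- al) * lorentz2 s c x.
  by move=> Wx; exact: hker_moment k0p s0 a0 a1 (hco (ltW s0) Wx).
have iF : (mu2 R).-integrable W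
    (EFin \o (fun x => edist x c `^ al * normc (hker s c 6 x))).
  apply: (ge0_le_integrable mW _ iZ) => [|x _|]; last exact: hm.
    apply: measurable_funM; last exact: measurable_normc (Cmeasurable_hker _ _ _ _).
    apply: (measurableT_comp (measurable_powR al)).
    exact: (continuous_measurable2 (@continuous_edist c)).
  exact: mulr_ge0 (powR_ge0 _ _) (normc_ge0 _).
split => //.
apply: (@le_trans _ _ (Rintegral (mu2 R) W (fun x => k0 ^- 3 * s `^ (- al) * lorentz2 s c x))).
  by apply: le_Rintegral.
rewrite (RintegralZl _ mW ilW).
have -> : k0 ^- 3 * pi ^+ 2 * s `^ (- al) * s ^- 2 = k0 ^- 3 * s `^ (- al) * (pi / s) ^+ 2.
  by rewrite expr_div_n; ring.
rewrite -el ler_wpM2l ?mulr_ge0 ?powR_ge0//.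
by apply: le_Rintegral_subset => // x _; exact: ltW (lorentz2_gt0 _ _ _).
Qed.

Lemma hker_sector_le s x : 0 < s -> W x -> normc (hker s c 6 x) <= k0 ^- 3.
Proof.
move=> s0 Wx; apply: le_trans (hker_lorentz2 k0p (hco (ltW s0) Wx)) _.
rewrite ler_piMr ?invr_ge0 ?exprn_ge0 ?(ltW k0p)//.
by rewrite /lorentz2 mulr_ile1 ?lorentz_le1 ?(ltW (lorentz_gt0 _)).
Qed.

(** In the square one factor is bounded by its supremum and the other by the Lorentzian. *)
Lemma l2_hker_sector s : 0 < s -> L2 (mu2 R) W (hker s c 6) /\
  Num.sqrt (l2 (mu2 R) W (hker s c 6)) <= k0 ^- 3 * pi / s.
Proof.
move=> s0.
have [il el] := integrable_lorentz2 c s0.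
have ilW := integrableS measurableT mW (@subsetT _ _) il.
have iZ := integrableZl mW (k0 ^- 3 ^+ 2) ilW.
have k3 : 0 <= k0 ^- 3 by rewrite invr_ge0 exprn_ge0// ltW.
have hm x : W x -> normc (hker s c 6 x) ^+ 2 <= k0 ^- 3 ^+ 2 * lorentz2 s c x.
  move=> Wx; rewrite expr2 [k0 ^- 3 ^+ 2]expr2 -mulrA ler_pM ?normc_ge0//.
    exact: hker_sector_le.
  exact: hker_lorentz2 k0p (hco (ltW s0) Wx).
have mk := @Cmeasurable_hker R W s c 6.
have iF : (mu2 R).-integrable W (EFin \o (fun x => normc (hker s c 6 x) ^+ 2)).
  apply: (ge0_le_integrable mW _ iZ) => [|x _|]; last exact: hm.
    by apply: measurable_funX; exact: measurable_normc.
  exact: sqr_ge0.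
split; first exact: integrable_L2.
have p0 : 0 <= k0 ^- 3 * pi / s by rewrite divr_ge0 ?mulr_ge0 ?pi_ge0// ltW.
rewrite -[leRHS]ger0_norm// -sqrtr_sqr ler_wsqrtr//.
apply: (@le_trans _ _ (Rintegral (mu2 R) W (fun x => k0 ^- 3 ^+ 2 * lorentz2 s c x))).
  by apply: le_Rintegral.
rewrite (RintegralZl _ mW ilW).
have -> : (k0 ^- 3 * pi / s) ^+ 2 = k0 ^- 3 ^+ 2 * (pi / s) ^+ 2 by rewrite -mulrA exprMn.
rewrite -el ler_wpM2l ?sqr_ge0//.
by apply: le_Rintegral_subset => // x _; exact: ltW (lorentz2_gt0 _ _ _).
Qed.

(** Markov's inequality with the first moment: outside the ball [1 <= |x - c| / r], which gains a
    power of [s] over the full mass. *)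
Lemma hker_sector_tail s r : 0 < s -> 0 < r ->
  Rintegral (mu2 R) (W `\` eball c r) (fun x => normc (hker s c 6 x)) <=
    k0 ^- 3 * pi ^+ 2 / r * s ^- 3.
Proof.
move=> s0 r0.
have [iF eF] := moment_hker_sector s0 ler01 (lexx 1).
have mD : measurable (W `\` eball c r : set T2) by apply: measurableD => //; exact: measurable_eball.
have iD := integrableS mW mD (@subDsetl _ _ _) iF.
have iK := integrable_normc mW (integrable_hker_sector c htm htmM htM s0).
have iKD := integrableS mW mD (@subDsetl _ _ _) iK.
have F0 x : 0 <= edist x c `^ 1 * normc (hker s c 6 x).
  by rewrite mulr_ge0 ?powR_ge0 ?normc_ge0.
apply: (@le_trans _ _ (Rintegral (mu2 R) (W `\` eball c r)
    (fun x => r^-1 * (edist x c `^ 1 * normc (hker s c 6 x))))).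
  apply: le_Rintegral => //; first exact: (integrableZl mD r^-1 iD).
  move=> x [_ hx]; have rx : r <= edist x c by rewrite leNgt; apply/negP.
  rewrite mulrA; apply: (ler_peMl (normc_ge0 _)).
  by rewrite (powRr1 (eudist_ge0 _ _)) mulrC ler_pdivlMr// mul1r.
rewrite (@RintegralZl _ T2 R (mu2 R) _ _ r^-1 mD iD).
have -> : k0 ^- 3 * pi ^+ 2 / r * s ^- 3 =
    r^-1 * (k0 ^- 3 * pi ^+ 2 * s `^ (- 1) * s ^- 2).
  by rewrite powR_inv1 ?(ltW s0)//; field; rewrite !gt_eqF.
rewrite ler_pM2l ?invr_gt0//; apply: le_trans eF.
by apply: le_Rintegral_subset => //; exact: subDsetl.
Qed.

Lemma sector_ball_measure_ge : tM - tm <> pi ->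
  exists2 c0 : R, 0 < c0 & forall r, 0 < r ->
    ((c0 * r ^+ 2)%:E <= mu2 R (W `&` eball c r))%E.
Proof.
move=> hne; set K := normc (sector_const tm tM).
have K0 : 0 < K by apply: normc_gt0; exact: sector_const_neq0.
set k3 := k0 ^- 3; have k3p : 0 < k3 by rewrite invr_gt0 exprn_gt0.
have p2 : 0 < (pi : R) ^+ 2 by rewrite exprn_gt0// pi_gt0.
(* With [s = A / r] the tail bound equals [K s^-2 / 4]. Since [K s^-2] is at most twice the integral
   of the modulus, a quarter of it is left as a lower bound for [k0^-3] times the measure. *)
pose A := 4 * k3 * pi ^+ 2 / K.
have A0 : 0 < A by apply: divr_gt0 K0; apply: mulr_gt0 p2; apply: mulr_gt0 k3p.
exists (K / (4 * k3 * A ^+ 2)) => [|r r0].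
  by apply: (divr_gt0 K0); apply: (mulr_gt0 _ (exprn_gt0 2 A0)); apply: mulr_gt0 k3p.
pose s := A / r; have s0 : 0 < s by rewrite divr_gt0.
have mE := measurable_eball c r.
have mS : measurable (W `&` eball c r : set T2) by exact: measurableI.
have mD : measurable (W `\` eball c r : set T2) by exact: measurableD.
have iK := integrable_hker_sector c htm htmM htM s0.
have inK := integrable_normc mW iK.
have [mfin|] := boolP (mu2 R (W `&` eball c r) \is a fin_num); last first.
  by rewrite ge0_fin_numE// -leNgt leye_eq => /eqP ->; rewrite leey.
rewrite -(fineK mfin) lee_fin; set m := fine _.
have hI : Rintegral (mu2 R) W (fun x => normc (hker s c 6 x)) <=
    k3 * m + k3 * pi ^+ 2 / r * s ^- 3.
  have E : W = (W `&` eball c r) `|` (W `\` eball c r) by rewrite setUIDK.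
  rewrite {1}E Rintegral_setU//; first last.
  - by rewrite disj_set2E; apply/eqP; apply/seteqP; split => // x [[_ h] [_]].
  - by rewrite -E.
  apply: lerD; last exact: hker_sector_tail.
  rewrite /m -[X in _ <= X](Rintegral_cst (mu2 R) mS k3).
  apply: le_Rintegral => //.
  - by apply: integrableS inK => //; exact: subIsetl.
  - by apply: integrable_cst_lty => //; rewrite -ge0_fin_numE.
  - by move=> x [Wx _]; exact: hker_sector_le.
have := normc_Cintegral_le mW iK.
rewrite (Cintegral_hker_sector c htm htmM htM s0) normcM -/K => h.
have h1 : normc (s%:C ^- 2) = r ^+ 2 / A ^+ 2.
  by rewrite normcV normc_expr normcR (gtr0_norm s0) /s; field; rewrite !gt_eqF.
have h2 : k3 * pi ^+ 2 / r * s ^- 3 = K * (r ^+ 2 / A ^+ 2) / 4.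
  have AK : A * K = 4 * k3 * pi ^+ 2 by rewrite /A divfK// gt_eqF.
  have E4 (a b : R) : a * b = 4 * a * b / 4 by field.
  rewrite (E4 k3) -AK.
  have E5 (a q b : R) : 0 < a -> 0 < q ->
      a * b / 4 / q / (a / q) ^+ 3 = b * (q ^+ 2 / a ^+ 2) / 4.
    by move=> a0 q0; field; rewrite !gt_eqF.
  exact: E5.
rewrite h1 in h; rewrite h2 in hI.
have -> : K / (4 * k3 * A ^+ 2) * r ^+ 2 = (K * (r ^+ 2 / A ^+ 2)) / 4 / k3.
  by field; rewrite !gt_eqF.
rewrite ler_pdivrMr//.
move: h hI; set q := Rintegral _ _ _; set p := K * _; rewrite (mulrC m).
by rewrite (mulrC _ K) -/p => h hI; lra.
Qed.

Lemma sector_ball_sub_box (B r : R) : 0 < B -> 0 < r ->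
  (forall x, W x -> - (B * `|x.2 - c.2|) < x.1 - c.1) ->
  W `&` eball c r `<=` corner_box B c r.
Proof.
move=> B0 r0 hW x [Wx]; rewrite /eball /= => xr.
have h1 := le_lt_trans (edist_norm1 x c) xr.
have h2 := le_lt_trans (edist_norm2 x c) xr.
have h3 := hW _ Wx.
have h4 : B * `|x.2 - c.2| <= B * r by rewrite ler_pM2l// ltW.
move: h1 h2; rewrite !ltr_norml => /andP[a1 a2] /andP[a3 a4].
by apply/boxP; split; lra.
Qed.

End kernel_integrals.

Lemma ae_le_Rintegral {R : realType} d {T : measurableType d}
    (mu : {measure set T -> \bar R}) (D : set T) (f g : T -> R) :
  measurable D -> mu.-integrable D (EFin \o f) -> mu.-integrable D (EFin \o g) ->
  (forall x, 0 <= f x) -> (forall x, 0 <= g x) ->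
  {ae mu, forall x, D x -> f x <= g x} ->
  Rintegral mu D f <= Rintegral mu D g.
Proof.
move=> mD jf jg f0 g0 fg; rewrite /Rintegral fine_le//.
- exact: integrable_fin_num.
- exact: integrable_fin_num.
apply: ae_ge0_le_integral => //.
- by move=> x _; rewrite lee_fin.
- exact: (measurable_int _ jf).
- by move=> x _; rewrite lee_fin.
- exact: (measurable_int _ jg).
Qed.

Section corner.
Context {R : realType}.
Local Notation T2 := (measurableTypeR R * measurableTypeR R)%type.
Variables (tm tM k0 h : R) (c : R * R) (Omega : set (R * R)).
Hypotheses (htm : - pi < tm) (htmM : tm < tM) (htM : tM < pi).
Hypotheses (k0p : 0 < k0) (h0 : 0 < h).
Local Notation W := (sector c tm tM).
Local Notation S := (W `&` eball c h).
Hypothesis hco : forall x s, 0 <= s -> W x -> coercive k0 s c x.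
Hypothesis mO : measurable (Omega : set T2).
Hypothesis hS : Omega `&` eball c h = S.

Let k3 := k0 ^- 3.
Let k3p : 0 < k3. Proof. by rewrite invr_gt0 exprn_gt0. Qed.
Let mW : measurable (W : set T2). Proof. exact: measurable_sector. Qed.
Let mE : measurable (eball c h : set T2). Proof. exact: measurable_eball. Qed.
Let mS : measurable (S : set T2). Proof. exact: measurableI. Qed.

(** The triangle inequality gives [s h - 1], and [s h >= 2] makes this at least half of [s h]. *)
Lemma affine_far s x : 2 / h <= s -> ~ eball c h x ->
  s * h / 2 <= normc (1 + s%:C * zrel c x).
Proof.
rewrite ler_pdivrMr// => hs hx.
have hx' : h <= edist x c by rewrite leNgt; apply/negP.
have s0 : 0 < s by rewrite -(pmulr_lgt0 _ h0); lra.
apply: le_trans (normc_affine_le c x (ltW s0)).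
have : s * h <= s * edist x c by rewrite ler_pM2l.
lra.
Qed.

Lemma hker_far s x : 2 / h <= s -> ~ eball c h x ->
  normc (hker s c 6 x) <= (2 / h) ^+ 6 * s ^- 6.
Proof.
move=> hs hx; have := affine_far hs hx.
have s0 : 0 < s by apply: lt_le_trans hs; rewrite divr_gt0.
have p : 0 < s * h / 2 by rewrite divr_gt0// mulr_gt0.
rewrite /hker normcV normc_expr => H.
have -> : (2 / h) ^+ 6 * s ^- 6 = (s * h / 2) ^- 6 by field; rewrite !gt_eqF.
rewrite lef_pV2 ?posrE; first by rewrite lerXn2r ?nnegrE ?normc_ge0// ltW.
  by rewrite exprn_gt0// (lt_le_trans p).
by rewrite exprn_gt0.
Qed.

(** Inside the ball [Omega] is the sector and coercivity applies; outside, the pole is at distance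
    at least [h / 2]. Hence the kernel has no singularity in [Omega], nor at its boundary. *)
Lemma affine_bounded_below s : k0 <= 1 -> 2 / h <= s ->
  forall x, Omega x -> Num.sqrt k0 <= normc (1 + s%:C * zrel c x).
Proof.
move=> k01 hs x Ox.
have s0 : 0 < s by apply: lt_le_trans hs; rewrite divr_gt0.
have [hx|hx] := pselect (eball c h x).
  have [Wx _] : S x by rewrite -hS.
  have := hco (ltW s0) Wx; rewrite /coercive => H.
  rewrite -[leRHS]ger0_norm ?normc_ge0// -sqrtr_sqr ler_wsqrtr//.
  by apply: le_trans H; rewrite ler_peMr ?(ltW k0p)// lerDl mulr_ge0 ?sqr_ge0.
apply: le_trans (affine_far hs hx).
apply: (@le_trans _ _ 1); first by rewrite -[leRHS]sqrtr1 ler_wsqrtr.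
by rewrite ler_pdivlMr// mul1r -ler_pdivrMr.
Qed.

(** [G] stands for [(1 + V) w - v] and [b] for its approximate value at the vertex. The vanishing
    integral over [Omega] is compared with [b] times the exact sector integral. The errors,
    multiplied by [s^2], come from the deviation [G - b] near the vertex, from [Omega] outside the
    ball and from the tail of the sector. *)
Lemma corner_estimate (G e : R * R -> R[i]) (b : R[i]) (M L dl al s : R) :
  Cintegrable (mu2 R) Omega G -> L2 (mu2 R) S e ->
  Num.sqrt (l2 (mu2 R) S e) <= dl ->
  0 <= M -> 0 <= L -> 0 <= al -> al <= 1 -> 2 / h <= s ->
  {ae mu2 R, forall x, S x ->
    normc (G x - b) <= M * edist x c `^ al + L * edist x c + normc (e x)} ->
  Cintegral (mu2 R) Omega (fun x => G x * hker s c 6 x) = 0 ->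
  normc b * normc (sector_const tm tM) <=
    2 * k3 * pi ^+ 2 * (M * s `^ (- al) + L / s) + 2 * k3 * pi * (dl * s) +
    2 * (2 / h) ^+ 6 * Rintegral (mu2 R) Omega (fun x => normc (G x)) * s ^- 4 +
    normc b * (2 * k3 * pi ^+ 2 / h / s).
Proof.
move=> iG Le hdl M0 L0 a0 a1 hs hG hz.
have s0 : 0 < s by apply: lt_le_trans hs; rewrite divr_gt0.
set u := hker s c 6.
have mD : measurable (Omega `\` eball c h : set T2) by exact: measurableD.
have mT : measurable (W `\` eball c h : set T2) by exact: measurableD.
have OE : Omega = S `|` (Omega `\` eball c h) by rewrite -hS setUIDK.
have WE : W = S `|` (W `\` eball c h) by rewrite setUIDK.
have dO : [disjoint S & Omega `\` eball c h].
  by rewrite disj_set2E; apply/eqP; apply/seteqP; split => // x [[_ ?] []].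
have dW : [disjoint S & W `\` eball c h].
  by rewrite disj_set2E; apply/eqP; apply/seteqP; split => // x [[_ ?] []].
have mu' D : Cmeasurable (D : set T2) u by exact: Cmeasurable_hker.
have SO : S `<=` Omega by rewrite -hS; exact: subIsetl.
have SW : S `<=` W by exact: subIsetl.
have iGS := CintegrableS mS mO SO iG.
have iGD := CintegrableS mD mO (@subDsetl _ _ _) iG.
have iuW : Cintegrable (mu2 R) W u := integrable_hker_sector c htm htmM htM s0.
have iuS := CintegrableS mS mW SW iuW.
have iuT := CintegrableS mT mW (@subDsetl _ _ _) iuW.
have hin x : S x -> normc (u x) <= k3.
  by move=> [Wx _]; exact: (hker_sector_le k0p hco s0 Wx).
have hout x : (Omega `\` eball c h) x -> normc (u x) <= (2 / h) ^+ 6 * s ^- 6.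
  by move=> [_ hx]; exact: hker_far hs hx.
have q0 : 0 <= (2 / h) ^+ 6 * s ^- 6.
  by rewrite mulr_ge0 ?invr_ge0// ?exprn_ge0 ?divr_ge0// ltW.
have iGuO : Cintegrable (mu2 R) Omega (fun x => G x * u x).
  apply: (le_Cintegrable mO (CmeasurableM (Cintegrable_Cmeasurable iG) (mu' _))
    (integrableZl mO (k3 + (2 / h) ^+ 6 * s ^- 6) (integrable_normc mO iG))) => x Ox.
  rewrite normcM mulrC; apply: (ler_wpM2r (normc_ge0 _)).
  have [hx|hx] := pselect (eball c h x).
    by apply: (@le_trans _ _ k3); [apply: hin; rewrite -hS|rewrite lerDl].
  apply: (@le_trans _ _ ((2 / h) ^+ 6 * s ^- 6)); first exact: hout.
  by rewrite lerDr ltW.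
have iGuS := CintegrableS mS mO SO iGuO.
have iGuD := CintegrableS mD mO (@subDsetl _ _ _) iGuO.
have ibuS := CintegrableZ b mS iuS.
have iPS := CintegrableB mS iGuS ibuS.
set P := Cintegral (mu2 R) S (fun x => G x * u x - b * u x).
set Q := Cintegral (mu2 R) (Omega `\` eball c h) (fun x => G x * u x).
set Tl := Cintegral (mu2 R) (W `\` eball c h) u.
(* Both [Omega] and the infinite sector are split along the ball; inside it they share the piece
   [S]. *)
have main : b * (s%:C ^- 2 * sector_const tm tM) = (b * Tl - P) - Q.
  rewrite -(Cintegral_hker_sector c htm htmM htM s0) -/u [in LHS]WE.
  rewrite Cintegral_setU//; last by rewrite -WE.
  move: hz; rewrite OE Cintegral_setU//; last by rewrite -OE.
  rewrite -/u -/Q => hz.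
  have -> : P = Cintegral (mu2 R) S (fun x => G x * u x) - b * Cintegral (mu2 R) S u.
    by rewrite /P (CintegralB mS iGuS ibuS) (CintegralZ _ mS iuS).
  have -> : Cintegral (mu2 R) S (fun x => G x * u x) = - Q by apply/eqP; rewrite -addr_eq0 hz.
  rewrite -/Tl; ring.
have bT : normc (b * Tl) <= normc b * (2 * (k3 * pi ^+ 2 / h * s ^- 3)).
  rewrite normcM ler_wpM2l ?normc_ge0//.
  apply: le_trans (normc_Cintegral_le mT iuT) _; rewrite ler_pM2l//.
  exact: (hker_sector_tail htm htmM htM k0p hco s0 h0).
have bQ : normc Q <= 2 * ((2 / h) ^+ 6 * s ^- 6 *
    Rintegral (mu2 R) Omega (fun x => normc (G x))).
  apply: le_trans (normc_Cintegral_le mD iGuD) _; rewrite ler_pM2l//.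
  apply: (@le_trans _ _ (Rintegral (mu2 R) (Omega `\` eball c h)
     (fun x => (2 / h) ^+ 6 * s ^- 6 * normc (G x)))).
    apply: (le_Rintegral mD (integrable_normc mD iGuD)
      (integrableZl mD _ (integrable_normc mD iGD))) => x Dx.
    by rewrite normcM mulrC (ler_wpM2r (normc_ge0 _) (hout x Dx)).
  rewrite (RintegralZl _ mD (integrable_normc mD iGD)).
  apply: (ler_wpM2l q0).
  apply: (le_Rintegral_subset mD mO (@subDsetl _ _ _) (integrable_normc mO iG)) => x _.
  exact: normc_ge0.
have [im em] := moment_hker_sector htm htmM htM k0p hco s0 a0 a1.
have [iq eq] := moment_hker_sector htm htmM htM k0p hco s0 ler01 (lexx 1).
have [Lu hu] := l2_hker_sector htm htmM htM k0p hco s0.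
have LuS := L2S mS mW SW Lu.
have ieu := integrable_normc mS (L2M_Cintegrable mS Le LuS).
have imS := integrableS mW mS SW im.
have iqS := integrableS mW mS SW iq.
have m0 x p : 0 <= edist x c `^ p * normc (u x).
  by rewrite mulr_ge0 ?powR_ge0 ?normc_ge0.
have bP : normc P <= 2 * (M * (k3 * pi ^+ 2 * s `^ (- al) * s ^- 2) +
    L * (k3 * pi ^+ 2 * s `^ (- 1) * s ^- 2) + dl * (k3 * pi / s)).
  apply: le_trans (normc_Cintegral_le mS iPS) _; rewrite ler_pM2l//.
  apply: (@le_trans _ _ (Rintegral (mu2 R) S (fun x =>
    M * (edist x c `^ al * normc (u x)) + L * (edist x c `^ 1 * normc (u x)) +
    normc (e x * u x)))).
    apply: (ae_le_Rintegral mS (integrable_normc mS iPS)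
      (integrableD mS (integrableD mS (integrableZl mS M imS) (integrableZl mS L iqS)) ieu)).
    - by move=> x; exact: normc_ge0.
    - by move=> x; rewrite !addr_ge0 ?mulr_ge0 ?powR_ge0 ?normc_ge0.
    apply: negligibleS hG => x H hx; apply: H => Sx.
    rewrite -mulrBl !normcM powRr1 ?eudist_ge0// !mulrA -!mulrDl.
    apply: (ler_wpM2r (normc_ge0 (u x))); exact: hx.
  rewrite (RintegralD mS (integrableD mS (integrableZl mS M imS) (integrableZl mS L iqS)) ieu).
  rewrite (RintegralD mS (integrableZl mS M imS) (integrableZl mS L iqS)).
  rewrite (RintegralZl _ mS imS) (RintegralZl _ mS iqS).
  apply: lerD; first apply: lerD.
  - apply: (ler_wpM2l M0); apply: le_trans em.
    by apply: (le_Rintegral_subset mS mW SW im) => x _; exact: m0.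
  - apply: (ler_wpM2l L0); apply: le_trans eq.
    by apply: (le_Rintegral_subset mS mW SW iq) => x _; exact: m0.
  apply: le_trans (cauchy_schwarz mS Le LuS) _.
  apply: (ler_pM (sqrtr_ge0 _) (sqrtr_ge0 _) hdl).
  apply: le_trans hu; rewrite ler_wsqrtr//.
  by apply: (le_Rintegral_subset mS mW SW (L2_integrable mW Lu)) => x _; exact: sqr_ge0.
have : normc (b * (s%:C ^- 2 * sector_const tm tM)) <= normc (b * Tl) + normc P + normc Q.
  rewrite main; apply: le_trans (le_normcB _ _) _; rewrite lerD2r; exact: le_normcB.
rewrite (normcM b (_ * _)) (normcM (s%:C ^- 2)) normcV normc_expr normcR (gtr0_norm s0) => fin0.
have {}fin0 : normc b * (s ^- 2 * normc (sector_const tm tM)) <=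
    normc b * (2 * (k3 * pi ^+ 2 / h * s ^- 3)) +
    2 * (M * (k3 * pi ^+ 2 * s `^ (- al) * s ^- 2) +
    L * (k3 * pi ^+ 2 * s `^ (- 1) * s ^- 2) + dl * (k3 * pi / s)) +
    2 * ((2 / h) ^+ 6 * s ^- 6 * Rintegral (mu2 R) Omega (fun x => normc (G x))).
  apply: (le_trans fin0); apply: lerD bQ; exact: lerD bT bP.
have s2 : 0 < s ^- 2 by rewrite invr_gt0 exprn_gt0.
rewrite -(ler_pM2r s2); move: fin0.
rewrite powR_inv1 ?(ltW s0)//.
set I := Rintegral _ _ _; set N := normc b; set K := normc _; set A := s `^ _.
(* Multiplication by [s^2] turns the far part from [s^-6] into [s^-4] and the sector tail from
   [s^-3] into [s^-1]. The identity is stated for plain variables so that [field] meets no norms or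
   integrals. *)
have E (n k m p i a ll d q z : R) : z != 0 -> q != 0 ->
   n * (2 * (k * p ^+ 2 / q * z ^- 3)) +
    2 * (m * (k * p ^+ 2 * a * z ^- 2) +
    ll * (k * p ^+ 2 * z^-1 * z ^- 2) + d * (k * p / z)) +
    2 * ((2 / q) ^+ 6 * z ^- 6 * i) =
   (2 * k * p ^+ 2 * (m * a + ll / z) + 2 * k * p * (d * z) +
    2 * (2 / q) ^+ 6 * i * z ^- 4 +
    n * (2 * k * p ^+ 2 / q / z)) * z ^- 2.
  by move=> zn0 qn0; field; rewrite zn0 qn0.
move=> H; have -> : N * K / s ^+ 2 = N * (s ^- 2 * K) by rewrite -mulrA (mulrC K).
apply: (le_trans H); rewrite le_eqVlt; apply/orP; left; apply/eqP.
exact: E (lt0r_neq0 s0) (lt0r_neq0 h0).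
Qed.

End corner.

Lemma powR_natr_small {R : realType} (p eps : R) : 0 < p -> 0 < eps ->
  exists N, forall n, (N <= n)%N -> n%:R `^ (- p) <= eps.
Proof.
move=> p0 e0; pose t := eps^-1 `^ p^-1.
exists (Num.trunc t).+1 => n hn.
have t0 : 0 <= t by exact: powR_ge0.
have tn : t <= n%:R.
  by apply: ltW; apply: (lt_le_trans (truncnS_gt t)); rewrite ler_nat.
have h : eps^-1 <= n%:R `^ p.
  have -> : eps^-1 = t `^ p.
    by rewrite -powRrM mulVf ?gt_eqF// powRr1// invr_ge0 ltW.
  by apply: ge0_ler_powR; rewrite ?nnegrE// ltW.
by rewrite powRN -[leRHS]invrK lef_pV2 ?posrE// ?invr_gt0// (lt_le_trans _ h)// invr_gt0.
Qed.

(** * Vanishing of the vertex values and Poincare near the vertex *)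

Section vertex.
Context {R : realType}.
Local Notation T2 := (measurableTypeR R * measurableTypeR R)%type.
Variables (tm tM k0 h B : R) (c : R * R) (Omega : set (R * R)).
Hypotheses (htm : - pi < tm) (htmM : tm < tM) (htM : tM < pi).
Hypothesis hne : tM - tm <> pi.
Hypotheses (k0p : 0 < k0) (h0 : 0 < h) (B0 : 0 < B).
Local Notation W := (sector c tm tM).
Local Notation S := (W `&` eball c h).
Hypothesis hco : forall x s, 0 <= s -> W x -> coercive k0 s c x.
Hypothesis hcone : forall x, W x -> - (B * `|x.2 - c.2|) < x.1 - c.1.
Hypothesis hS : Omega `&` eball c h = S.

(** With [s = j^(U/2)] the error terms of [corner_estimate] decay like [j^(-al U/2)], [j^(r - U/2)],
    [j^(-U/2)] and [j^(-2 U)]. The tail term carries the unknown [normc (b j)] itself and is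
    absorbed into the left-hand side. *)
Lemma vertex_value_cvg0 (G : R * R -> R[i]) (e : nat -> R * R -> R[i])
    (b : nat -> R[i]) (M al L U r : R) :
  measurable (Omega : set T2) -> Cintegrable (mu2 R) Omega G ->
  0 <= M -> 0 <= L -> 0 < al -> al < 1 -> 0 < U -> r < al * U / 2 ->
  (forall j, (0 < j)%N -> L2 (mu2 R) S (e j)) ->
  (forall j, (0 < j)%N -> Num.sqrt (l2 (mu2 R) S (e j)) <= j%:R `^ (- U)) ->
  (forall j, (0 < j)%N -> {ae mu2 R, forall x, S x ->
     normc (G x - b j) <=
       M * edist x c `^ al + L * j%:R `^ r * edist x c + normc (e j x)}) ->
  (forall s, 2 / h <= s ->
     Cintegral (mu2 R) Omega (fun x => G x * hker s c 6 x) = 0) ->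
  forall eps, 0 < eps -> exists N, forall j, (N <= j)%N -> normc (b j) <= eps.
Proof.
move=> mO iG M0 L0 a0 a1 U0 rU Le hle hG hz eps eps0.
set K := normc (sector_const tm tM).
have K0 : 0 < K by apply: normc_gt0; exact: sector_const_neq0.
pose k3 := k0 ^- 3; have k3p : 0 < k3 by rewrite invr_gt0 exprn_gt0.
have p0 : 0 < (pi : R) by exact: pi_gt0.
pose C1 := 2 * k3 * pi ^+ 2; have C10 : 0 <= C1 by rewrite !mulr_ge0 ?exprn_ge0// ltW.
pose C2 := 2 * k3 * pi; have C20 : 0 <= C2 by rewrite !mulr_ge0// ltW.
pose I := Rintegral (mu2 R) Omega (fun x => normc (G x)).
have I0 : 0 <= I by apply: Rintegral_ge0 => x _; exact: normc_ge0.
pose C3 := 2 * (2 / h) ^+ 6 * I.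
have C30 : 0 <= C3.
  by apply: (mulr_ge0 _ I0); apply: mulr_ge0; rewrite ?exprn_ge0// divr_ge0// ltW.
pose C4 := 2 * k3 * pi ^+ 2 / h; have C40 : 0 < C4.
  by rewrite divr_gt0// !mulr_gt0// exprn_gt0.
pose Ct := C1 * M + C1 * L + C2 + C3 + 1.
have Ct0 : 0 < Ct by rewrite ltr_wpDl// !addr_ge0// mulr_ge0.
(* Chosen so that the errors sum to at most [eps * K / 2], the other half of [K] being spent on
   absorbing the tail. *)
pose dl := eps * K / (2 * Ct).
have dl0 : 0 < dl by rewrite divr_gt0 ?mulr_gt0.
have q1 : 0 < U / 2 * al by rewrite mulr_gt0// divr_gt0.
have q2 : 0 < U / 2 - r.
  rewrite subr_gt0; apply: lt_le_trans rU _; rewrite -mulrA ler_piMl ?(ltW a1)//.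
  by rewrite divr_ge0// ltW.
have q3 : 0 < U / 2 by rewrite divr_gt0.
have q4 : 0 < U / 2 * 4 by rewrite mulr_gt0.
have [N1 h1] := powR_natr_small q1 dl0.
have [N2 h2] := powR_natr_small q2 dl0.
have [N3 h3] := powR_natr_small q3 dl0.
have [N4 h4] := powR_natr_small q4 dl0.
(* The bound [h / 2] on [s^-1] makes [s] admissible in [corner_estimate]; [K / (2 * C4)] is what the
   absorption requires. *)
have m0 : 0 < Num.min (h / 2) (K / (2 * C4)).
  by rewrite lt_min !divr_gt0// mulr_gt0.
have [N5 h5] := powR_natr_small q3 m0.
exists (maxn 1 (maxn N1 (maxn N2 (maxn N3 (maxn N4 N5))))) => j.
rewrite !geq_max => /and5P[j1 /h1 {}h1 /h2 {}h2 /h3 {}h3 /andP[/h4 {}h4 /h5 {}h5]].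
have jp : 0 < j%:R :> R by rewrite ltr0n.
pose s := j%:R `^ (U / 2) : R.
have s0 : 0 < s by exact: powR_gt0.
have sV : s^-1 = j%:R `^ (- (U / 2)) by rewrite powRN.
move: h5; rewrite -sV le_min => /andP[h5 h6].
have hs : 2 / h <= s.
  by rewrite -[leLHS]invrK invf_div -[leRHS]invrK lef_pV2// posrE ?invr_gt0// divr_gt0.
have e1 : s `^ (- al) <= dl by rewrite /s -powRrM mulrN.
have e2 : j%:R `^ r / s <= dl.
  by rewrite sV -powRD ?(gt_eqF jp) ?implybT//; move: h2; rewrite opprB.
have e3 : j%:R `^ (- U) * s <= dl.
  rewrite /s -powRD ?(gt_eqF jp) ?implybT//; move: h3.
  by congr (_ `^ _ <= _); field.
have e4 : s ^- 4 <= dl.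
  by move: h4; rewrite powRN powRrM -/s -powR_mulrn ?(ltW s0).
have := corner_estimate htm htmM htM k0p h0 hco mO hS iG (Le j j1) (hle j j1) M0
  (mulr_ge0 L0 (powR_ge0 j%:R r)) (ltW a0) (ltW a1) hs (hG j j1) (hz s hs).
rewrite -/k3 -/C1 -/C2 -/I -/C3 -/C4 -/K.
set n := normc (b j); have n0 : 0 <= n by exact: normc_ge0.
move=> H.
have b1 : C1 * (M * s `^ (- al)) <= C1 * (M * dl) by rewrite !ler_wpM2l.
have b2 : C1 * (L * (j%:R `^ r / s)) <= C1 * (L * dl) by rewrite !ler_wpM2l.
have b3 : C2 * (j%:R `^ (- U) * s) <= C2 * dl by rewrite ler_wpM2l.
have b4 : C3 * s ^- 4 <= C3 * dl by rewrite ler_wpM2l.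
have b5 : n * (C4 / s) <= n * (K / 2).
  apply: (ler_wpM2l n0); rewrite mulrC -ler_pdivlMr//.
  by apply: le_trans h6 _; rewrite le_eqVlt invfM mulrA eqxx.
have : n * K <= Ct * dl + n * (K / 2).
  apply: le_trans H _; apply: lerD => //; rewrite [leRHS]mulrDl mul1r !mulrDl.
  apply: (@le_trans _ _ (C1 * M * dl + C1 * L * dl + C2 * dl + C3 * dl)); last by rewrite lerDl ltW.
  apply: lerD => //; apply: lerD => //; rewrite mulrDr.
  by apply: lerD; rewrite -[leRHS](mulrA C1) // -(mulrA L).
have -> : Ct * dl = eps * K / 2 by rewrite /dl; field; rewrite gt_eqF.
by rewrite {1}(splitr (n * K)) mulrA lerD2r ler_pM2r ?invr_gt0// ler_pM2r//.
Qed.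

(** Three gains: the segments have length of order [rho], Cauchy-Schwarz on a set of measure of
    order [rho^2] gives another [rho], and the L2 norm of the gradient over the shrinking box is
    arbitrarily small. *)
Lemma corner_poincare (u : R * R -> R[i]) Du eps : open Omega -> bounded_set Omega ->
  H10 Omega u Du -> 0 < eps ->
  exists2 d : R, 0 < d & forall rho, 0 < rho -> rho <= d ->
    Rintegral (mu2 R) (eball c rho `&` Omega) (fun x => normc (u x)) <= eps * rho ^+ 2.
Proof.
move=> oO bO hu eps0.
have mO := open_measurable2 oO.
have [[Lu LD _ _ _] _] := hu.
have Ofin := mu2_bounded_lty mO bO.
have B1 : 0 < 1 + B by rewrite addr_gt0.
(* The final bound is [2 (1 + B) rho * eta * 2 (1 + B) rho], which this choice makes equal to
   [eps * rho^2]. *)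
pose eta := eps / (4 * (1 + B) ^+ 2).
have eta0 : 0 < eta by rewrite divr_gt0// mulr_gt0// exprn_gt0.
have [d1 d10 hd1] := integral_corner_box_small c B0 mO (L2_integrable mO LD)
  (fun x => sqr_ge0 (normc (Du x).1)) (exprn_gt0 2 eta0).
exists (Num.min d1 (h / (2 * (1 + B)))) => [|rho rho0].
  by rewrite lt_min d10 divr_gt0// mulr_gt0.
rewrite le_min => /andP[rd1 rh].
have rh' : (1 + B) * rho < h.
  move: rh; rewrite ler_pdivlMr ?mulr_gt0// => rh.
  by have := mulr_gt0 B1 rho0; lra.
have Br0 : 0 < B * rho by rewrite mulr_gt0.
set D := corner_box B c rho `&` Omega.
have mB : measurable (corner_box B c rho : set T2) by exact: measurable_box.
have mD : measurable (D : set T2) by exact: measurableI.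
have DO : D `<=` Omega by exact: subIsetr.
have ED : D = Omega `&` corner_box B c rho by rewrite setIC.
have ESW x : eball c rho x -> Omega x -> W x.
  move=> xr Ox; have [] // : S x; rewrite -hS; split => //.
  apply: lt_trans xr _; apply: le_lt_trans rh'; rewrite mulrDl mul1r lerDl ltW//.
have ab : c.1 - B * rho <= c.1 + rho by lra.
(* The left edge lies in the ball of radius [h], where [Omega] coincides with the sector; but there
   the cone condition forces abscissas above [-B |x2 - c2|], hence above [-B rho]. *)
have hO y : c.2 - rho <= y <= c.2 + rho -> ~ Omega (c.1 - B * rho, y).
  move=> /andP[y1 y2] Oy.
  have yr : `|y - c.2| <= rho by rewrite ler_norml; apply/andP; split; lra.
  have [] : S (c.1 - B * rho, y).
    rewrite -hS; split => //; apply: le_lt_trans (edist_le_sum _ _) _ => /=.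
    rewrite addrAC subrr add0r normrN (gtr0_norm Br0).
    by apply: le_lt_trans rh'; rewrite mulrDl mul1r addrC lerD2r.
  move=> /hcone /=; rewrite addrAC subrr add0r ltrN2.
  by rewrite ltr_pM2l// ltNge yr.
have P := poincare_H10 oO ab hu hO.
have Dfin : (mu2 R D < +oo)%E.
  by apply: le_lt_trans Ofin; apply: le_measure; rewrite ?inE.
have [_ L12] := L1_le_L2 mD Dfin (L2S mD mO DO LD).
have hm : fine (mu2 R D) <= (2 * (1 + B) * rho) ^+ 2.
  have bxE : mu2 R (corner_box B c rho) = (((1 + B) * rho) * (2 * rho))%:E.
    rewrite /corner_box mu2_box; [congr (_%:E); ring|lra|lra].
  apply: (@le_trans _ _ (((1 + B) * rho) * (2 * rho))).
    rewrite -lee_fin fineK ?ge0_fin_numE// -bxE.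
    by apply: le_measure; rewrite ?inE//; exact: subIsetl.
  have rr : 0 <= rho ^+ 2 by exact: sqr_ge0.
  have := mulr_ge0 (ltW B0) rr; have := mulr_ge0 (sqr_ge0 B) rr; lra.
have hl : Num.sqrt (l2 (mu2 R) D (fun x => (Du x).1)) <= eta.
  rewrite -[leRHS]ger0_norm ?(ltW eta0)// -sqrtr_sqr ler_wsqrtr//.
  by rewrite /l2 ED; exact: hd1.
have hm' : Num.sqrt (fine (mu2 R D)) <= 2 * (1 + B) * rho.
  have g0 : 0 <= 2 * (1 + B) * rho by rewrite !mulr_ge0// ltW.
  by rewrite -[leRHS]ger0_norm// -sqrtr_sqr ler_wsqrtr.
apply: (@le_trans _ _ (Rintegral (mu2 R) D (fun x => normc (u x)))).
  apply: le_Rintegral_subset => //.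
  - by apply: measurableI => //; exact: measurable_eball.
  - move=> x [xr Ox]; split => //.
    by apply: (sector_ball_sub_box B0 rho0 hcone); split => //; exact: ESW.
  - have [iu _] := L1_le_L2 mD Dfin (L2S mD mO DO Lu).
    exact: integrable_normc mD iu.
  - by move=> x _; exact: normc_ge0.
apply: (le_trans P).
have -> : c.1 + rho - (c.1 - B * rho) = (1 + B) * rho by ring.
apply: (@le_trans _ _ (2 * ((1 + B) * rho) * (eta * (2 * (1 + B) * rho)))).
  apply: ler_wpM2l; first by rewrite !mulr_ge0// ltW.
  apply: (le_trans L12); exact: ler_pM (sqrtr_ge0 _) (sqrtr_ge0 _) hl hm'.
rewrite le_eqVlt; apply/orP; left; apply/eqP; rewrite /eta; field.
by rewrite gt_eqF.
Qed.

End vertex.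

(** On division by the measure [m >= q^2] the L2 term loses only a square root,
    [dl * sqrt m / m <= dl / q]; keeping it in L2 until here is what allows the choice
    [rho ~ j^(-Upsilon/2)]. *)
Lemma average_le {R : realType} d {T : measurableType d}
    (mu : {measure set T -> \bar R}) (D : set T) (f p e : T -> R[i]) (K P dl q : R) :
  measurable D -> (mu D < +oo)%E -> 0 < q -> q ^+ 2 <= fine (mu D) ->
  0 <= K -> 0 <= P ->
  Cintegrable mu D f -> Cintegrable mu D p -> L2 mu D e ->
  Num.sqrt (l2 mu D e) <= dl -> Rintegral mu D (fun x => normc (p x)) <= P ->
  {ae mu, forall x, D x -> normc (f x) <= K + normc (p x) + normc (e x)} ->
  normc (Cintegral mu D f / (fine (mu D))%:C) <= 2 * (K + P / q ^+ 2 + dl / q).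
Proof.
move=> mD Dfin q0 qm K0 P0 jf jp Le edl pP hf.
set m := fine (mu D); have q20 : 0 < q ^+ 2 by rewrite exprn_gt0.
have m0 : 0 < m by exact: lt_le_trans qm.
have [je he] := L1_le_L2 mD Dfin Le.
have ip := integrable_normc mD jp; have ie := integrable_normc mD je.
have iK := integrable_cst_lty K mD Dfin.
rewrite normcM normcV normcR (gtr0_norm m0) ler_pdivrMr//.
apply: le_trans (normc_Cintegral_le mD jf) _; rewrite -mulrA ler_pM2l//.
apply: (@le_trans _ _ (Rintegral mu D (fun x => K + normc (p x) + normc (e x)))).
  apply: (ae_le_Rintegral mD (integrable_normc mD jf)
    (integrableD mD (integrableD mD iK ip) ie)) => // x; first exact: normc_ge0.
  by rewrite !addr_ge0 ?normc_ge0.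
rewrite (RintegralD mD (integrableD mD iK ip) ie) (RintegralD mD iK ip).
rewrite (Rintegral_cst mu mD K) -/m !mulrDl.
have sq : q <= Num.sqrt m.
  by rewrite -[leLHS]gtr0_norm// -sqrtr_sqr ler_wsqrtr.
have sm : Num.sqrt m ^+ 2 = m by rewrite sqr_sqrtr// ltW.
have sp : 0 < Num.sqrt m by rewrite sqrtr_gt0.
have dl0 : 0 <= dl by exact: le_trans (sqrtr_ge0 _) edl.
apply: lerD; first apply: lerD => //.
  apply: (le_trans pP); rewrite mulrAC -mulrA ler_peMr// ler_pdivlMr// mul1r//.
apply: (le_trans he); rewrite -/m; apply: (@le_trans _ _ (dl * Num.sqrt m)).
  by rewrite ler_pM2r.
rewrite -[X in dl / q * X]sm -mulrA ler_wpM2l// mulrC -ler_pdivrMr ?invr_gt0// invrK.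
by rewrite expr2 ler_pM2l.
Qed.

(** With [t = rho^(-2/U) >= 1], the integer [j] just above [t] satisfies [t < j <= 2 t]; the
    constant [2^(U/2)] is the price of this factor 2. *)
Lemma exists_index {R : realType} (U rho : R) (N : nat) : 0 < U -> 0 < rho ->
  rho <= N.+1%:R `^ (- (U / 2)) ->
  exists j, [/\ (N < j)%N, j%:R `^ (- (U / 2)) <= rho &
    rho <= 2^-1 `^ (- (U / 2)) * j%:R `^ (- (U / 2))].
Proof.
move=> U0 rho0 hN; have q0 : 0 < U / 2 by rewrite divr_gt0.
pose t := rho `^ (- (U / 2)^-1).
have t0 : 0 < t by exact: powR_gt0.
have tE : t `^ (- (U / 2)) = rho.
  by rewrite -powRrM mulrNN mulVf ?gt_eqF// powRr1// ltW.
have anti (a b : R) : 0 < a -> a <= b -> b `^ (- (U / 2)) <= a `^ (- (U / 2)).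
  move=> a0 ab; have b0 := lt_le_trans a0 ab.
  by rewrite !powRN lef_pV2 ?posrE ?powR_gt0// ge0_ler_powR ?nnegrE// ltW.
have Nt : N.+1%:R <= t.
  rewrite leNgt; apply/negP => tN; move: hN; rewrite leNgt => /negP; apply.
  rewrite -tE !powRN ltf_pV2 ?posrE ?powR_gt0//.
  by rewrite gt0_ltr_powR ?nnegrE// ltW.
have [jt jlt] : (Num.truncn t)%:R <= t /\ t < (Num.truncn t).+1%:R.
  by split; [rewrite truncn_le ltW|exact: truncnS_gt].
exists (Num.truncn t).+1; split.
- by rewrite -(ltr_nat R) (lt_trans _ jlt)// (lt_le_trans _ Nt)// ltr_nat.
- by rewrite -tE; apply: anti => //; exact: ltW.
rewrite -[leLHS]tE -powRM ?invr_ge0//; apply: anti; first by rewrite mulr_gt0 ?invr_gt0.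
have t1 : 1 <= t by apply: le_trans Nt; rewrite ler1n.
by rewrite mulrC ler_pdivrMr// mulr_natr mulr2n -natr1 lerD.
Qed.

(** Serves to make the Herglotz functions measurable. *)
Lemma Ccontinuous_lipschitz {R : realType} (f : R * R -> R[i]) (L : R) :
  (forall x y, normc (f x - f y) <= L * edist x y) ->
  forall x, Ccontinuous_at f x.
Proof.
move=> hL x.
have key (p : R[i] -> R) : (forall z w, `|p z - p w| <= normc (z - w)) ->
    {for x, continuous (fun y => p (f y))}.
  move=> hp; apply/cvgrPdist_le => eps eps0.
  have L0 : 0 < 1 + `|L| by rewrite ltr_pwDl.
  have : nbhs x (eball x (eps / (1 + `|L|))).
    apply: open_nbhs_nbhs; split; first exact: open_eball.
    by rewrite /eball /= /Defs.edist !subrr !expr0n /= addr0 sqrtr0 divr_gt0.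
  apply: filterS => y; rewrite /eball /= ltr_pdivlMr// => hy.
  rewrite distrC; apply: le_trans (hp _ _) _; apply: le_trans (hL _ _) _.
  apply: le_trans (ltW hy); rewrite mulrC; apply: ler_wpM2l; first exact: eudist_ge0.
  by apply: le_trans (ler_norm _) _; rewrite lerDr.
split; apply: key => z w.
  by rewrite -cReN -cReD; exact: normr_Re_le.
by rewrite -cImN -cImD; exact: normr_Im_le.
Qed.

(** * The average of [V w] near the vertex *)

Local Notation T2 R := (measurableTypeR R * measurableTypeR R)%type.

Theorem corollary2p4 (R : realType) (Omega : set (R * R))
    (V v w : R * R -> R[i]) (Dv Dw : R * R -> R[i] * R[i]) (k : R)
    (xc : R * R) (tm tM h alpha C Upsilon varrho : R)
    (g : nat -> R * R -> R[i])
    (hOmega : bounded_lipschitz_domain Omega)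
    (hcompl : connected (~` Omega))
    (hV : Linfty (mu2 R) Omega V)
    (hk : 0 < k)
    (hvw : transmission_eigenfunctions Omega k V v w Dv Dw)
    (htm : - pi < tm) (htmM : tm < tM) (htM : tM < pi)
    (hangle : tM - tm <> pi)
    (hh : 0 < h) :
  let W := sector xc tm tM in
  let Sh := W `&` eball xc h in
  let vj := fun j => herglotz k (g j) in
  Omega `&` eball xc h = Sh ->
  0 < alpha -> alpha < 1 ->
  ae_holder Sh (closure Sh) alpha (fun x => (1 + V x) * w x) ->
  0 < C -> 0 < Upsilon -> varrho < alpha * Upsilon / 2 ->
  (forall j : nat, (0 < j)%N ->
     [/\ L2circle (g j),
         (H1norm Sh (fun x => v x - vj j x)%R
                    (fun x => Dv x - Cgrad (vj j) x)%R
            <= (j%:R `^ (- Upsilon))%:E)%E &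
         (L2circle_norm (g j) <= (C * j%:R `^ varrho)%:E)%E]) ->
  normc (Cintegral (mu2 R) (eball xc rho `&` Omega) (fun x => V x * w x)
         / (fine (mu2 R (eball xc rho `&` Omega)))%:C)
    @[rho --> (0 : R)^'+] --> (0 : R).
Proof.
move=> W Sh vj hS al0 al1 [F [aeF [M hM]]] C0 U0 hrho hvj.
have [oO _ _ bO _] := hOmega.
have [B [k0 [B0 k0p k01 hcone hco]]] := sector_coercive htm htmM htM.
have [c0 c00 hc0] := sector_ball_measure_ge htm htmM htM k0p (hco xc) hangle.
have mO := open_measurable2 oO.
have mW : measurable (W : set (T2 R)) by exact: measurable_sector.
have mE r : measurable (eball xc r : set (T2 R)).
  exact: measurable_eball.
have mS : measurable (Sh : set (T2 R)) by exact: measurableI.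
have SO : Sh `<=` Omega by rewrite -hS; exact: subIsetl.
have Ofin := mu2_bounded_lty mO bO.
have ballS r : r <= h -> eball xc r `&` Omega = W `&` eball xc r.
  move=> rh; apply/seteqP; split => x [].
    move=> xr Ox; have [Wx _] : Sh x by rewrite -hS; split => //; exact: lt_le_trans rh.
    by split.
  move=> Wx xr; split => //; apply: SO; split => //; exact: lt_le_trans rh.
(* Small sectors have positive measure and so are nonempty; hence the vertex, itself outside the
   sector, lies in the closure, and the Hoelder bound may be used at [xc]. *)
have Sr0 r : 0 < r -> (W `&` eball xc r) !=set0.
  move=> r0; apply/set0P/negP => /eqP E; have := hc0 r r0.
  by rewrite -/W E measure0 lee_fin leNgt mulr_gt0// exprn_gt0.
have clS : closure Sh xc.
  move=> U /nbhs_ballP[d /= d0 dU].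
  have [x [Wx xd]] := Sr0 (Num.min d h) ltac:(by rewrite lt_min d0).
  move: xd; rewrite /eball /= lt_min => /andP[xd xh].
  exists x; split; first by split.
  apply: dU; apply/ball2P; split; rewrite distrC.
    exact: le_lt_trans (edist_norm1 _ _) xd.
  exact: le_lt_trans (edist_norm2 _ _) xd.
pose a := F xc.
have hF x : Sh x -> normc (F x - a) <= `|M| * edist x xc `^ alpha.
  move=> Sx; apply: le_trans (hM x xc (subset_closure Sx) clS) _.
  by rewrite ler_wpM2r ?powR_ge0// ler_norm.
pose L := 4 * k * Num.sqrt (2 * pi) * C.
have L0 : 0 <= L by rewrite /L !mulr_ge0 ?sqrtr_ge0// ltW.
have lip j x y : (0 < j)%N ->
    normc (vj j x - vj j y) <= L * j%:R `^ varrho * edist x y.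
  move=> j0; have [Lg _ hg] := hvj j j0.
  have M0 : 0 <= C * j%:R `^ varrho by rewrite mulr_ge0 ?powR_ge0// ltW.
  by have := herglotz_lipschitz x y hk M0 Lg hg; rewrite /L !mulrA.
have [[hv hw] [_ [_ [_ [h10 _]]]]] := hvw.
have [Lv _ _ _ _] := hv; have [Lw _ _ _ _] := hw.
have orth s : 2 / h <= s -> L2 (mu2 R) Omega (fun x => (1 + V x) * w x) /\
    Cintegral (mu2 R) Omega (fun x => ((1 + V x) * w x - v x) * hker s xc 6 x) = 0.
  move=> hs; apply: (transmission_orthogonality oO bO hk hV hvw (dl := Num.sqrt k0)).
    by rewrite sqrtr_gt0.
  exact: (affine_bounded_below k0p hh (hco xc) hS k01 hs).
have [Lq _] := orth (2 / h) (lexx _).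
pose G x := (1 + V x) * w x - v x.
have LG : L2 (mu2 R) Omega G := L2B mO Lq Lv.
have [iG _] := L1_le_L2 mO Ofin LG.
pose e j x := v x - vj j x.
have Le j : (0 < j)%N -> L2 (mu2 R) Sh (e j) /\
    Num.sqrt (l2 (mu2 R) Sh (e j)) <= j%:R `^ (- Upsilon).
  move=> j0; have [_ hn _] := hvj j j0.
  have [h1 _ _] := H1norm_le (powR_ge0 _ _) hn.
  have me : Cmeasurable (Sh : set (T2 R)) (e j).
    apply: CmeasurableB; first by apply: (CmeasurableS mO SO); have [] := Lv.
    apply: Cmeasurable_continuous; apply: Ccontinuous_lipschitz => x y; exact: lip.
  have Lej : L2 (mu2 R) Sh (e j) by split => //; apply: le_lt_trans h1 _; rewrite ltry.
  by split => //; apply: (l2_le mS Lej _ h1); exact: powR_ge0.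
pose b j := a - vj j xc.
have hG j : (0 < j)%N -> {ae mu2 R, forall x, Sh x -> normc (G x - b j) <=
    `|M| * edist x xc `^ alpha + L * j%:R `^ varrho * edist x xc + normc (e j x)}.
  move=> j0; apply: negligibleS aeF => x H hx; apply: H => Sx.
  rewrite /G /b /e (hx Sx).
  have -> : F x - v x - (a - vj j xc) = (F x - a) - (vj j x - vj j xc) - (v x - vj j x) by ring.
  apply: le_trans (le_normcB _ _) _; rewrite lerD2r.
  apply: le_trans (le_normcB _ _) _; apply: lerD; first exact: hF.
  exact: lip.
have hb := vertex_value_cvg0 htm htmM htM hangle k0p hh (hco xc) hS mO iG (normr_ge0 M)
  L0 al0 al1 U0 hrho (fun j j0 => (Le j j0).1) (fun j j0 => (Le j j0).2) hG
  (fun s hs => (orth s hs).2).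
apply/cvgrPdist_le => eps eps0.
(* Five errors of size at most [dl], doubled by [average_le]. *)
pose dl := eps / 10; have dl0 : 0 < dl by rewrite divr_gt0.
have U2 : 0 < Upsilon / 2 by rewrite divr_gt0.
have q2 : 0 < Upsilon / 2 - varrho.
  rewrite subr_gt0; apply: lt_le_trans hrho _; rewrite -mulrA ler_piMl ?(ltW al1)//.
  by rewrite ltW.
pose c2 : R := 2^-1 `^ (- (Upsilon / 2)).
have c20 : 0 < c2 by apply: powR_gt0; rewrite invr_gt0.
have L1 : 0 < (1 + L) * c2 by rewrite mulr_gt0// ltr_pwDl.
have sc0 : 0 < Num.sqrt c0 by rewrite sqrtr_gt0.
(* [N1] makes [b j] small, [N2] the Lipschitz term [L j^varrho rho], and [N3] the approximation term
   [j^(-Upsilon) / rho]. *)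
have [N1 h1] := hb dl dl0.
have [N2 h2] := powR_natr_small q2 (divr_gt0 dl0 L1).
have [N3 h3] := powR_natr_small U2 (mulr_gt0 dl0 sc0).
pose N := maxn N1 (maxn N2 N3).
have [d1 d10 hd1] := corner_poincare hh B0 (hcone xc) hS oO bO h10 (mulr_gt0 c00 dl0).
(* Below [d2] the Hoelder term [|M| rho^alpha] is at most [dl]; below [d3] the index attached to
   [rho] exceeds [N]. *)
pose d2 := (dl / (1 + `|M|)) `^ alpha^-1.
have M1 : 0 < 1 + `|M| by rewrite ltr_pwDl.
have d20 : 0 < d2 by apply: powR_gt0; rewrite divr_gt0.
pose d3 : R := N.+1%:R `^ (- (Upsilon / 2)).
have d30 : 0 < d3 by apply: powR_gt0.
have small rho : 0 < rho -> rho <= h -> rho <= d1 -> rho <= d2 -> rho <= d3 ->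
  normc (Cintegral (mu2 R) (eball xc rho `&` Omega) (fun x => V x * w x)
         / (fine (mu2 R (eball xc rho `&` Omega)))%:C) <= eps.
  move=> r0 rh r1 r2 r3.
  (* Both comparisons of [rho] with [j^(-Upsilon/2)] matter: the lower bound on [rho] serves the
     approximation error divided by [rho], the upper one the Lipschitz term. *)
  have [j [Nj j1 j2]] := exists_index U0 r0 r3.
  have j0 : (0 < j)%N by exact: leq_ltn_trans Nj.
  move: (ltnW Nj); rewrite !geq_max => /and3P[/h1 {}h1 /h2 {}h2 /h3 {}h3].
  set D := eball xc rho `&` Omega.
  have mD : measurable (D : set (T2 R)) by exact: measurableI.
  have DO : D `<=` Omega by exact: subIsetr.
  have DS : D `<=` Sh.
    by rewrite /D ballS// => x [Wx xr]; split => //; exact: lt_le_trans rh.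
  have Dfin : (mu2 R D < +oo)%E by apply: le_lt_trans Ofin; apply: le_measure; rewrite ?inE.
  have qm : (Num.sqrt c0 * rho) ^+ 2 <= fine (mu2 R D).
    rewrite exprMn sqr_sqrtr ?(ltW c00)// -lee_fin fineK ?ge0_fin_numE//.
    by rewrite /D ballS//; exact: hc0.
  pose K := `|M| * rho `^ alpha + L * j%:R `^ varrho * rho + dl.
  have Lj0 : 0 <= L * j%:R `^ varrho := mulr_ge0 L0 (powR_ge0 _ _).
  have K0 : 0 <= K := addr_ge0 (addr_ge0 (mulr_ge0 (normr_ge0 _) (powR_ge0 _ _))
    (mulr_ge0 Lj0 (ltW r0))) (ltW dl0).
  have Lu := L2B mO Lw Lv.
  have [iu _] := L1_le_L2 mD Dfin (L2S mD mO DO Lu).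
  have [ivw _] := L1_le_L2 mD Dfin (L2S mD mO DO (L2B mO Lq Lw)).
  have EV x : (1 + V x) * w x - w x = V x * w x by ring.
  have iVw : Cintegrable (mu2 R) D (fun x => V x * w x).
    by move: ivw; under eq_fun do rewrite EV.
  have [Lej lej] := Le j j0.
  have LeD := L2S mD mS DS Lej.
  have leD : Num.sqrt (l2 (mu2 R) D (e j)) <= j%:R `^ (- Upsilon).
    apply: le_trans lej; rewrite ler_wsqrtr//.
    by apply: (le_Rintegral_subset mD mS DS (L2_integrable mS Lej)) => x _; exact: sqr_ge0.
  have P0 : 0 <= c0 * dl * rho ^+ 2 := mulr_ge0 (mulr_ge0 (ltW c00) (ltW dl0)) (sqr_ge0 rho).
  have q0 : 0 < Num.sqrt c0 * rho by rewrite mulr_gt0.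
  have ae : {ae mu2 R, forall x, D x ->
      normc (V x * w x) <= K + normc (w x - v x) + normc (e j x)}.
    apply: negligibleS aeF => x H hx; apply: H => Dx.
    have Sx := DS _ Dx; have Ex := hx Sx.
    have -> : V x * w x = (F x - a) + (b j - (vj j x - vj j xc)) - (w x - v x) - e j x.
      rewrite -EV; have -> : (1 + V x) * w x = F x by exact: Ex.
      by rewrite /b /e; ring.
    apply: le_trans (le_normcB _ _) _; rewrite lerD2r.
    apply: le_trans (le_normcB _ _) _; rewrite lerD2r.
    apply: le_trans (le_normcD _ _) _; rewrite /K -[leRHS]addrA; apply: lerD.
      apply: le_trans (hF x Sx) _; apply: ler_wpM2l => //.
      have [xr _] := Dx.
      by apply: ge0_ler_powR; rewrite ?nnegrE ?eudist_ge0 ?(ltW r0) ?(ltW al0)// ltW.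
    apply: le_trans (le_normcB _ _) _; rewrite addrC; apply: lerD => //.
    apply: le_trans (lip j x xc j0) _; apply: (ler_wpM2l Lj0).
    by have [xr _] := Dx; exact: ltW.
  apply: le_trans (average_le mD Dfin q0 qm K0 P0 iVw iu LeD leD (hd1 rho r0 r1) ae) _.
  have E1 : c0 * dl * rho ^+ 2 / (Num.sqrt c0 * rho) ^+ 2 = dl.
    rewrite exprMn sqr_sqrtr ?(ltW c00)//.
    by move: (c0) (dl) (rho) c00 r0 => x y z x0 z0; field; rewrite !gt_eqF.
  have E2 : j%:R `^ (- Upsilon) / (Num.sqrt c0 * rho) <= dl.
    rewrite ler_pdivrMr// mulrA.
    (* One factor is compared with [rho] through [j1], the other is made small by [h3]. *)
    have -> : j%:R `^ (- Upsilon) = j%:R `^ (- (Upsilon / 2)) * j%:R `^ (- (Upsilon / 2)).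
      by rewrite -powRD ?pnatr_eq0 -?lt0n ?j0 ?implybT//; congr (_ `^ _); field.
    by apply: ler_pM; rewrite ?powR_ge0.
  have E3 : `|M| * rho `^ alpha <= dl.
    have : rho `^ alpha <= dl / (1 + `|M|).
      have -> : dl / (1 + `|M|) = d2 `^ alpha.
        by rewrite /d2 -powRrM mulVf ?gt_eqF// powRr1// divr_ge0// ltW.
      by apply: ge0_ler_powR; rewrite ?nnegrE ?(ltW al0) ?(ltW r0) ?(ltW d20).
    rewrite ler_pdivlMr// mulrDr mulr1 mulrC; apply: le_trans.
    by rewrite lerDr powR_ge0.
  have E4 : L * j%:R `^ varrho * rho <= dl.
    apply: (@le_trans _ _ (L * j%:R `^ varrho * (c2 * j%:R `^ (- (Upsilon / 2))))).
      exact: ler_wpM2l Lj0 _ _ j2.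
    have -> : L * j%:R `^ varrho * (c2 * j%:R `^ (- (Upsilon / 2))) =
        L * c2 * j%:R `^ (- (Upsilon / 2 - varrho)).
      rewrite opprB powRD ?pnatr_eq0 -?lt0n ?j0 ?implybT//; ring.
    move: h2; rewrite ler_pdivlMr// mulrDl mul1r mulrDr => h2.
    apply: le_trans h2; rewrite mulrC lerDr.
    exact: mulr_ge0 (powR_ge0 _ _) (ltW c20).
  rewrite E1 /K; have E5 : dl * 10 = eps by rewrite /dl divfK// pnatr_eq0.
  rewrite -E5 (_ : dl * 10 = 2 * (dl + dl + dl + dl + dl)); last by ring.
  rewrite ler_pM2l//; exact: lerD (lerD (lerD (lerD E3 E4) (lexx _)) (lexx _)) E2.
near=> rho; rewrite sub0r normrN ger0_norm ?normc_ge0//; apply: small.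
- by near: rho; exact: nbhs_right_gt.
- by near: rho; exact: nbhs_right_le.
- by near: rho; exact: nbhs_right_le.
- by near: rho; exact: nbhs_right_le.
- by near: rho; exact: nbhs_right_le.
Unshelve. all: by end_near.
Qed.
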